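(* Let $\mathcal M_3=\mathrm{Spec}\big(\mathbb C[\mathrm{GL}_n^3]^{U^4}\big)$, and let $\overline M_{i,j,k}$ ($(i,j,k)\in\Delta^3(n)$) and $\overline\Phi_3$ be the functions on $\mathcal M_3$ induced by the $U^4$-invariant functions $M_{i,j,k}$ and $\Phi_3$ on $\mathrm{GL}_n^3$. Then: (a) The functions $\overline M_{i,j,k}$ define a positive structure on $(\mathcal M_3,\overline\Phi_3)$: the functions $\overline M_{i,j,k}$ with $(i,j,k)\ne(0,0,0)$ and ($k=0$ or $i=0$) are the coordinate functions of a positive chart, and all $\overline M_{i,j,k}$ are positive functions with respect to it. (b) The Plücker relations $$\overline M_{i+1,j,k+1}\overline M_{i,j+1,k}=\overline M_{i,j+1,k+1}\overline M_{i+1,j,k}+\overline M_{i,j,k+1}\overline M_{i+1,j+1,k}\qquad(i,j,k\ge0,\ i+j+k\le n-2)$$ hold, and they allow one to express every $\overline M_{i,j,k}$ as a rational function of those with $k=0$ or $i=0$, and also as a rational function of those with $i+j+k=n$ or $j=0$. (c) At every tropical point, the inequality $\overline\Phi_3^{\,t}\le0$ is equivalent to the rhombus inequalities $$\overline M^{\,t}_{\underline\alpha_1}+\overline M^{\,t}_{\underline\alpha_3}\le\overline M^{\,t}_{\underline\alpha_2}+\overline M^{\,t}_{\underline\alpha_4}$$ for all small rhombi in $\Delta^3(n)$, with long diagonal $\{\underline\alpha_1,\underline\alpha_3\}$ and short diagonal $\{\underline\alpha_2,\underline\alpha_4\}$. (d) Tropicalization of the Plücker relations gives the octahedron recurrence: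 for all $i,j,k\ge0$ with $i+j+k\le n-2$, $$\overline M^{\,t}_{i+1,j,k+1}+\overline M^{\,t}_{i,j+1,k}=\max\{\overline M^{\,t}_{i,j+1,k+1}+\overline M^{\,t}_{i+1,j,k},\ \overline M^{\,t}_{i,j,k+1}+\overline M^{\,t}_{i+1,j+1,k}\}.$$
   Context: **Groups.** $\mathrm{GL}_n=\mathrm{GL}_n(\mathbb C)$; $U\subset\mathrm{GL}_n$ is the group of unipotent upper triangular matrices. $U^{4}$ acts on $\mathrm{GL}_n^3$ by $(u_0,u_1,u_2,u_3).(g_1,g_2,g_3)=(u_0g_1u_1^{-1},u_1g_2u_2^{-1},u_2g_3u_3^{-1})$. **Minors.** $[1,k]=\{1,\dots,k\}$ (empty if $k\le0$); $I^{\rm op}=\{n+1-a:a\in I\}$; $I+b=\{a+b:a\in I\}$; $\Delta_{I,J}(g)$ is the minor of $g$ with rows $I$ and columns $J$. For $(g_1,g_2,g_3)\in\mathrm{GL}_n^3$ let $\boldsymbol g=[\,\mathrm{Id}_n\ \ g_1\ \ g_1g_2\ \ g_1g_2g_3\,]$ (size $n\times4n$). For $(i,j,k)\in\Delta^3(n):=\{(i,j,k)\in\mathbb Z_{\ge0}^3:i+j+k\le n\}$ the multi-corner minor is $M_{i,j,k}(g_1,g_2,g_3)=\Delta_{[1,n],J}(\boldsymbol g)$, $J=[1,n-i-j-k]\cup([1,i]+n)\cup([1,j]+2n)\cup([1,k]+3n)$. **Potential.** $\Phi_{\rm BK}(g)=\sum_{i=1}^{n-1}\dfrac{\Delta_{([1,i+1]\setminus\{i\})^{\rm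 op},[1,i]}(g)+\Delta_{[1,i]^{\rm op},[1,i+1]\setminus\{i\}}(g)}{\Delta_{[1,i]^{\rm op},[1,i]}(g)}$ and $\Phi_3(g_1,g_2,g_3)=\Phi_{\rm BK}(g_1)+\Phi_{\rm BK}(g_2)+\Phi_{\rm BK}(g_3)-\Phi_{\rm BK}(g_1g_2g_3)$. **Positivity and tropicalization.** A rational function is positive in variables $x_1,\dots,x_d$ if it has a subtraction-free expression (a ratio of polynomials with positive coefficients). For a $d$-dimensional variety $P$ with rational function $\Phi$, a positive chart on $(P,\Phi)$ is an open embedding $\theta:(\mathbb C^* )^d\hookrightarrow P$ such that $\Phi\circ\theta$ is positive; its coordinate functions are the components of the rational inverse $\theta^{-1}$. A function $f$ on $P$ is positive if $f\circ\theta$ is. A positive structure is a collection of positive charts with positive transition maps. The tropicalization $f^t$ of a positive $f$ is the piecewise linear function of real variables $x_1^t,\dots,x_d^t$ obtained from a subtraction-free expression of $f\circ\theta$ by replacing $(+,\times,/)$ by $(\max,+,-)$ and positive constants by $0$; a Laurent polynomial $\sum_a c_a x^a$ with all $c_a>0$ becomes $\max_a\langle a,x^t\rangle$. A tropical point is a point of the space $\mathbb R^d$ of values of $(x_1^t,\dots,x_d^t)$. **Small rhombi.** Setting $x_0=n-x_1-x_2-x_3$, identify $\Delta^3(n)$ with $\{x\in\mathbb Z_{\ge0}^4:x_0+\dots+x_3=n\}$, with basis vectors $e_0,\dots,e_3$. For pairwise distinct $a,b,c\in\{0,1,2,3\}$ and $y\in\mathbb Z^4_{\ge0}$ with $\sum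 y_i=n-2$, there is a small rhombus with short diagonal $\{y+e_a+e_b,y+e_a+e_c\}$ and long diagonal $\{y+2e_a,y+e_b+e_c\}$; these are all small rhombi. *)

(* Defs.v *)
(* The complex numbers are R[i], for R : realType. *)
From HB Require Import structures.
From mathcomp Require Import all_boot all_order all_algebra.
From mathcomp Require Import boolp classical_sets functions.
From mathcomp Require Import reals constructive_ereal.
From mathcomp Require Import complex.

Set Implicit Arguments.
Unset Strict Implicit.
Unset Printing Implicit Defensive.

Import Order.TTheory GRing.Theory Num.Theory.

Local Open Scope ring_scope.
Local Open Scope complex_scope.

Section GLn.
Variables (R : realType) (n : nat).

Record GL := MkGL { glval :> 'M[R[i]]_n; glvalP : glval \in unitmx }.

HB.instance Definition _ := [isSub for glval].
HB.instance Definition _ := [Choice of GL by <:].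

Definition GL_one : GL := MkGL (unitmx1 _ n).

Lemma GL_mul_subproof (g h : GL) : (g : 'M_n) *m h \in unitmx.
Proof. by rewrite unitmx_mul !glvalP. Qed.
Definition GL_mul (g h : GL) : GL := MkGL (GL_mul_subproof g h).

Lemma GL_inv_subproof (g : GL) : invmx g \in unitmx.
Proof. by rewrite unitmx_inv glvalP. Qed.
Definition GL_inv (g : GL) : GL := MkGL (GL_inv_subproof g).

Lemma GL_mulA : associative GL_mul.
Proof. by move=> f g h; apply: val_inj; apply: mulmxA. Qed.
Lemma GL_mul1 : left_id GL_one GL_mul.
Proof. by move=> g; apply: val_inj; apply: mul1mx. Qed.
Lemma GL_mulr1 : right_id GL_one GL_mul.
Proof. by move=> g; apply: val_inj; apply: mulmx1. Qed.
Lemma GL_mulV : left_inverse GL_one GL_inv GL_mul.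
Proof. by move=> g; apply: val_inj; apply: (mulVmx (glvalP g)). Qed.
Lemma GL_mulrV : right_inverse GL_one GL_inv GL_mul.
Proof. by move=> g; apply: val_inj; apply: (mulmxV (glvalP g)). Qed.

HB.instance Definition _ :=
  isGroup.Build GL GL_mulA GL_mul1 GL_mulr1 GL_mulV GL_mulrV.

Definition GL3 : Type := (GL * GL * GL)%type.

Definition unipotent (u : GL) : Prop :=
  forall i j : 'I_n, (j <= i)%N -> u i j = (i == j)%:R.

Definition act (u0 u1 u2 u3 : GL) (g : GL3) : GL3 :=
  ((u0 * g.1.1 * u1^-1)%g, (u1 * g.1.2 * u2^-1)%g, (u2 * g.2 * u3^-1)%g).

End GLn.

Inductive generated_algebra (C : pzRingType) (T : Type) (G : (T -> C) -> Prop) :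
    (T -> C) -> Prop :=
| gen_mem f : G f -> generated_algebra G f
| gen_cst c : generated_algebra G (fun=> c)
| gen_add f g : generated_algebra G f -> generated_algebra G g ->
    generated_algebra G (fun x => f x + g x)
| gen_mul f g : generated_algebra G f -> generated_algebra G g ->
    generated_algebra G (fun x => f x * g x).

Section InvariantRing.
Variables (R : realType) (n : nat).
Local Notation C := R[i].
Local Notation GL3 := (GL3 R n).

Variant GL3_generator : (GL3 -> C) -> Prop :=
| entry1 i j : GL3_generator (fun g => g.1.1 i j)
| entry2 i j : GL3_generator (fun g => g.1.2 i j)
| entry3 i j : GL3_generator (fun g => g.2 i j)
| invdet1 : GL3_generator (fun g => (\det g.1.1)^-1)
| invdet2 : GL3_generator (fun g => (\det g.1.2)^-1)
| invdet3 : GL3_generator (fun g => (\det g.2)^-1).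

Definition regular_GL3 (f : GL3 -> C) : Prop :=
  generated_algebra GL3_generator f.

Definition U4_invariant (f : GL3 -> C) : Prop :=
  forall u0 u1 u2 u3 : GL R n,
    unipotent u0 -> unipotent u1 -> unipotent u2 -> unipotent u3 ->
    forall g : GL3, f (act u0 u1 u2 u3 g) = f g.

Definition regular_invariant : {pred GL3 -> C} :=
  [pred f | `[< regular_GL3 f /\ U4_invariant f >]].

(* The coordinate ring C[GL_n^3]^{U^4} of M_3. *)
Record invariants :=
  MkInv { inv_fun :> GL3 -> C; inv_funP : inv_fun \in regular_invariant }.

HB.instance Definition _ := [isSub for inv_fun].
HB.instance Definition _ := [Choice of invariants by <:].

Lemma regular_invariantZ (a : C) (f : GL3 -> C) :
  f \in regular_invariant -> a *: f \in regular_invariant.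
Proof.
move=> /asboolP[rf If]; apply/asboolP; split.
  exact: (gen_mul (gen_cst _ a) rf).
by move=> *; congr (a * _); apply: If.
Qed.

Lemma regular_invariant_subring : subring_closed regular_invariant.
Proof.
split.
- by apply/asboolP; split => //; apply: gen_cst.
- move=> f g fP /(regular_invariantZ (-1)).
  move: fP => /asboolP[rf If] /asboolP[rg Ig]; apply/asboolP.
  have -> : f - g = fun x => f x + ((-1) *: g) x.
    by apply/funext => x; rewrite -[(_ *: g) x]/(-1 * g x) mulN1r.
  split; first exact: gen_add.
  by move=> *; congr (_ + _); [apply: If | apply: Ig].
- move=> f g /asboolP[rf If] /asboolP[rg Ig]; apply/asboolP; split.
    exact: gen_mul.
  by move=> *; congr (_ * _); [apply: If | apply: Ig].
Qed.

HB.instance Definition _ :=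
  GRing.isSubringClosed.Build (GL3 -> C) regular_invariant
    regular_invariant_subring.
HB.instance Definition _ :=
  GRing.SubChoice_isSubComPzRing.Build (GL3 -> C) regular_invariant invariants
    regular_invariant_subring.

Lemma regular_invariant_scaler : GRing.scaler_closed regular_invariant.
Proof. exact: regular_invariantZ. Qed.
HB.instance Definition _ :=
  GRing.isScaleClosed.Build C (GL3 -> C) regular_invariant
    regular_invariant_scaler.
HB.instance Definition _ := [SubZmodule_isSubLmodule of invariants by <:].

Lemma invariants_oner_neq0 : 1 != 0 :> invariants.
Proof.
apply/eqP => /(congr1 (fun f : invariants => f (GL_one R n, GL_one R n, GL_one R n))).
by move=> /eqP; rewrite oner_eq0.
Qed.
HB.instance Definition _ :=
  GRing.PzSemiRing_isNonZero.Build invariants invariants_oner_neq0.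

Lemma invariants_scalerAl (a : C) (f g : invariants) : a *: (f * g) = a *: f * g.
Proof. by apply: val_inj; apply/funext => x; apply: mulrA. Qed.
HB.instance Definition _ :=
  GRing.Lmodule_isLalgebra.Build C invariants invariants_scalerAl.
HB.instance Definition _ := GRing.Lalgebra_isComAlgebra.Build C invariants.

End InvariantRing.

(* Rows and columns are taken in increasing order; the minor is 0 by convention
   if #|I| and #|J| differ.  An element a of 'I_m stands for the index a + 1 of
   the usual 1-based numbering. *)
Definition minor (K : comPzRingType) (m p : nat) (A : 'M[K]_(m, p))
    (I : {set 'I_m}) (J : {set 'I_p}) : K :=
  if #|I| =P #|J| is ReflectT e
  then \det (mxsub (fun a : 'I_#|I| => enum_val a)
                   (fun b : 'I_#|I| => enum_val (cast_ord e b)) A)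
  else 0.

(* In 1-based numbering: seg n k is [1, k], seg_skip n i is [1, i+1] minus {i}. *)
Definition seg (n k : nat) : {set 'I_n} := [set a : 'I_n | a.+1 <= k]%N.
Definition seg_skip (n i : nat) : {set 'I_n} :=
  [set a : 'I_n | (a.+1 <= i.+1)%N && (a.+1 != i)].
Definition opset (n : nat) (I : {set 'I_n}) : {set 'I_n} :=
  [set rev_ord a | a in I].

Section Potential.
Variables (R : realType) (n : nat).
Local Notation C := R[i].
Local Notation GL := (GL R n).
Local Notation GL3 := (GL3 R n).

Definition bold (g : GL3) : 'M[C]_(n, n + (n + (n + n))) :=
  row_mx 1%:M (row_mx g.1.1 (row_mx (g.1.1 *m g.1.2) (g.1.1 *m g.1.2 *m g.2))).

(* [1, n-i-j-k] u ([1,i] + n) u ([1,j] + 2n) u ([1,k] + 3n) *)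
Definition multi_corner_cols (i j k : nat) : {set 'I_(n + (n + (n + n)))} :=
  [set c : 'I_(n + (n + (n + n))) |
     [|| 0 < c.+1 <= n - i - j - k,
         n < c.+1 <= n + i,
         2 * n < c.+1 <= 2 * n + j
       | 3 * n < c.+1 <= 3 * n + k]%N].

Definition multi_corner (i j k : nat) (g : GL3) : C :=
  minor (bold g) [set: 'I_n] (multi_corner_cols i j k).

Definition BK_den (i : nat) (g : GL) : C := minor g (opset (seg n i)) (seg n i).

Definition Phi_BK (g : GL) : C :=
  \sum_(1 <= i < n)
    (minor g (opset (seg_skip n i)) (seg n i)
     + minor g (opset (seg n i)) (seg_skip n i)) / BK_den i g.

Definition Phi_BK_defined (g : GL) : Prop :=
  forall i, (1 <= i < n)%N -> BK_den i g != 0.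

Definition Phi3 (g : GL3) : C :=
  Phi_BK g.1.1 + Phi_BK g.1.2 + Phi_BK g.2 - Phi_BK (g.1.1 * g.1.2 * g.2)%g.

Definition Phi3_defined (g : GL3) : Prop :=
  [/\ Phi_BK_defined g.1.1, Phi_BK_defined g.1.2, Phi_BK_defined g.2
    & Phi_BK_defined (g.1.1 * g.1.2 * g.2)%g].

End Potential.

Inductive expr (K I : Type) : Type :=
| Const of K
| Var of I
| Add of expr K I & expr K I
| Mul of expr K I & expr K I
| Div of expr K I & expr K I.

Section Expr.
Variables (R : realType) (I : Type).
Local Notation C := R[i].

Fixpoint eval (t : I -> C) (e : expr C I) : C :=
  match e with
  | Const c => c
  | Var i => t i
  | Add e1 e2 => eval t e1 + eval t e2
  | Mul e1 e2 => eval t e1 * eval t e2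
  | Div e1 e2 => eval t e1 / eval t e2
  end.

Fixpoint defined_at (t : I -> C) (e : expr C I) : bool :=
  match e with
  | Const _ | Var _ => true
  | Add e1 e2 | Mul e1 e2 => defined_at t e1 && defined_at t e2
  | Div e1 e2 => [&& defined_at t e1, defined_at t e2 & eval t e2 != 0]
  end.

(* The constant 0 (the empty sum) is allowed, so that the zero function is
   positive, with tropicalization -oo; this occurs for Phi_3 when n = 1.
   [0 <= c] says that c is a nonnegative real number. *)
Fixpoint subtraction_free (e : expr C I) : bool :=
  match e with
  | Const c => 0 <= c
  | Var _ => true
  | Add e1 e2 | Mul e1 e2 | Div e1 e2 =>
      subtraction_free e1 && subtraction_free e2
  end.

Fixpoint trop (x : I -> R) (e : expr C I) : \bar R :=
  match e with
  | Const c => if c == 0 then -oo%E else 0%E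
  | Var i => (x i)%:E
  | Add e1 e2 => maxe (trop x e1) (trop x e2)
  | Mul e1 e2 => (trop x e1 + trop x e2)%E
  | Div e1 e2 => (trop x e1 - trop x e2)%E
  end.

End Expr.

Section Charts.
Variables (R : realType) (A : comAlgType R[i]).
Local Notation C := R[i].

(* The (closed) points of Spec A; f : A is the function p |-> p f. *)
Definition spec_pt : Type := {lrmorphism A -> C^o}.

(* Spec A is meant to be irreducible (A a domain), so that ratfun is its
   function field and nonempty open sets are dense. *)
Record ratfun := RatFun { rnum : A; rden : A; rden_neq0 : rden != 0 }.

Definition regfun (f : A) : ratfun := @RatFun f 1 (oner_neq0 A).

Definition zariski_open (V : set spec_pt) : Prop :=
  exists S : set A, V = [set p | exists2 f, S f & p f != 0]%classic.

Variable I : finType.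

Record torus := Torus { coord :> {ffun I -> C};
                        coord_neq0 : forall i, coord i != 0 }.

Variant laurent_generator : (torus -> C) -> Prop :=
| laurent_var i : laurent_generator (fun t => t i)
| laurent_inv i : laurent_generator (fun t => (t i)^-1).

Definition laurent (f : torus -> C) : Prop :=
  generated_algebra laurent_generator f.

(* An isomorphism of varieties from the torus onto an open subset of Spec A:
   the last condition says that the components of the inverse are regular,
   i.e. locally quotients of elements of A. *)
Record open_embedding (theta : torus -> spec_pt) : Prop := {
  embedding_morphism : forall f : A, laurent (fun t => theta t f);
  embedding_injective : injective theta;
  embedding_open : zariski_open (range theta);
  embedding_inverse : forall (i : I) (t : torus), exists f g : A,
    theta t g != 0 /\
    forall s : torus, theta s g != 0 -> s i = theta s f / theta s g }.

(* r o theta = e as rational functions on the torus. *)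
Definition pullback_is (theta : torus -> spec_pt) (r : ratfun) (e : expr C I) :
    Prop :=
  (exists t : torus, (theta t (rden r) != 0) && defined_at t e) /\
  forall t : torus, theta t (rden r) != 0 -> defined_at t e ->
    theta t (rnum r) / theta t (rden r) = eval t e.

Definition positive_ratfun (theta : torus -> spec_pt) (r : ratfun) : Prop :=
  exists2 e, subtraction_free e & pullback_is theta r e.

Definition positive_chart (Phi : ratfun) (theta : torus -> spec_pt) : Prop :=
  open_embedding theta /\ positive_ratfun theta Phi.

(* r is the i-th component of the rational inverse of theta. *)
Definition coordinate_function (theta : torus -> spec_pt) (i : I) (r : ratfun) :
    Prop :=
  pullback_is theta r (Var C i).

Definition positive_structure (Phi : ratfun) (D : set (torus -> spec_pt)) : Prop :=
  (forall theta, D theta -> positive_chart Phi theta) /\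
  forall theta theta', D theta -> D theta' ->
    forall i r, coordinate_function theta' i r -> positive_ratfun theta r.

(* T = r^t, as a function of the tropical coordinates x. *)
Definition tropicalization (theta : torus -> spec_pt) (r : ratfun)
    (T : (I -> R) -> \bar R) : Prop :=
  exists e, [/\ subtraction_free e, pullback_is theta r e
              & forall x, T x = trop x e].

End Charts.

Definition Delta3_sub (n : nat) (P : nat -> nat -> nat -> bool) : Type :=
  {a : 'I_n.+1 * 'I_n.+1 * 'I_n.+1 |
     (a.1.1 + a.1.2 + a.2 <= n)%N && P a.1.1 a.1.2 a.2}.
HB.instance Definition _ n P := Finite.on (Delta3_sub n P).

Definition at_Delta3 (T : Type) (n : nat) (P : nat -> nat -> nat -> bool)
    (m : nat -> nat -> nat -> T) (s : Delta3_sub n P) : T :=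
  m (val s).1.1 (val s).1.2 (val s).2.

Definition on_k0_i0 (i j k : nat) : bool := (k == 0) || (i == 0).
Definition on_top_j0 (n i j k : nat) : bool := (i + j + k == n)%N || (j == 0).
Definition chart_index (i j k : nat) : bool :=
  ((i, j, k) != (0, 0, 0)) && on_k0_i0 i j k.

Definition pluecker (K : pzRingType) (n : nat) (m : nat -> nat -> nat -> K) :
    Prop :=
  forall i j k, (i + j + k + 2 <= n)%N ->
    m i.+1 j k.+1 * m i j.+1 k
    = m i j.+1 k.+1 * m i.+1 j k + m i j k.+1 * m i.+1 j.+1 k.

(* The Pluecker relations allow one to solve for m i j k as the rational
   expression e in the entries of m indexed by P. *)
Definition pluecker_solves (R : realType) (n : nat)
    (P : nat -> nat -> nat -> bool) (i j k : nat)
    (e : expr R[i] (Delta3_sub n P)) : Prop :=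
  forall m : nat -> nat -> nat -> R[i],
    (forall a b c, (a + b + c <= n)%N -> m a b c != 0) -> pluecker n m ->
    defined_at (at_Delta3 m) e /\ m i j k = eval (at_Delta3 m) e.

(* h = e(F) as rational functions on Spec A. *)
Definition rational_in (R : realType) (A : comAlgType R[i]) (I : Type)
    (F : I -> A) (h : A) (e : expr R[i] I) : Prop :=
  (exists p : spec_pt A, defined_at (fun s => p (F s)) e) /\
  forall p : spec_pt A, defined_at (fun s => p (F s)) e ->
    p h = eval (fun s => p (F s)) e.

(* F at the point (x_0, x_1, x_2, x_3) of the simplex, and y + e_a + e_b. *)
Definition at_simplex (T : Type) (F : nat -> nat -> nat -> T)
    (x : 'I_4 -> nat) : T :=
  F (x (inord 1)) (x (inord 2)) (x (inord 3)).
Definition shift2 (y : 'I_4 -> nat) (a b : 'I_4) : 'I_4 -> nat :=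
  fun m => (y m + (m == a) + (m == b))%N.

Definition rhombus_inequalities (R : realType) (n : nat)
    (F : nat -> nat -> nat -> \bar R) : Prop :=
  forall (y : 'I_4 -> nat) (a b c : 'I_4),
    ((\sum_m y m) + 2 = n)%N -> uniq [:: a; b; c] ->
    (at_simplex F (shift2 y a a) + at_simplex F (shift2 y b c)
     <= at_simplex F (shift2 y a b) + at_simplex F (shift2 y a c))%E.

Definition octahedron_recurrence (R : realType) (n : nat)
    (F : nat -> nat -> nat -> \bar R) : Prop :=
  forall i j k, (i + j + k + 2 <= n)%N ->
    (F i.+1 j k.+1 + F i j.+1 k
     = maxe (F i j.+1 k.+1 + F i.+1 j k) (F i j k.+1 + F i.+1 j.+1 k))%E.

(* Main.v *)
(* The multi-corner minors are determinants of the first vectors of four bases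
   (the columns of Id, g1, g1g2 and g1g2g3), so the three-term Plücker relation
   holds for any two of them that differ in two vectors.  For a flag basis A and
   a list Y put W_A(l; Y) = [A'_l Y] / [A_l Y], where A'_l is A_l with its last
   vector replaced by the next one.  Then Phi_BK is a sum of such ratios, and by
   the Plücker relation W_A(l; Y b) - W_A(l; Y c) is, up to sign, a single small
   rhombus ratio; telescoping writes Phi_3 as the sum of the rhombus ratios of
   the faces k = 0 and i = 0 of the simplex.

   A generic U^4-orbit has a unique representative with g1g2 antidiagonal and
   with g1 and g1g2g3 lower triangular; column by column it solves a triangular
   linear system whose pivots are monomials in the minors of the two faces.  So
   its entries are Laurent polynomials in these minors, and the representative
   inverts the chart.

   The tropicalization of an expression is its growth rate along t_i = exp(s x_i),
   hence depends only on the rational function.  Finally, the rhombi of a vertex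
   sharing a small triangle satisfy the tropical relation
   r(bd) = max(r(bc), r(cd)), which propagates the inequalities from the two
   faces to the whole simplex. *)
Require Import Defs.
From HB Require Import structures.
From mathcomp Require Import all_boot all_order all_algebra perm.
From mathcomp Require Import boolp classical_sets functions.
From mathcomp Require Import reals constructive_ereal.
From mathcomp Require Import sequences exp.
From mathcomp Require Import complex.
From mathcomp Require Import zify ring lra.

Set Implicit Arguments.
Unset Strict Implicit.
Unset Printing Implicit Defensive.

Import Order.TTheory GRing.Theory Num.Theory.

Local Open Scope ring_scope.

(** * Determinants of lists of vectors *)

(** A point of the spectrum is an arbitrary algebra morphism, not given as evaluation at a triple,
    whereas the minors are computed on triples. The image of the chart is therefore found through an
    identity in the ring. Along the normal forms an invariant f is a Laurent polynomial in the face
    minors, so f P^k = q with P the product of the coordinate minors and q a polynomial in them.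
    This is checked on triples with P nonzero; one more factor P makes it true on all triples, and
    it can then be evaluated at any morphism.

    Parts (c) and (d) concern arbitrary subtraction-free expressions, which may contain the constant
    0 and be undefined at some torus points. On the positive rays t = exp(s x) this does no harm: an
    expression defined at one point is defined along the whole ray, and all minors are positive
    there, because the Plücker relations compute them without subtraction.

    The two faces come from a triangulation: Phi_3 runs along the boundary of a quadrilateral 0123
    of flags, and the diagonal 02 cuts it into the triangles 012 (k = 0) and 023 (i = 0). *)

Lemma nth_mid (T : Type) (x0 x y : T) s1 s2 i : i != size s1 ->
  nth x0 (s1 ++ x :: s2) i = nth x0 (s1 ++ y :: s2) i.
Proof.
move=> ne; rewrite !nth_cat; case: (ltngtP i (size s1)) ne => // lt _.
by rewrite -[(i - size s1)%N]prednK ?subn_gt0.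
Qed.

Section ListDeterminant.
Variables (K : comNzRingType) (n : nat).
Implicit Types (s : seq 'rV[K]_n) (x y v : 'rV[K]_n).

(** Short lists are padded with zero rows and long ones truncated, so lengths are hypotheses of the
    lemmas and not part of the type. *)
Definition ldet s : K := \det (\matrix_(i < n) nth 0 s i).

Lemma ldet_eq0 s i j : (i < j < n)%N -> nth 0 s i = nth 0 s j -> ldet s = 0.
Proof.
move=> /andP[ij jn] e; have i_n := ltn_trans ij jn.
apply: (determinant_alternate (i1 := Ordinal i_n) (i2 := Ordinal jn)).
  by rewrite -val_eqE /= neq_ltn ij.
by move=> k; rewrite !mxE /= e.
Qed.

Lemma ldet_linear s1 s2 (a : K) x y : (size s1 < n)%N ->
  ldet (s1 ++ (a *: x + y) :: s2) = a * ldet (s1 ++ x :: s2) + ldet (s1 ++ y :: s2).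
Proof.
move=> sn; rewrite -[ldet (_ ++ y :: _)]mul1r.
have e : forall z w, row' (Ordinal sn) (\matrix_(i < n) nth 0 (s1 ++ z :: s2) i) =
         row' (Ordinal sn) (\matrix_(i < n) nth 0 (s1 ++ w :: s2) i).
  move=> z w; apply/matrixP=> i j; rewrite !mxE; congr (fun_of_matrix _ _ _).
  apply: nth_mid; rewrite -[size s1]/(val (Ordinal sn)) val_eqE.
  by rewrite eq_sym; apply: neq_lift.
apply: (@determinant_multilinear _ _ _ _ _ (Ordinal sn)); [|exact: e|exact: e].
by rewrite !rowK /= !nth_cat ltnn subnn scale1r.
Qed.

Lemma ldet_add s1 s2 x y : (size s1 < n)%N ->
  ldet (s1 ++ (x + y) :: s2) = ldet (s1 ++ x :: s2) + ldet (s1 ++ y :: s2).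
Proof. by move=> sn; rewrite -{1}[x]scale1r ldet_linear// mul1r. Qed.

Lemma ldet_0 s1 s2 : (size s1 < n)%N -> ldet (s1 ++ 0 :: s2) = 0.
Proof.
move=> sn; apply: (addrI (ldet (s1 ++ 0 :: s2))).
by rewrite -ldet_add// !addr0.
Qed.

Lemma ldet_scale s1 s2 a x : (size s1 < n)%N ->
  ldet (s1 ++ a *: x :: s2) = a * ldet (s1 ++ x :: s2).
Proof. by move=> sn; rewrite -[a *: x]addr0 ldet_linear// ldet_0// addr0. Qed.

Lemma ldet_sum s1 s2 (I : Type) (r : seq I) (P : pred I) (a : I -> K)
    (f : I -> 'rV_n) : (size s1 < n)%N ->
  ldet (s1 ++ (\sum_(i <- r | P i) a i *: f i) :: s2)
  = \sum_(i <- r | P i) a i * ldet (s1 ++ f i :: s2).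
Proof.
move=> sn; elim: r => [|i r IH]; first by rewrite !big_nil ldet_0.
by rewrite !big_cons; case: ifP => // _; rewrite ldet_linear// IH.
Qed.

Lemma ldet_coord s1 s2 v : (size s1 < n)%N ->
  ldet (s1 ++ v :: s2) = \sum_c v 0 c * ldet (s1 ++ delta_mx 0 c :: s2).
Proof. by move=> sn; rewrite {1}[v]row_sum_delta ldet_sum. Qed.

Lemma ldet_swap s1 s2 x y : ((size s1).+1 < n)%N ->
  ldet (s1 ++ x :: y :: s2) = - ldet (s1 ++ y :: x :: s2).
Proof.
move=> sn; have sn' := ltnW sn.
have dup z : ldet (s1 ++ z :: z :: s2) = 0.
  apply: (@ldet_eq0 _ (size s1) (size s1).+1); first by rewrite ltnSn.
  by rewrite !nth_cat ltnn subnn ltnNge leqnSn /= subSnn.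
have rc z w : s1 ++ z :: w :: s2 = rcons s1 z ++ w :: s2 by rewrite cat_rcons.
have := dup (x + y); rewrite ldet_add// !rc !ldet_add ?size_rcons//.
by rewrite -!rc !dup add0r addr0 => /eqP; rewrite addr_eq0 => /eqP.
Qed.

Lemma ldet_move s1 s2 s3 x : (size s1 + size s2 < n)%N ->
  ldet (s1 ++ x :: s2 ++ s3) = (-1) ^+ size s2 * ldet (s1 ++ s2 ++ x :: s3).
Proof.
elim: s2 s1 => [|y s2 IH] s1 /= sn; first by rewrite mul1r.
rewrite ldet_swap; last by lia.
by rewrite -cat_rcons IH ?size_rcons ?cat_rcons; [rewrite exprS; ring | lia].
Qed.

Lemma ldet_cat_swap s1 s2 s3 s4 : (size s1 + size s2 + size s3 <= n)%N ->
  ldet (s1 ++ s2 ++ s3 ++ s4)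
  = (-1) ^+ (size s2 * size s3) * ldet (s1 ++ s3 ++ s2 ++ s4).
Proof.
elim/last_ind: s2 s4 => [|s2 x IH] s4 /= sn; first by rewrite mul1r.
rewrite size_rcons in sn; rewrite cat_rcons catA ldet_move ?size_cat; last by lia.
rewrite -catA IH; last by lia.
by rewrite size_rcons cat_rcons mulrA -exprD; congr (_ ^+ _ * _); lia.
Qed.

Lemma ldet_mul (A : 'M[K]_n) s : size s = n ->
  ldet [seq v *m A | v <- s] = ldet s * \det A.
Proof.
move=> sn; rewrite -det_mulmx; congr (\det _); apply/row_matrixP=> i.
by rewrite row_mul !rowK (nth_map 0) ?sn.
Qed.

(** The last f' is first left in the tail while the earlier ones are replaced by the f; its
    correction terms then repeat vectors already in the list. *)
Lemma ldet_unipotent s1 s2 k (f f' : nat -> 'rV[K]_n) (a : nat -> nat -> K) :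
  (size s1 + k <= n)%N ->
  (forall i, (i < k)%N -> f' i = f i + \sum_(j < i) a i j *: f j) ->
  ldet (s1 ++ mkseq f' k ++ s2) = ldet (s1 ++ mkseq f k ++ s2).
Proof.
elim: k s2 => [|k IH] s2 // kn ff'.
rewrite !mkseqS !cat_rcons IH; [|lia|by move=> i ik; apply: ff'; lia].
have szn : (size (s1 ++ mkseq f k) < n)%N by rewrite size_cat size_mkseq; lia.
rewrite ff'// catA ldet_add// ldet_sum// big1 ?addr0 ?catA// => j _.
rewrite (@ldet_eq0 _ (size s1 + j) (size s1 + k)) ?mulr0//; first by move: (ltn_ord j); lia.
rewrite !nth_cat !size_cat !size_mkseq ltnn subnn ltn_add2l ltn_ord.
by rewrite ltnNge leq_addr /= addKn nth_mkseq.
Qed.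

End ListDeterminant.

Section ThreeTermRelation.
Variables (F : fieldType) (m : nat) (Z : seq 'rV[F]_(m.+2)).
Hypothesis size_Z : size Z = m.
Local Notation phi x y := (ldet (Z ++ [:: x; y])).

Lemma ldet_last2_anti x y : phi x y = - phi y x.
Proof. by rewrite ldet_swap ?size_Z. Qed.

(** An alternating form that factors through the quotient by the span of [Z]. If it is nonzero this
    quotient is a plane, and the form is a multiple of the 2x2 determinant, for which the three-term
    relation is a polynomial identity. *)
Lemma ldet_last2_coords : exists l1 l2 : 'rV[F]_(m.+2) -> F, exists c : F,
  forall x y, phi x y = c * (l1 x * l2 y - l2 x * l1 y).
Proof.
have [[a [b ab]]|no] := boolp.EM (exists a b, phi a b != 0); last first.
  exists (fun=> 0), (fun=> 0), 0 => x y; rewrite mul0r; apply/eqP/negPn/negP => h.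
  by apply: no; exists x, y.
pose B := \matrix_(i < m.+2) nth 0 (Z ++ [:: a; b]) i.
have Bu : B \in unitmx by rewrite unitmxE unitfE.
pose w (x : 'rV[F]_(m.+2)) := x *m invmx B.
(* The coordinates on a and b, the last two vectors of the basis [Z], a, b. *)
exists (fun x => w x 0 (inord m)), (fun x => w x 0 ord_max), (phi a b) => x y.
have dup z i : (i < m)%N -> phi (nth 0 Z i) z = 0.
  move=> im; apply: (@ldet_eq0 _ _ _ i m); first by rewrite im leqnSn.
  by rewrite !nth_cat size_Z ltnn subnn im.
have e x' : x' = \sum_i w x' 0 i *: nth 0 (Z ++ [:: a; b]) i.
  rewrite -[LHS](mulmxKV Bu) -/(w x') mulmx_sum_row.
  by apply: eq_bigr => i _; rewrite rowK.
have lin x' z : phi x' z = w x' 0 (inord m) * phi a z + w x' 0 ord_max * phi b z.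
  rewrite {1}[x']e ldet_sum ?size_Z// big_ord_recr big_ord_recr /= big1 => [|i _].
    rewrite add0r !nth_cat size_Z ltnn subnn ltnNge leqnSn /= subSnn /=.
    by congr (w x' 0 _ * _ + _); apply: val_inj; rewrite /= inordK.
  by rewrite nth_cat size_Z ltn_ord dup ?mulr0.
have phi0 z : phi z z = 0.
  apply: (@ldet_eq0 _ _ _ m m.+1); first by rewrite !ltnSn.
  by rewrite !nth_cat size_Z ltnn subnn ltnNge leqnSn /= subSnn.
rewrite (lin x y) (ldet_last2_anti a y) (ldet_last2_anti b y) (lin y a) (lin y b) !phi0.
by rewrite (ldet_last2_anti b a); ring.
Qed.

Lemma three_term a b c d :
  phi a c * phi b d = phi a b * phi c d + phi a d * phi b c.
Proof. by have [l1 [l2 [k h]]] := ldet_last2_coords; rewrite !h; ring. Qed.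

End ThreeTermRelation.

(** * Brackets of flags and potentials of triangles *)

Definition mkskip (T : Type) (f : nat -> T) (l : nat) : seq T :=
  rcons (mkseq f l.-1) (f l).

Definition bracket (K : comNzRingType) n (f0 f1 f2 f3 : nat -> 'rV[K]_n) (x0 x1 x2 x3 : nat) : K :=
  ldet (mkseq f0 x0 ++ mkseq f1 x1 ++ mkseq f2 x2 ++ mkseq f3 x3).

Section Brackets.
Variables (F : fieldType) (n : nat).
Implicit Types (s Z : seq 'rV[F]_n) (f : nat -> 'rV[F]_n).

Lemma ldet_three_term Z a b c d : (size Z).+2 = n ->
  ldet (Z ++ [:: a; c]) * ldet (Z ++ [:: b; d])
  = ldet (Z ++ [:: a; b]) * ldet (Z ++ [:: c; d])
    + ldet (Z ++ [:: a; d]) * ldet (Z ++ [:: b; c]).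
Proof.
by case: n Z a b c d => [|[|m]] Z a b c d // [sz]; apply: three_term.
Qed.

(** y crosses [s3], then x crosses [s2] and [s3]; the two crossings of [s3] cancel in the sign. *)
Lemma ldet_pull2 s1 s2 s3 x y : (size (s1 ++ s2 ++ s3)).+2 = n ->
  ldet (s1 ++ x :: s2 ++ y :: s3)
  = (-1) ^+ size s2 * ldet ((s1 ++ s2 ++ s3) ++ [:: x; y]).
Proof.
rewrite !size_cat => sz.
have := @ldet_move _ _ (s1 ++ x :: s2) s3 [::] y.
rewrite cats0 -!catA !cat_cons => ->; last by rewrite size_cat /=; lia.
have := @ldet_move _ _ s1 (s2 ++ s3) [:: y] x.
rewrite -!catA => ->; last by rewrite size_cat /=; lia.
by rewrite mulrA -exprD size_cat addnC -addnA exprD addnn -mul2n exprM sqrrN expr1n expr1n mulr1.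
Qed.

Section FourBlocks.
Variables A0 A1 A2 A3 : seq 'rV[F]_n.
Hypothesis sz : (size (A0 ++ A1 ++ A2 ++ A3)).+2 = n.
Local Notation phi x y := (ldet ((A0 ++ A1 ++ A2 ++ A3) ++ [:: x; y])).

(** In this lemma and its variants the two digits name the blocks that are lengthened by one vector
    each. *)
Lemma ldet_block00 x y :
  ldet (A0 ++ x :: y :: A1 ++ A2 ++ A3) = phi x y.
Proof. by have := @ldet_pull2 A0 [::] (A1 ++ A2 ++ A3) x y sz; rewrite mul1r. Qed.

Lemma ldet_block11 x y :
  ldet (A0 ++ A1 ++ x :: y :: A2 ++ A3) = phi x y.
Proof.
by have := @ldet_pull2 (A0 ++ A1) [::] (A2 ++ A3) x y; rewrite mul1r -!catA; apply.
Qed.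

Lemma ldet_block01 x y :
  ldet (A0 ++ x :: A1 ++ y :: A2 ++ A3) = (-1) ^+ size A1 * phi x y.
Proof. exact: ldet_pull2. Qed.

Lemma ldet_block02 x y :
  ldet (A0 ++ x :: A1 ++ A2 ++ y :: A3) = (-1) ^+ (size A1 + size A2) * phi x y.
Proof.
by have := @ldet_pull2 A0 (A1 ++ A2) A3 x y; rewrite -!catA => ->//; rewrite size_cat.
Qed.

Lemma ldet_block03 x y :
  ldet (A0 ++ x :: A1 ++ A2 ++ rcons A3 y)
  = (-1) ^+ (size A1 + size A2 + size A3) * phi x y.
Proof.
have := @ldet_pull2 A0 (A1 ++ A2 ++ A3) [::] x y.
by rewrite -cats1 -!catA cats0 => ->//; rewrite !size_cat addnA.
Qed.

Lemma ldet_block12 x y :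
  ldet (A0 ++ A1 ++ x :: A2 ++ y :: A3) = (-1) ^+ size A2 * phi x y.
Proof.
by have := @ldet_pull2 (A0 ++ A1) A2 A3 x y; rewrite -!catA; apply.
Qed.

Lemma ldet_block13 x y :
  ldet (A0 ++ A1 ++ x :: A2 ++ rcons A3 y)
  = (-1) ^+ (size A2 + size A3) * phi x y.
Proof.
have := @ldet_pull2 (A0 ++ A1) (A2 ++ A3) [::] x y.
by rewrite -cats1 -!catA cats0 => ->//; rewrite size_cat.
Qed.

Lemma ldet_block23 x y :
  ldet (A0 ++ A1 ++ A2 ++ x :: rcons A3 y) = (-1) ^+ size A3 * phi x y.
Proof.
have := @ldet_pull2 (A0 ++ A1 ++ A2) A3 [::] x y.
by rewrite -cats1 -!catA cats0 => ->.
Qed.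

End FourBlocks.

(** The three-term relation for the next vector of each of the four flags. Moving them to the end
    costs the same sign (-1)^(x1 + x3) in all three products. *)
Lemma bracket_pluecker f0 f1 f2 f3 x0 x1 x2 x3 : (x0 + x1 + x2 + x3).+2 = n ->
  bracket f0 f1 f2 f3 x0 x1.+1 x2 x3.+1 * bracket f0 f1 f2 f3 x0.+1 x1 x2.+1 x3
  = bracket f0 f1 f2 f3 x0 x1 x2.+1 x3.+1 * bracket f0 f1 f2 f3 x0.+1 x1.+1 x2 x3
  + bracket f0 f1 f2 f3 x0.+1 x1 x2 x3.+1 * bracket f0 f1 f2 f3 x0 x1.+1 x2.+1 x3.
Proof.
move=> sz; pose Z := mkseq f0 x0 ++ mkseq f1 x1 ++ mkseq f2 x2 ++ mkseq f3 x3.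
have szZ : (size Z).+2 = n by rewrite !size_cat !size_mkseq; lia.
have := ldet_three_term (f0 x0) (f1 x1) (f2 x2) (f3 x3) szZ.
rewrite /bracket !mkseqS !cat_rcons.
rewrite ldet_block13// ldet_block02// ldet_block23// ldet_block01// ldet_block03//.
rewrite ldet_block12// !size_mkseq => e.
have sgn : (-1) ^+ x2 * (-1) ^+ x2 = 1 :> F by rewrite -expr2 sqrr_sign.
rewrite !exprD; move: e sgn.
move: (_ ^+ x1) (_ ^+ x2) (_ ^+ x3) => s1 s2 s3 e sgn.
rewrite mulrACA -[s2 * s3 * _](_ : s2 * s2 * (s1 * s3) = _); last by ring.
rewrite sgn [X in _ * X]mulrC e.
rewrite [X in _ = _ + X](_ : _ = s2 * s2 * (s1 * s3) * (ldet (Z ++ [:: f0 x0; f3 x3]) * ldet (Z ++ [:: f1 x1; f2 x2]))).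
  by rewrite sgn /Z; ring.
by rewrite /Z; ring.
Qed.

Lemma mkskipS (T : Type) (f : nat -> T) l :
  mkskip f l.+1 = rcons (mkseq f l) (f l.+1).
Proof. by []. Qed.

(* W_f(l; s1 s2) in the notation of the header *)
Definition wratio s1 f l s2 : F :=
  ldet (s1 ++ mkskip f l ++ s2) / ldet (s1 ++ mkseq f l ++ s2).

(** In each of the three ratios [l] is the coordinate of the corner at which the long diagonal
    starts, so that a single index set l + p + q = n - 2 serves the three families of rhombi of a
    triangle. *)
Definition rhombus_terms (B : nat -> nat -> nat -> F) (l p q : nat) : F :=
  B l.+2 p q * B l p.+1 q.+1 / (B l.+1 p.+1 q * B l.+1 p q.+1)
  + B p l.+2 q * B p.+1 l q.+1 / (B p.+1 l.+1 q * B p l.+1 q.+1)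
  + B p q l.+2 * B p.+1 q.+1 l / (B p.+1 q l.+1 * B p q.+1 l.+1).

Section Triangle.
Variables f g h : nat -> 'rV[F]_n.
Definition bracket3 x y z := ldet (mkseq f x ++ mkseq g y ++ mkseq h z).
Local Notation B := bracket3.
Hypothesis B_neq0 : forall x y z, (x + y + z)%N = n -> B x y z != 0.

Section Rhombi.
Variables x y z : nat.
Hypothesis sz : (x + y + z).+2 = n.
Let A0 := mkseq f x.
Let A1 := mkseq g y.
Let A3 := mkseq h z.
Let phi u v := ldet ((A0 ++ A1 ++ A3) ++ [:: u; v]).

Let szZ : (size (A0 ++ A1 ++ [::] ++ A3)).+2 = n.
Proof. by rewrite !size_cat !size_mkseq /=; lia. Qed.

Let b00 u v : ldet (A0 ++ u :: v :: A1 ++ A3) = phi u v.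
Proof. exact: (ldet_block00 szZ). Qed.
Let b11 u v : ldet (A0 ++ A1 ++ u :: v :: A3) = phi u v.
Proof. exact: (ldet_block11 szZ). Qed.
Let b33 u v : ldet (A0 ++ A1 ++ rcons (rcons A3 u) v) = phi u v.
Proof. by rewrite /phi -!cats1 -!catA. Qed.
Let b01 u v : ldet (A0 ++ u :: A1 ++ v :: A3) = (-1) ^+ y * phi u v.
Proof. by have := ldet_block01 szZ u v; rewrite size_mkseq. Qed.
Let b03 u v : ldet (A0 ++ u :: A1 ++ rcons A3 v) = (-1) ^+ (y + z) * phi u v.
Proof. by have := ldet_block03 szZ u v; rewrite !size_mkseq addn0. Qed.
Let b13 u v : ldet (A0 ++ A1 ++ u :: rcons A3 v) = (-1) ^+ z * phi u v.
Proof. by have := ldet_block13 szZ u v; rewrite !size_mkseq add0n. Qed.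

Let sgn_neq0 k : (-1) ^+ k != 0 :> F.
Proof. by rewrite signr_eq0. Qed.

Let three u v w t :
  phi u w * phi v t = phi u v * phi w t + phi u t * phi v w.
Proof. exact: (ldet_three_term u v w t szZ). Qed.

Let sgnK k : (-1) ^+ k * (-1) ^+ k = 1 :> F.
Proof. by rewrite -expr2 sqrr_sign. Qed.

(** Over a common denominator the difference consists of two of the three products in the three-term
    relation for the vectors f_x, f_(x+1), g_y, h_z; the third product is the numerator on the
    right. [wratio_diff1] and [wratio_diff2] take the two consecutive vectors from g and from h. *)
Lemma wratio_diff0 :
  wratio [::] f x.+1 (mkseq g y ++ mkseq h z.+1)
  - wratio [::] f x.+1 (mkseq g y.+1 ++ mkseq h z)
  = B x.+2 y z * B x y.+1 z.+1 / (B x.+1 y.+1 z * B x.+1 y z.+1).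
Proof.
have e := three (f x) (f x.+1) (g y) (h z).
have := @B_neq0 x.+1 y.+1 z; have := @B_neq0 x.+1 y z.+1.
rewrite /B /wratio mkskipS !cat0s !mkseqS !cat_rcons b03 b01 !b00 b13 !b03 !b01.
rewrite !mulf_eq0 !signr_eq0 /= => n1 n2.
have {}n1 := n1 ltac:(lia); have {}n2 := n2 ltac:(lia).
rewrite exprD; have sy := sgn_neq0 y; have sz' := sgn_neq0 z; have sK := sgnK y.
move: sy sz' sK; move: (_ ^+ y) (_ ^+ z) => s t s0 t0 ss.
rewrite [RHS](_ : _ = (s * s)^-1 * (phi (f x) (f x.+1) * phi (g y) (h z))
  / (phi (f x) (g y) * phi (f x) (h z))); last by field; rewrite n1 n2 s0 t0.
rewrite ss invr1 mul1r -[_ * phi (g y) _](addrK (phi (f x) (h z) * phi (f x.+1) (g y))) -e.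
by field; rewrite n1 n2 s0 t0.
Qed.

Lemma wratio_diff1 :
  wratio (mkseq f x.+1) g y.+1 (mkseq h z)
  - wratio (mkseq f x) g y.+1 (mkseq h z.+1)
  = B x y.+2 z * B x.+1 y z.+1 / (B x.+1 y.+1 z * B x y.+1 z.+1).
Proof.
have e := three (f x) (g y) (g y.+1) (h z).
have := @B_neq0 x.+1 y.+1 z; have := @B_neq0 x y.+1 z.+1.
rewrite /B /wratio mkskipS !mkseqS !cat_rcons b13 !b01 b11 !b13 b03.
rewrite !mulf_eq0 !signr_eq0 /= => n1 n2.
have {}n1 := n1 ltac:(lia); have {}n2 := n2 ltac:(lia).
rewrite exprD; have sy := sgn_neq0 y; have sz' := sgn_neq0 z.
move: sy sz'; move: (_ ^+ y) (_ ^+ z) => s t s0 t0.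
rewrite [RHS](_ : _ = (phi (f x) (h z) * phi (g y) (g y.+1))
  / (phi (f x) (g y) * phi (g y) (h z))); last by field; rewrite n1 n2 s0 t0.
rewrite -[_ * phi (g y) (g _)](addKr (phi (f x) (g y) * phi (g y.+1) (h z))) -e.
by field; rewrite n1 n2 s0 t0.
Qed.

Lemma wratio_diff2 :
  wratio (mkseq f x ++ mkseq g y.+1) h z.+1 [::]
  - wratio (mkseq f x.+1 ++ mkseq g y) h z.+1 [::]
  = B x y z.+2 * B x.+1 y.+1 z / (B x.+1 y z.+1 * B x y.+1 z.+1).
Proof.
have e := three (f x) (g y) (h z) (h z.+1).
have := @B_neq0 x.+1 y z.+1; have := @B_neq0 x y.+1 z.+1.
rewrite /B /wratio mkskipS !cats0 -!catA !mkseqS !cat_rcons !b13 !b03 b33 b01.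
rewrite !mulf_eq0 !signr_eq0 /= => n1 n2.
have {}n1 := n1 ltac:(lia); have {}n2 := n2 ltac:(lia).
rewrite exprD; have sy := sgn_neq0 y; have sz' := sgn_neq0 z; have sK := sgnK z.
move: sy sz' sK; move: (_ ^+ y) (_ ^+ z) => s t s0 t0 ss.
rewrite [RHS](_ : _ = (t * t)^-1 * (phi (f x) (g y) * phi (h z) (h z.+1))
  / (phi (f x) (h z) * phi (g y) (h z))); last by field; rewrite n1 n2 s0 t0.
rewrite ss invr1 mul1r -[_ * phi (h z) (h _)](addrK (phi (f x) (h z.+1) * phi (g y) (h z))) -e.
by field; rewrite n1 n2 s0 t0.
Qed.

End Rhombi.

(** For f and g the columns of invertible matrices h and h', this is [Phi_BK] at h^-1 h', as shown
    in [Phi_BK_ldet]. *)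
Definition pair_potential (f g : nat -> 'rV[F]_n) : F :=
  \sum_(1 <= i < n)
    (ldet (mkseq f (n - i) ++ mkskip g i) - ldet (mkskip f (n - i) ++ mkseq g i))
    / ldet (mkseq f (n - i) ++ mkseq g i).

Lemma pair_potentialE u v : pair_potential u v =
  \sum_(0 <= l < n.-1) wratio (mkseq u (n.-1 - l)) v l.+1 [::]
  - \sum_(0 <= l < n.-1) wratio [::] u l.+1 (mkseq v (n.-1 - l)).
Proof.
rewrite /pair_potential; under eq_bigr do rewrite mulrBl.
rewrite sumrB; congr (_ - _).
  rewrite big_add1; apply: eq_bigr => l _; rewrite /wratio !cats0.
  by have -> : (n - l.+1 = n.-1 - l)%N by lia.
rewrite big_add1 [RHS]big_nat_rev add0n !big_nat; apply: eq_bigr => l ln.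
rewrite /wratio !cat0s; have -> : (n.-1 - (n.-1 - l.+1) = l.+1)%N by lia.
by have -> : (n - l.+1 = (n.-1 - l.+1).+1)%N by lia.
Qed.

Let telescope (u : nat -> F) N : u N - u 0%N = \sum_(0 <= p < N) (u p.+1 - u p).
Proof. by rewrite telescope_sumr. Qed.

Lemma triangle_potential :
  pair_potential f g + pair_potential g h - pair_potential f h
  = \sum_(0 <= l < n.-1) \sum_(0 <= p < n.-1 - l)
      rhombus_terms B l p (n.-2 - l - p).
Proof.
rewrite !pair_potentialE.
set a0 := RHS; set a1 := \sum_(_ <= _ < _) _; set a2 := \sum_(_ <= _ < _) _.
set a3 := \sum_(_ <= _ < _) _; set a4 := \sum_(_ <= _ < _) _.
set a5 := \sum_(_ <= _ < _) _; set a6 := \sum_(_ <= _ < _) _.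
(* Each flag occurs in two of the three pair potentials; its two sums are put together. *)
have -> : a1 - a2 + (a3 - a4) - (a5 - a6) = (a6 - a2) + (a1 - a4) + (a3 - a5) by ring.
rewrite /a0 /a1 /a2 /a3 /a4 /a5 /a6 -!sumrB -!big_split /= !big_nat.
apply: eq_bigr => l /= ln; rewrite /rhombus_terms !big_split /=.
set N := (n.-1 - l)%N; congr (_ + _ + _).
(* The vectors of h are exchanged one by one for vectors of g: p = 0 gives the term of the pair f, h
   and p = N that of the pair f, g. *)
- have := telescope (fun p => - wratio [::] f l.+1 (mkseq g p ++ mkseq h (N - p))) N.
  rewrite subnn cats0 subn0 opprK addrC /= => ->.
  rewrite !big_nat; apply: eq_bigr => p /andP[_]; rewrite {1}/N => pn; rewrite opprK addrC.
  have -> : (N - p = (n.-2 - l - p).+1)%N by rewrite /N; lia.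
  have -> : (N - p.+1 = n.-2 - l - p)%N by rewrite /N; lia.
  by rewrite wratio_diff0//; lia.
- have := telescope (fun p => wratio (mkseq f p) g l.+1 (mkseq h (N - p))) N.
  rewrite subnn subn0 /= => ->.
  rewrite !big_nat; apply: eq_bigr => p /andP[_]; rewrite {1}/N => pn.
  have -> : (N - p = (n.-2 - l - p).+1)%N by rewrite /N; lia.
  have -> : (N - p.+1 = n.-2 - l - p)%N by rewrite /N; lia.
  by rewrite wratio_diff1//; lia.
- have := telescope (fun p => - wratio (mkseq f p ++ mkseq g (N - p)) h l.+1 [::]) N.
  rewrite subnn cats0 subn0 opprK addrC /= => ->.
  rewrite !big_nat; apply: eq_bigr => p /andP[_]; rewrite {1}/N => pn; rewrite opprK addrC.
  have -> : (N - p = (n.-2 - l - p).+1)%N by rewrite /N; lia.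
  have -> : (N - p.+1 = n.-2 - l - p)%N by rewrite /N; lia.
  by rewrite wratio_diff2//; lia.
Qed.

End Triangle.
End Brackets.

(** * Minors as brackets *)

(** Two strictly sorted lists with the same elements are equal, so any increasing parametrization of
    the index sets may be used to compute a minor. *)
Lemma increasing_enum_val p m (f : 'I_p -> 'I_m) (J : {set 'I_m}) :
  {homo f : x y / (x < y)%N} -> J = [set f b | b in 'I_p] ->
  exists e : p = #|J|, forall b, enum_val (cast_ord e b) = f b.
Proof.
move=> incr eJ; pose r (x y : 'I_m) := (x < y)%N.
have r_tr : transitive r by move=> y x z; apply: ltn_trans.
have sorted_ord q : sorted (fun x y : 'I_q => (x < y)%N) (enum 'I_q).
  by rewrite -(sorted_map (e' := ltn)) val_enum_ord iota_ltn_sorted.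
have eq_enum : enum J = [seq f b | b <- enum 'I_p].
  apply: (irr_sorted_eq (leT := r)) => //.
  - by move=> x; apply: ltnn.
  - rewrite /(enum J) /enum_mem -enumT; apply: sorted_filter => //; exact: sorted_ord.
  - by rewrite sorted_map; apply: sub_sorted (sorted_ord p) => x y; apply: incr.
  - move=> x; rewrite mem_enum eJ; apply/imsetP/mapP => [[b _ ->]|[b _ ->]];
      by exists b; rewrite ?mem_enum.
have e : p = #|J| by rewrite cardE eq_enum size_map size_enum_ord.
exists e => b; rewrite (enum_val_nth (f b)) eq_enum (nth_map b) ?size_enum_ord//=.
by rewrite nth_ord_enum.
Qed.

Lemma minorE (K : comPzRingType) m q p (A : 'M[K]_(m, q)) (I : {set 'I_m})
    (J : {set 'I_q}) (f : 'I_p -> 'I_m) (g : 'I_p -> 'I_q) :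
  {homo f : x y / (x < y)%N} -> I = [set f b | b in 'I_p] ->
  {homo g : x y / (x < y)%N} -> J = [set g b | b in 'I_p] ->
  minor A I J = \det (mxsub f g A).
Proof.
move=> /increasing_enum_val fI /fI[eI {}fI] /increasing_enum_val gJ /gJ[eJ {}gJ].
rewrite /minor; case: eqP => [e|]; last by rewrite -eI -eJ.
have -> : mxsub f g A = castmx (esym eI, esym eI)
   (mxsub (fun a : 'I_#|I| => enum_val a) (fun b : 'I_#|I| => enum_val (cast_ord e b)) A).
  apply/matrixP=> a b; rewrite castmxE !mxE /= -fI -gJ !esymK.
  by congr (A _ (enum_val _)); apply: val_inj.
by case: _ / (esym eI); rewrite castmx_id.
Qed.

Section Flags.
Variables (K : comNzRingType) (n : nat).

(** Columns as a total function on [nat], so that the first vectors of a flag form a [mkseq]. *)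
Definition fl (A : 'M[K]_n) (m : nat) : 'rV[K]_n :=
  if insub m is Some c then (col c A)^T else 0.

Lemma flE (A : 'M[K]_n) (c : 'I_n) : fl A c = (col c A)^T.
Proof. by rewrite /fl valK. Qed.

End Flags.

Section MultiCorner.
Variables (R : realType) (n : nat).
Local Notation C := R[i].

Definition flags0 : nat -> 'rV[C]_n := fl 1%:M.
Definition flags1 (g : GL3 R n) : nat -> 'rV[C]_n := fl g.1.1.
Definition flags2 (g : GL3 R n) : nat -> 'rV[C]_n := fl ((g.1.1 : 'M_n) *m g.1.2).
Definition flags3 (g : GL3 R n) : nat -> 'rV[C]_n :=
  fl ((g.1.1 : 'M_n) *m g.1.2 *m g.2).

Lemma multi_cornerE i j k (g : GL3 R n) : (i + j + k <= n)%N ->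
  multi_corner i j k g
  = bracket flags0 (flags1 g) (flags2 g) (flags3 g) (n - i - j - k) i j k.
Proof.
move=> le_n; pose r := (n - i - j - k)%N.
(* The increasing enumeration of J: runs of lengths r, i, j, k starting at 0, n, 2n, 3n. *)
pose f (c : nat) := (if c < r then c else if c < r + i then n + (c - r)
  else if c < r + i + j then n + (n + (c - r - i)) else
  n + (n + (n + (c - r - i - j))))%N.
have rn : (r + i + j + k = n)%N by rewrite /r; lia.
have f_lt (c : 'I_n) : (f c < n + (n + (n + n)))%N.
  by move: (ltn_ord c); rewrite /f; repeat case: ifP => ?; lia.
pose F c := Ordinal (f_lt c).
rewrite /multi_corner (minorE _ (f := id) (g := F)) //; last first.
- apply/setP=> c; rewrite inE; apply/idP/imsetP => [h|[b _ ->] /=].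
    have : exists b, (b < n)%N && (f b == c).
      rewrite -/r in h; have [h1|h1] := ltnP c n.
        exists c; rewrite /f; have -> : (c < r)%N by lia.
        lia.
      have [h2|h2] := ltnP c (2 * n).
        exists (c - n + r)%N; rewrite /f; have -> : (c - n + r < r)%N = false by lia.
        have -> : (c - n + r < r + i)%N by lia.
        lia.
      have [h3|h3] := ltnP c (3 * n).
        exists (c - 2 * n + r + i)%N; rewrite /f.
        by do !case: ifP => ?; lia.
      exists (c - 3 * n + r + i + j)%N; rewrite /f.
      by do !case: ifP => ?; lia.
    move=> [b /andP[bn /eqP fb]]; exists (Ordinal bn) => //.
    by apply: val_inj; rewrite /= fb.
  rewrite -/r; move: (ltn_ord b); rewrite /f.
  by do !case: ifP => ?; lia.
- by move=> x y; move: (ltn_ord x) (ltn_ord y); rewrite /= /f; do !case: ifP => ?; lia.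
- by apply/setP=> x; rewrite inE; apply/esym/imsetP; exists x.
rewrite /bracket /ldet -det_tr -/r; congr (\det _); apply/matrixP=> c x.
rewrite mxE mxE [RHS]mxE !nth_cat !size_mkseq /bold.
have [cr|cr] := ltnP c r.
  have -> : F c = lshift _ c by apply: val_inj; rewrite /= /f cr.
  by rewrite row_mxEl nth_mkseq// /flags0 flE !mxE.
have [ci|ci] := ltnP (c - r)%N i.
  have lt : (c - r < n)%N by lia.
  have -> : F c = rshift _ (lshift _ (Ordinal lt)).
    by apply: val_inj; rewrite /= /f ltnNge cr /= -ltn_subLR// ci.
  by rewrite row_mxEr row_mxEl nth_mkseq// -[(c - r)%N]/(val (Ordinal lt)) /flags1 flE !mxE.
have [cj|cj] := ltnP (c - r - i)%N j.
  have lt : (c - r - i < n)%N by lia.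
  have -> : F c = rshift _ (rshift _ (lshift _ (Ordinal lt))).
    by apply: val_inj; rewrite /= /f; do !case: ifP => ?; lia.
  rewrite !row_mxEr row_mxEl nth_mkseq// -[(c - r - i)%N]/(val (Ordinal lt)) /flags2 flE.
  by rewrite !mxE.
have cn := ltn_ord c; have lt : (c - r - i - j < n)%N by lia.
have -> : F c = rshift _ (rshift _ (rshift _ (Ordinal lt))).
  by apply: val_inj; rewrite /= /f; do !case: ifP => ?; lia.
rewrite !row_mxEr nth_mkseq; last by lia.
by rewrite -[(c - r - i - j)%N]/(val (Ordinal lt)) /flags3 flE !mxE.
Qed.

End MultiCorner.

Lemma size_mkskip (T : Type) (f : nat -> T) l : (0 < l)%N -> size (mkskip f l) = l.
Proof. by move=> l0; rewrite size_rcons size_mkseq prednK. Qed.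

Lemma fl_mul (K : comNzRingType) n (h g : 'M[K]_n) m :
  fl (h *m g) m = fl g m *m h^T.
Proof.
rewrite /fl; case: insubP => [c _ _|_]; last by rewrite mul0mx.
by rewrite colE -mulmxA -colE trmx_mul.
Qed.

Lemma map_mkseq (T1 T2 : Type) (F : T1 -> T2) (f : nat -> T1) k :
  [seq F x | x <- mkseq f k] = mkseq (F \o f) k.
Proof. by rewrite /mkseq -map_comp. Qed.

Lemma map_mkskip (T1 T2 : Type) (F : T1 -> T2) (f : nat -> T1) k :
  [seq F x | x <- mkskip f k] = mkskip (F \o f) k.
Proof. by rewrite /mkskip map_rcons map_mkseq. Qed.

Section CornerMinors.
Variables (K : comNzRingType).

(** Below the first m unit vectors the matrix is block lower triangular with an identity block, and
    only the last i rows of g contribute. The size is written m + i so that these rows are the image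
    of [rshift]. *)
Lemma ldet_corner m i (g : 'M[K]_(m + i)) (s : seq 'I_(m + i)) (j : 'I_i -> 'I_(m + i)) :
  s = [seq j b | b <- enum 'I_i] ->
  ldet (mkseq (fl 1%:M) m ++ [seq (col c g)^T | c <- s])
  = \det (mxsub (@rshift m i) j g).
Proof.
move=> ->; pose Adl := \matrix_(b < i, c < m) g (lshift i c) (j b).
have -> : \det (mxsub (@rshift m i) j g)
    = \det (block_mx 1%:M 0 Adl (mxsub (@rshift m i) j g)^T).
  by rewrite det_lblock det1 mul1r det_tr.
congr (\det _); apply/matrixP=> a c; rewrite mxE nth_cat size_mkseq.
case: (split_ordP a) => a' -> /=.
  rewrite nth_mkseq// -[nat_of_ord a']/(nat_of_ord (lshift i a')) flE.
  case: (split_ordP c) => c' ->; rewrite ?block_mxEul ?block_mxEur !mxE -val_eqE /=.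
    by rewrite eq_sym.
  by rewrite gtn_eqF// (leq_trans (ltn_ord a')) ?leq_addr.
rewrite addKn -map_comp (nth_map a') ?size_enum_ord//=.
rewrite nth_ord_enum.
by case: (split_ordP c) => c' ->; rewrite ?block_mxEdl ?block_mxEdr !mxE.
Qed.

Lemma mkseq_fl n (g : 'M[K]_n) i (le_in : (i <= n)%N) :
  mkseq (fl g) i = [seq (col c g)^T | c <- [seq widen_ord le_in b | b <- enum 'I_i]].
Proof.
rewrite -map_comp /mkseq -val_enum_ord -map_comp; apply: eq_map => b /=.
by rewrite -flE.
Qed.

Definition skip_ord n i (lt_in : (i < n)%N) (b : 'I_i) : 'I_n :=
  if b.+1 == i then Ordinal lt_in else widen_ord (ltnW lt_in) b.

Lemma mkskip_fl n (g : 'M[K]_n) i (lt_in : (i < n)%N) : (0 < i)%N ->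
  mkskip (fl g) i = [seq (col c g)^T | c <- [seq skip_ord lt_in b | b <- enum 'I_i]].
Proof.
case: i lt_in => // i lt_in _; apply: (@eq_from_nth _ 0).
  by rewrite size_mkskip// size_map size_map size_enum_ord.
move=> b; rewrite size_mkskip// => bi.
rewrite -map_comp (nth_map (Ordinal bi)) ?size_enum_ord// nth_rcons size_mkseq /=.
rewrite (nth_ord_enum _ (Ordinal bi)) -flE /skip_ord /= eqSS.
have [e|ne] := eqVneq b i; first by rewrite e ltnn.
by rewrite ltn_neqAle ne -ltnS bi nth_mkseq// ltn_neqAle ne -ltnS.
Qed.

Lemma seg_image n i (le_in : (i <= n)%N) :
  seg n i = [set widen_ord le_in b | b in 'I_i].
Proof.
apply/setP=> c; rewrite inE; apply/idP/imsetP => [ci|[b _ ->]]; last exact: (ltn_ord b).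
by exists (Ordinal ci) => //; apply: val_inj.
Qed.

Lemma seg_skip_image n i (lt_in : (i < n)%N) : (0 < i)%N ->
  seg_skip n i = [set skip_ord lt_in b | b in 'I_i].
Proof.
move=> i0; apply/setP=> c; rewrite inE; apply/idP/imsetP => [/andP[ci ne]|[b _ ->]].
  have [e|ne'] := eqVneq (c : nat) i.
    have bi : (i.-1 < i)%N by rewrite prednK.
    by exists (Ordinal bi) => //; apply: val_inj; rewrite /skip_ord /= prednK// eqxx.
  have bi : (c < i)%N by lia.
  by exists (Ordinal bi) => //; apply: val_inj; rewrite /skip_ord /= (negPf ne).
by move: (ltn_ord b); rewrite /skip_ord; case: ifP => /=; lia.
Qed.

Lemma widen_ord_homo n i (le_in : (i <= n)%N) :
  {homo widen_ord le_in : x y / (x < y)%N}.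
Proof. by []. Qed.

Lemma skip_ord_homo n i (lt_in : (i < n)%N) :
  {homo skip_ord lt_in : x y / (x < y)%N}.
Proof.
move=> x y xy; have := ltn_ord y; rewrite /skip_ord.
by do 2! case: ifP => /= /eqP ?; lia.
Qed.

Lemma opset_seg m i :
  opset (seg (m + i) i) = [set rshift m b | b in 'I_i].
Proof.
apply/setP=> c; apply/imsetP/imsetP => [[a]|[b _ ->]].
  rewrite inE => ai ->; have bi : (i - a.+1 < i)%N by lia.
  by exists (Ordinal bi) => //; apply: val_inj => /=; lia.
by exists (rev_ord (rshift m b)); rewrite ?rev_ordK// inE /=; move: (ltn_ord b); lia.
Qed.

Lemma minor_corner m i (g : 'M[K]_(m + i)) (J : {set 'I_(m + i)})
    (j : 'I_i -> 'I_(m + i)) :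
  {homo j : x y / (x < y)%N} -> J = [set j b | b in 'I_i] ->
  minor g (opset (seg (m + i) i)) J
  = ldet (mkseq (fl 1%:M) m ++ [seq (col c g)^T | c <- [seq j b | b <- enum 'I_i]]).
Proof.
move=> j_homo Jj; rewrite (minorE _ _ (opset_seg m i) j_homo Jj) ?(ldet_corner _ erefl)//.
by move=> x y; rewrite /= ltn_add2l.
Qed.

Lemma minor_corner_seg m i (g : 'M[K]_(m + i)) :
  minor g (opset (seg (m + i) i)) (seg (m + i) i)
  = ldet (mkseq (fl 1%:M) m ++ mkseq (fl g) i).
Proof.
rewrite (mkseq_fl _ (leq_addl m i)).
exact: (minor_corner _ (@widen_ord_homo _ _ _) (seg_image _)).
Qed.

Lemma minor_corner_skip m i (g : 'M[K]_(m + i)) : (0 < m)%N -> (0 < i)%N ->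
  minor g (opset (seg (m + i) i)) (seg_skip (m + i) i)
  = ldet (mkseq (fl 1%:M) m ++ mkskip (fl g) i).
Proof.
move=> m0 i0; have lt_in : (i < m + i)%N by lia.
rewrite (mkskip_fl _ lt_in)//.
exact: (minor_corner _ (@skip_ord_homo _ _ _) (seg_skip_image _ _)).
Qed.

Lemma minor_skip_corner m i (g : 'M[K]_(m + i)) : (0 < m)%N -> (0 < i)%N ->
  minor g (opset (seg_skip (m + i) i)) (seg (m + i) i)
  = - ldet (mkskip (fl 1%:M) m ++ mkseq (fl g) i).
Proof.
move=> m0 i0; have lt_m1 : (m.-1 < m + i)%N by lia.
have lt_m : (m < m + i)%N by lia.
pose t := tperm (Ordinal lt_m1) (Ordinal lt_m).
(* The rows of the minor are m-1, m+1, ..., m+i-1, that is, the last i rows after the transposition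
   of m-1 and m. *)
have tE (b : 'I_i) : t (rshift m b) = (if b == 0 :> nat then m.-1 else m + b)%N :> nat.
  case: ifP => [b0|b0].
    have -> : rshift m b = Ordinal lt_m by apply: val_inj => /=; rewrite (eqP b0) addn0.
    by rewrite tpermR.
  by rewrite tpermD //; apply/eqP => /(congr1 val) /=; lia.
rewrite (minorE _ (f := t \o @rshift m i) (g := widen_ord (leq_addl m i))) //; last first.
- exact: seg_image.
- apply/setP=> c; apply/imsetP/imsetP => [[a]|[b _ ->]].
    rewrite inE => /andP[ai ne] ->.
    have [e|ne'] := eqVneq (a : nat) i.
      exists (Ordinal i0) => //; apply: val_inj => /=; rewrite tE /= e; lia.
    have bi : (i - a.+1 < i)%N by lia.
    exists (Ordinal bi) => //; apply: val_inj => /=; rewrite tE /=.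
    by case: ifP; lia.
  exists (rev_ord (t (rshift m b))); rewrite ?rev_ordK// inE /= tE.
  by move: (ltn_ord b); case: ifP; lia.
- by move=> x y xy; rewrite /= !tE; do 2! case: ifP; lia.
have -> : mxsub (t \o @rshift m i) (widen_ord (leq_addl m i)) g =
          mxsub (@rshift m i) (widen_ord (leq_addl m i)) (row_perm t g).
  by apply/matrixP=> a b; rewrite !mxE.
rewrite -(ldet_corner _ erefl) -mkseq_fl row_permE.
(* The same transposition turns the unit vectors with index below m into the skipped list, and its
   determinant gives the minus sign. *)
have -> : mkseq (fl 1%:M) m ++ mkseq (fl (perm_mx t *m g)) i
   = [seq v *m (perm_mx t)^T | v <- mkskip (fl 1%:M) m ++ mkseq (fl g) i].
  rewrite map_cat !map_mkseq map_mkskip; congr (_ ++ _); last first.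
    by apply: eq_mkseq => c; rewrite /= fl_mul.
  have pE (c : 'I_(m + i)) : fl (1%:M : 'M[K]_(m + i)) c *m (perm_mx t)^T = fl 1%:M (t c).
    rewrite -fl_mul mulmx1 !flE; apply/rowP=> x; rewrite !mxE.
    by rewrite (canF_eq (permK t)) tpermV.
  apply: (@eq_from_nth _ 0); rewrite ?size_mkskip ?size_mkseq// => c cm.
  rewrite nth_mkseq// nth_rcons size_mkseq.
  have [lt|ge] := ltnP c m.-1.
    have cn : (c < m + i)%N by lia.
    rewrite nth_mkseq// /= (pE (Ordinal cn)) tpermD //.
      by apply/eqP => /(congr1 val) /=; lia.
    by apply/eqP => /(congr1 val) /=; lia.
  have -> : c = m.-1 by lia.
  by rewrite eqxx /= (pE (Ordinal lt_m)) tpermR.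
rewrite ldet_mul; last by rewrite size_cat size_mkskip// size_mkseq.
rewrite det_tr det_perm odd_tperm -val_eqE /=.
have -> : (m.-1 != m) by lia.
by rewrite expr1 mulrN1.
Qed.

End CornerMinors.

(** * The Berenstein-Kazhdan potential in terms of flags *)

Section Potential.
Variables (R : realType) (n : nat).
Local Notation C := R[i].

(** Multiplication by h scales all brackets of the flags of 1 and g by det h, which cancels in the
    quotients. *)
Lemma Phi_BK_ldet (h g : 'M[C]_n) (gG : GL R n) : g = gG -> \det h != 0 ->
  Phi_BK gG = pair_potential (fl h) (fl (h *m g)).
Proof.
move=> eg h0; rewrite /Phi_BK /pair_potential /BK_den -eg !big_nat; apply: eq_bigr => i /andP[i0 i_n].
pose m := (n - i)%N; have m0 : (0 < m)%N by rewrite /m; lia.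
have mulh (s : seq 'rV[C]_n) : size s = n ->
    ldet [seq v *m h^T | v <- s] = ldet s * \det h by move=> ?; rewrite ldet_mul ?det_tr.
have hE f k : map (mulmxr h^T) (mkseq (fl f) k) = mkseq (fl (h *m f)) k.
  by rewrite map_mkseq; apply: eq_mkseq => c; rewrite /= fl_mul.
have hE' f k : map (mulmxr h^T) (mkskip (fl f) k) = mkskip (fl (h *m f)) k.
  rewrite map_mkskip /mkskip /= -fl_mul; congr (rcons _ _).
  by apply: eq_mkseq => c; rewrite /= fl_mul.
rewrite -/m -[h in fl h]mulmx1 -!hE -!hE' -!map_cat !mulh;
  try by rewrite size_cat ?size_mkseq ?size_mkskip// /m; lia.
rewrite -mulrBl -mulf_div divff// mulr1.
have en : n = (m + i)%N by rewrite /m; lia.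
clearbody m; clear - en m0 i0; subst n.
by rewrite minor_corner_seg minor_corner_skip// minor_skip_corner// [in LHS]addrC.
Qed.

End Potential.

(** * Closure properties and unipotent invariance *)

Section GeneratedAlgebra.
Variables (K : comNzRingType) (T : Type) (G : (T -> K) -> Prop).
Local Notation alg := (generated_algebra G).

Lemma gen_ext f g : (forall x, g x = f x) -> alg f -> alg g.
Proof. by move=> /funext ->. Qed.

Lemma gen_sum (I : Type) (r : seq I) (P : pred I) (F : I -> T -> K) :
  (forall i, P i -> alg (F i)) -> alg (fun x => \sum_(i <- r | P i) F i x).
Proof.
move=> FG; elim: r => [|i r IH].
  by rewrite (_ : (fun _ => _) = fun=> 0); [exact: gen_cst|apply: funext => x; rewrite big_nil].
have [Pi|nPi] := boolP (P i).
  rewrite (_ : (fun _ => _) = fun x => F i x + \sum_(i <- r | P i) F i x).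
    by apply: gen_add => //; apply: FG.
  by apply: funext => x; rewrite big_cons Pi.
rewrite (_ : (fun _ => _) = fun x => \sum_(i <- r | P i) F i x) //.
by apply: funext => x; rewrite big_cons (negPf nPi).
Qed.

Lemma gen_prod (I : Type) (r : seq I) (P : pred I) (F : I -> T -> K) :
  (forall i, P i -> alg (F i)) -> alg (fun x => \prod_(i <- r | P i) F i x).
Proof.
move=> FG; elim: r => [|i r IH].
  by rewrite (_ : (fun _ => _) = fun=> 1); [exact: gen_cst|apply: funext => x; rewrite big_nil].
have [Pi|nPi] := boolP (P i).
  rewrite (_ : (fun _ => _) = fun x => F i x * \prod_(i <- r | P i) F i x).
    by apply: gen_mul => //; apply: FG.
  by apply: funext => x; rewrite big_cons Pi.
rewrite (_ : (fun _ => _) = fun x => \prod_(i <- r | P i) F i x) //.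
by apply: funext => x; rewrite big_cons (negPf nPi).
Qed.

Lemma gen_det m (A : T -> 'M[K]_m) :
  (forall i j, alg (fun x => A x i j)) -> alg (fun x => \det (A x)).
Proof.
move=> AG; apply: gen_sum => s _; apply: gen_mul; first exact: gen_cst.
by apply: gen_prod => i _.
Qed.

Lemma gen_mulmx m p q (A : T -> 'M[K]_(m, p)) (B : T -> 'M[K]_(p, q)) :
  (forall i j, alg (fun x => A x i j)) -> (forall i j, alg (fun x => B x i j)) ->
  forall i j, alg (fun x => (A x *m B x) i j).
Proof.
move=> AG BG i j.
rewrite (_ : (fun _ => _) = fun x => \sum_k A x i k * B x k j).
  by apply: gen_sum => k _; apply: gen_mul.
by apply: funext => x; rewrite mxE.
Qed.

Lemma gen_ldet n (s : T -> seq 'rV[K]_n) :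
  (forall i j, alg (fun x => nth 0 (s x) i 0 j)) -> alg (fun x => ldet (s x)).
Proof.
move=> sG; apply: gen_det => i j.
by under [fun _ => _]eq_fun do rewrite mxE.
Qed.

Lemma gen_adj m (A : T -> 'M[K]_m) :
  (forall i j, alg (fun x => A x i j)) ->
  forall i j, alg (fun x => (\adj (A x)) i j).
Proof.
move=> AG i j.
rewrite (_ : (fun _ => _) = fun x => (-1) ^+ (j + i) * \det (row' j (col' i (A x)))).
  apply: gen_mul; first exact: gen_cst.
  by apply: gen_det => a b; under [fun _ => _]eq_fun do rewrite !mxE.
by apply: funext => x; rewrite mxE.
Qed.

End GeneratedAlgebra.

Lemma gen_invmx (K : fieldType) (T : Type) (G : (T -> K) -> Prop) m (A : T -> 'M[K]_m) :
  (forall x, \det (A x) != 0) ->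
  (forall i j, generated_algebra G (fun x => A x i j)) ->
  generated_algebra G (fun x => (\det (A x))^-1) ->
  forall i j, generated_algebra G (fun x => invmx (A x) i j).
Proof.
move=> A0 AG dG i j.
rewrite (_ : (fun _ => _) = fun x => (\det (A x))^-1 * (\adj (A x)) i j).
  by apply: gen_mul => //; apply: gen_adj.
by apply: funext => x; rewrite /invmx unitmxE unitfE A0 mxE.
Qed.

Section Unipotent.
Variables (K : comNzRingType) (n : nat).
Implicit Types (u h : 'M[K]_n).

Definition unitriangular u := forall i j : 'I_n, (j <= i)%N -> u i j = (i == j)%:R.

Lemma det_unitriangular u : unitriangular u -> \det u = 1.
Proof.
move=> uU; rewrite -det_tr det_trig; first by rewrite big1 // => i _; rewrite mxE uU ?eqxx.
apply/is_trig_mxP => i j ij; rewrite mxE uU ?(ltnW ij)// -val_eqE.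
by rewrite (gtn_eqF ij).
Qed.

Lemma fl_unitriangular h u : unitriangular u -> exists a : nat -> nat -> K,
  forall i, (i < n)%N -> fl (h *m u) i = fl h i + \sum_(j < i) a i j *: fl h j.
Proof.
move=> uU; pose a i j := if insub j is Some r then fl u i 0 r else 0.
have aE i (r : 'I_n) : a i r = fl u i 0 r by rewrite /a valK.
exists a => i i_n; rewrite (big_ord_widen n (fun j => a i j *: fl h j)) 1?ltnW//.
rewrite fl_mul mulmx_sum_row (bigD1 (Ordinal i_n)) //= [in RHS]big_mkcond /=.
rewrite [in RHS](bigD1 (Ordinal i_n)) //= ltnn add0r; congr (_ + _).
  rewrite -[i in fl u i]/(val (Ordinal i_n)) flE !mxE uU// eqxx scale1r.
  by rewrite -[i in RHS]/(val (Ordinal i_n)) flE tr_col.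
apply: eq_bigr => k ki; rewrite aE flE -tr_col -[i in fl u i]/(val (Ordinal i_n)) flE.
case: ltnP => // ik; rewrite !mxE uU// (negPf ki) scale0r//.
Qed.

Lemma bracket_unitriangular h0 h1 h2 h3 u0 u1 u2 u3 x0 x1 x2 x3 :
  unitriangular u0 -> unitriangular u1 -> unitriangular u2 -> unitriangular u3 ->
  (x0 + x1 + x2 + x3)%N = n ->
  bracket (fl (h0 *m u0)) (fl (h1 *m u1)) (fl (h2 *m u2)) (fl (h3 *m u3)) x0 x1 x2 x3
  = bracket (fl h0) (fl h1) (fl h2) (fl h3) x0 x1 x2 x3.
Proof.
move=> /(fl_unitriangular h0)[a0 e0] /(fl_unitriangular h1)[a1 e1].
move=> /(fl_unitriangular h2)[a2 e2] /(fl_unitriangular h3)[a3 e3] sz.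
rewrite /bracket (@ldet_unipotent _ _ [::] _ _ (fl h0) _ a0) /=; [|lia|]; last first.
  by move=> i ix; apply: e0; lia.
rewrite (@ldet_unipotent _ _ (mkseq (fl h0) x0) _ _ (fl h1) _ a1); last 2 first.
- by rewrite size_mkseq; lia.
- by move=> i ix; apply: e1; lia.
rewrite catA (@ldet_unipotent _ _ (_ ++ _) _ _ (fl h2) _ a2); last 2 first.
- by rewrite size_cat !size_mkseq; lia.
- by move=> i ix; apply: e2; lia.
rewrite catA -[mkseq _ x3]cats0 (@ldet_unipotent _ _ (_ ++ _) _ _ (fl h3) _ a3) ?cats0 -?catA//.
- by rewrite !size_cat !size_mkseq; lia.
- by move=> i ix; apply: e3; lia.
Qed.

Lemma bracket_mul u h0 h1 h2 h3 x0 x1 x2 x3 : (x0 + x1 + x2 + x3)%N = n ->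
  bracket (fl (u *m h0)) (fl (u *m h1)) (fl (u *m h2)) (fl (u *m h3)) x0 x1 x2 x3
  = bracket (fl h0) (fl h1) (fl h2) (fl h3) x0 x1 x2 x3 * \det u.
Proof.
move=> sz; rewrite /bracket -(det_tr u) -ldet_mul; last by rewrite !size_cat !size_mkseq; lia.
by rewrite !map_cat !map_mkseq; congr (ldet (_ ++ _ ++ _ ++ _)); apply: eq_mkseq => i;
  rewrite /= fl_mul.
Qed.

End Unipotent.

Section GeneratedBrackets.
Variables (K : comNzRingType) (T : Type) (G : (T -> K) -> Prop) (n : nat).
Local Notation alg := (generated_algebra G).

Lemma gen_fl (A : T -> 'M[K]_n) m c :
  (forall i j, alg (fun x => A x i j)) -> alg (fun x => fl (A x) m 0 c).
Proof.
move=> AG; rewrite /fl; case: insubP => [r _ _|_].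
  by apply: (gen_ext _ (AG c r)) => x; rewrite !mxE.
by apply: (gen_ext _ (gen_cst _ 0)) => x; rewrite mxE.
Qed.

Lemma gen_nth_cat (s1 s2 : T -> seq 'rV[K]_n) (N : nat) :
  (forall x, size (s1 x) = N) ->
  (forall i c, alg (fun x => nth 0 (s1 x) i 0 c)) ->
  (forall i c, alg (fun x => nth 0 (s2 x) i 0 c)) ->
  forall i c, alg (fun x => nth 0 (s1 x ++ s2 x) i 0 c).
Proof.
move=> sN h1 h2 i c; case iN : (i < N)%N.
  by apply: (gen_ext _ (h1 i c)) => x; rewrite nth_cat sN iN.
by apply: (gen_ext _ (h2 (i - N)%N c)) => x; rewrite nth_cat sN iN.
Qed.

Lemma gen_nth_mkseq (f : T -> nat -> 'rV[K]_n) k :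
  (forall i c, alg (fun x => f x i 0 c)) ->
  forall i c, alg (fun x => nth 0 (mkseq (f x) k) i 0 c).
Proof.
move=> fG i c; have [ik|ki] := ltnP i k.
  by apply: (gen_ext _ (fG i c)) => x; rewrite nth_mkseq.
by apply: (gen_ext _ (gen_cst _ 0)) => x; rewrite nth_default ?size_mkseq// mxE.
Qed.

Lemma gen_bracket (f0 f1 f2 f3 : T -> nat -> 'rV[K]_n) x0 x1 x2 x3 :
  (forall i c, alg (fun x => f0 x i 0 c)) -> (forall i c, alg (fun x => f1 x i 0 c)) ->
  (forall i c, alg (fun x => f2 x i 0 c)) -> (forall i c, alg (fun x => f3 x i 0 c)) ->
  alg (fun x => bracket (f0 x) (f1 x) (f2 x) (f3 x) x0 x1 x2 x3).
Proof.
move=> h0 h1 h2 h3; apply: gen_ldet.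
apply: (gen_nth_cat (N := x0)); [by move=> x; rewrite size_mkseq|exact: gen_nth_mkseq|].
apply: (gen_nth_cat (N := x1)); [by move=> x; rewrite size_mkseq|exact: gen_nth_mkseq|].
by apply: (gen_nth_cat (N := x2)); [by move=> x; rewrite size_mkseq|exact: gen_nth_mkseq|
  exact: gen_nth_mkseq].
Qed.

End GeneratedBrackets.

Section MultiCornerFunctions.
Variables (R : realType) (n : nat).
Local Notation C := R[i].
Local Notation GL3 := (GL3 R n).

Lemma multi_corner_invariant i j k : (i + j + k <= n)%N ->
  U4_invariant (@multi_corner R n i j k).
Proof.
move=> le_n u0 u1 u2 u3 U0 U1 U2 U3 g.
have sz : (n - i - j - k + i + j + k)%N = n by lia.
have V (u : GL R n) : glval u \in unitmx by case: u.
rewrite (multi_cornerE _ le_n) (multi_cornerE g le_n) /flags0 /flags1 /flags2 /flags3 /=.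
set a := glval g.1.1; set b := glval g.1.2; set c := glval g.2.
have E1 : glval u0 *m a *m invmx u1 = glval u0 *m (a *m invmx u1) by rewrite mulmxA.
have E2 : glval u0 *m a *m invmx u1 *m (glval u1 *m b *m invmx u2)
    = glval u0 *m (a *m b *m invmx u2) by rewrite !mulmxA mulmxKV.
have E3 : glval u0 *m a *m invmx u1 *m (glval u1 *m b *m invmx u2)
      *m (glval u2 *m c *m invmx u3) = glval u0 *m (a *m b *m c *m invmx u3).
  by rewrite E2 !mulmxA mulmxKV.
(* The identity block is written as u0 u0^-1: all four blocks then have the left factor u0, of
   determinant 1, and the right factors are unitriangular. *)
rewrite E3 E2 E1 -[X in fl X](mulmxV (V u0)) (bracket_mul _ _ _ _ _ sz).
rewrite (det_unitriangular U0) mulr1 -(bracket_unitriangular _ _ _ _ U0 U1 U2 U3 sz).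
by rewrite (mulmxKV (V u1)) (mulmxKV (V u2)) (mulmxKV (V u3)) (mulVmx (V u0)) (mulmxV (V u0)).
Qed.

Lemma multi_corner_regular i j k : (i + j + k <= n)%N ->
  regular_GL3 (@multi_corner R n i j k).
Proof.
move=> le_n.
have -> : @multi_corner R n i j k = fun g : GL3 =>
    bracket (flags0 R n) (flags1 g) (flags2 g) (flags3 g) (n - i - j - k) i j k.
  by apply: funext => g; rewrite multi_cornerE.
have r1 a b : regular_GL3 (fun g : GL3 => g.1.1 a b) by apply/gen_mem/entry1.
have r2 a b : regular_GL3 (fun g : GL3 => g.1.2 a b) by apply/gen_mem/entry2.
have r3 a b : regular_GL3 (fun g : GL3 => g.2 a b) by apply/gen_mem/entry3.
apply: gen_bracket => m c; first exact: gen_cst.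
- by apply: gen_fl.
- by apply: gen_fl; apply: gen_mulmx.
- by apply: gen_fl; apply: gen_mulmx => //; apply: gen_mulmx.
Qed.

Lemma multi_corner_pluecker (g : GL3) :
  pluecker n (fun i j k => multi_corner i j k g).
Proof.
move=> i j k le_n; rewrite !multi_cornerE; try lia.
pose x := (n - i - j - k - 2)%N.
have -> : (n - i.+1 - j - k.+1 = x)%N by rewrite /x; lia.
have -> : (n - i - j.+1 - k = x.+1)%N by rewrite /x; lia.
have -> : (n - i - j.+1 - k.+1 = x)%N by rewrite /x; lia.
have -> : (n - i.+1 - j - k = x.+1)%N by rewrite /x; lia.
have -> : (n - i - j - k.+1 = x.+1)%N by rewrite /x; lia.
have -> : (n - i.+1 - j.+1 - k = x)%N by rewrite /x; lia.
by apply: bracket_pluecker; rewrite /x; lia.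
Qed.

Lemma multi_corner000 (g : GL3) : multi_corner 0 0 0 g = 1.
Proof.
rewrite multi_cornerE// !subn0 /bracket !cats0 /= -[RHS](det1 _ n).
congr (\det _); apply/row_matrixP => i; rewrite rowK nth_mkseq//.
by rewrite /flags0 flE tr_col trmx1.
Qed.

Lemma rhombus_terms_ext (F : fieldType) (B B' : nat -> nat -> nat -> F) N l p q :
  (forall x y z, (x + y + z)%N = N -> B x y z = B' x y z) -> (l + p + q).+2 = N ->
  rhombus_terms B l p q = rhombus_terms B' l p q.
Proof.
move=> BB' sz; rewrite /rhombus_terms !BB' //; lia.
Qed.

Lemma regroup_potentials (F : fieldType) (p01 p12 p23 p03 p02 s t : F) :
  p01 + p12 - p02 = s -> p02 + p23 - p03 = t -> p01 + p12 + p23 - p03 = s + t.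
Proof. by move=> <- <-; ring. Qed.

(** The terms of Phi_3 are the pair potentials of the flags 01, 12, 23 and 03; adding and
    subtracting that of 02 splits them into the triangles 012 and 023. *)
Lemma Phi3_multi_corner (g : GL3) :
  (forall i j, (i + j <= n)%N -> multi_corner i j 0 g != 0) ->
  (forall j k, (j + k <= n)%N -> multi_corner 0 j k g != 0) ->
  Phi3 g = \sum_(0 <= l < n.-1) \sum_(0 <= p < n.-1 - l)
    (rhombus_terms (fun _ y z => multi_corner y z 0 g) l p (n.-2 - l - p)
     + rhombus_terms (fun _ y z => multi_corner 0 y z g) l p (n.-2 - l - p)).
Proof.
move=> M0 M1; have det_neq0 (h : GL R n) : \det h != 0.
  by rewrite -unitfE -unitmxE; case: h.
have e0 x y z : (x + y + z)%N = n ->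
    bracket3 (flags0 R n) (flags1 g) (flags2 g) x y z = multi_corner y z 0 g.
  move=> sz; rewrite multi_cornerE; last by lia.
  by rewrite /bracket cats0; have -> : (n - y - z - 0 = x)%N by lia.
have e1 x y z : (x + y + z)%N = n ->
    bracket3 (flags0 R n) (flags2 g) (flags3 g) x y z = multi_corner 0 y z g.
  move=> sz; rewrite multi_cornerE; last by lia.
  by rewrite /bracket /=; have -> : (n - 0 - y - z = x)%N by lia.
have B0 x y z (sz : (x + y + z)%N = n) :
    bracket3 (flags0 R n) (flags1 g) (flags2 g) x y z != 0.
  by rewrite (e0 _ _ _ sz); apply: M0; lia.
have B1 x y z (sz : (x + y + z)%N = n) :
    bracket3 (flags0 R n) (flags2 g) (flags3 g) x y z != 0.
  by rewrite (e1 _ _ _ sz); apply: M1; lia.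
have T0 := triangle_potential B0; have T1 := triangle_potential B1.
rewrite /Phi3 (@Phi_BK_ldet _ _ 1%:M _ _ erefl) ?det1 ?oner_eq0//.
rewrite (@Phi_BK_ldet _ _ g.1.1 _ _ erefl)//.
rewrite (@Phi_BK_ldet _ _ (glval g.1.1 *m g.1.2) _ _ erefl); last first.
  by rewrite det_mulmx mulf_neq0.
rewrite (@Phi_BK_ldet _ _ 1%:M _ _ erefl) ?det1 ?oner_eq0//= !mul1mx.
rewrite (regroup_potentials T0 T1).
rewrite -big_split !big_nat /=; apply: eq_bigr => l ln.
rewrite -big_split !big_nat /=; apply: eq_bigr => p pn.
have szq : (l + p + (n.-2 - l - p)).+2 = n by lia.
by congr (_ + _); [exact: rhombus_terms_ext e0 szq|exact: rhombus_terms_ext e1 szq].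
Qed.

End MultiCornerFunctions.

(** * Normal forms *)

Section Elimination.
Variables (F : fieldType) (n : nat).
Local Notation e := (fl (1%:M : 'M[F]_n)).

Lemma fl1 (c : 'I_n) : e c = delta_mx 0 c.
Proof. by rewrite flE tr_col trmx1 row1. Qed.

Lemma ldet_fl (h : 'M[F]_n) : ldet (mkseq (fl h) n) = \det h.
Proof.
rewrite -[RHS]det_tr; congr (\det _); apply/row_matrixP => i.
by rewrite rowK nth_mkseq// flE tr_col.
Qed.

(* In the basis B_0, ..., B_(n-j-1), h_0, ..., h_(j-1), the coordinates of h_j
   on the h_i are the opposites of the entries of column j of u. *)
Lemma column_elimination (B : nat -> 'rV[F]_n) (h : 'M[F]_n) :
  (forall j, (j < n)%N -> ldet (mkseq B (n - j) ++ mkseq (fl h) j) != 0) ->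
  exists2 u : 'M_n, unitriangular u & forall j, (j < n)%N ->
    exists b : nat -> F, fl (h *m u) j = \sum_(m < n - j) b m *: B m.
Proof.
move=> B0.
pose P j := \matrix_(i < n) nth 0 (mkseq B (n - j) ++ mkseq (fl h) j) i.
pose y j := fl h j *m invmx (P j).
pose co j m := if insub m is Some k then (y j) 0 k else 0.
pose u := \matrix_(r < n, c < n)
  if (r < c)%N then - co c (n - c + r)%N else (r == c)%:R : F.
exists u => [r c cr|j jn]; first by rewrite mxE ltnNge cr.
exists (co j).
have Pu : P j \in unitmx by rewrite unitmxE unitfE B0.
have e_h : fl h j = \sum_(m < n - j) co j m *: B m
    + \sum_(i < j) co j (n - j + i)%N *: fl h i.
  rewrite -[LHS](mulmxKV Pu) mulmx_sum_row -/(y j).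
  under eq_bigr => k _ do rewrite rowK.
  rewrite (eq_bigr (fun k : 'I_n => co j k *: nth 0 (mkseq B (n - j) ++ mkseq (fl h) j) k)).
    rewrite -(big_mkord xpredT (fun k => co j k *: nth 0 (mkseq B (n - j) ++ mkseq (fl h) j) k)).
    rewrite (big_cat_nat (n := (n - j)%N))//=; last exact: leq_subr.
    congr (_ + _).
      rewrite big_mkord; apply: eq_bigr => m _.
      by rewrite nth_cat size_mkseq ltn_ord nth_mkseq.
    rewrite -{1}[(n - j)%N]add0n big_addn subKn 1?ltnW// big_mkord.
    apply: eq_bigr => m _; rewrite addnC nth_cat size_mkseq ltnNge leq_addr /= addKn.
    by rewrite nth_mkseq.
  by move=> k _; rewrite /co valK.
rewrite fl_mul mulmx_sum_row (bigD1 (Ordinal jn)) //=.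
rewrite -[j in fl u j]/(val (Ordinal jn)) flE !mxE ltnn eqxx scale1r.
rewrite -tr_col -(flE h (Ordinal jn)) /= [X in X + _]e_h -addrA.
rewrite (big_ord_widen n (fun i => co j (n - j + i)%N *: fl h i)) 1?ltnW//.
rewrite [X in _ + (X + _)]big_mkcond /= (bigD1 (Ordinal jn)) //= ltnn add0r.
rewrite -big_split /= [X in _ + X]big1 ?addr0// => k kj; rewrite -tr_col -(flE h k) !mxE /=.
case: ltnP => [kj'|jk]; first by rewrite scaleNr subrr.
by rewrite (negPf kj) scale0r addr0.
Qed.
End Elimination.

Section TriangularSystem.
Variables (F : fieldType) (n : nat) (a : nat -> F) (A : nat -> 'rV[F]_n).
Local Notation e := (fl (1%:M : 'M[F]_n)).
Hypothesis a_neq0 : forall l, (l < n)%N -> a l != 0.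
Hypothesis A_anti : forall l, (l < n)%N -> A l = a l *: e (n.-1 - l).

(** The common form of the minors of both faces: v is the flag of g1 or of g1g2g3, and A, placed
    last, that of g1g2. *)
Definition corner (v : nat -> 'rV[F]_n) (i j : nat) : F :=
  ldet (mkseq e (n - i - j) ++ mkseq v i ++ mkseq A j).

(** The unit vector is A_j / a_j, and behind A_0, ..., A_(j-1) it completes the first j+1 vectors of
    A. *)
Lemma ldet_pivot (v : nat -> 'rV[F]_n) i j : (i + j < n)%N ->
  ldet (mkseq e (n - i - j.+1) ++ mkseq v i ++ e (n.-1 - j) :: mkseq A j)
  = (-1) ^+ j / a j * corner v i j.+1.
Proof.
move=> ij; have jn : (j < n)%N by lia.
rewrite /corner mkseqS -cats1 A_anti// !catA ldet_scale; last first.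
  by rewrite !size_cat !size_mkseq; lia.
rewrite mulrA divfK ?a_neq0// -!catA.
have := @ldet_move _ _ (mkseq e (n - i - j.+1) ++ mkseq v i) (mkseq A j) [::] (e (n.-1 - j)).
by rewrite cats0 -!catA => ->; rewrite ?size_cat !size_mkseq//; lia.
Qed.

(** For i = 0 the unit vector in [ldet_pivot] may also be read as prolonging the initial run of unit
    vectors. Hence a_j is, up to sign, a quotient of consecutive minors on the edge between the
    vertices 0 and 2. *)
Lemma corner0S j : (j < n)%N ->
  corner (fun=> 0) 0 j.+1 = (-1) ^+ j * a j * corner (fun=> 0) 0 j.
Proof.
move=> jn; have := @ldet_pivot (fun=> 0) 0 j jn.
rewrite cat0s subn0 -cat_rcons (_ : (n.-1 - j = n - j.+1)%N); last by lia.
rewrite -mkseqS (_ : (n - j.+1).+1 = (n - j)%N); last by lia.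
rewrite /corner subn0 cat0s => ->.
by rewrite mulrA mulrACA -expr2 sqrr_sign mul1r divff ?mul1r ?a_neq0.
Qed.

(** The linear conditions on column i given the columns before it: equation x < i says that entry x
    is 0, as required of a lower triangular matrix, and equation x >= i prescribes the corner (i+1,
    n-1-x). *)
Definition column_system (v : nat -> 'rV[F]_n) (i : nat) : 'M[F]_n :=
  \matrix_(s, x) if (x < i)%N then (s == x)%:R
    else ldet (mkseq e (x - i) ++ mkseq v i ++ delta_mx 0 s :: mkseq A (n.-1 - x)).

Lemma column_systemE v i w x : (i < n)%N ->
  (w *m column_system v i) 0 x = if (x < i)%N then w 0 x
    else ldet (mkseq e (x - i) ++ mkseq v i ++ w :: mkseq A (n.-1 - x)).
Proof.
move=> i_n; rewrite mxE; case: ltnP => xi.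
  rewrite (bigD1 x)//= mxE xi eqxx mulr1 big1 ?addr0// => s sx.
  by rewrite mxE xi (negPf sx) mulr0.
rewrite catA ldet_coord; last by rewrite size_cat !size_mkseq; move: (ltn_ord x); lia.
by apply: eq_bigr => s _; rewrite mxE ltnNge xi /= catA.
Qed.

Lemma det_column_system v i : (i < n)%N -> \det (column_system v i)
  = \prod_(x < n) if (x < i)%N then 1
      else (-1) ^+ (n.-1 - x) / a (n.-1 - x) * corner v i (n - x).
Proof.
move=> i_n; rewrite -det_tr det_trig.
  apply: eq_bigr => x _; rewrite !mxE eqxx; case: ltnP => // xi.
  have xn := ltn_ord x; have := @ldet_pivot v i (n.-1 - x).
  rewrite (_ : (n - i - (n.-1 - x).+1 = x - i)%N); last by lia.
  rewrite (_ : (n.-1 - (n.-1 - x) = x)%N); last by lia.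
  rewrite (_ : (n.-1 - x).+1 = (n - x)%N); last by lia.
  by rewrite fl1 => ->//; lia.
(* Off the diagonal, for s > x >= i, the unit vector e_s is proportional to A_(n-1-s), which already
   occurs among the first n-1-x vectors of A. *)
apply/is_trig_mxP => x s xs; rewrite !mxE; case: ltnP => xi.
  by rewrite -val_eqE /= gtn_eqF.
have sn := ltn_ord s; set l := (n.-1 - s)%N.
have al : a l != 0 by apply: a_neq0; rewrite /l; lia.
apply: (mulfI al); rewrite mulr0 catA -ldet_scale; last first.
  by rewrite size_cat !size_mkseq; lia.
have es : delta_mx 0 s = e (n.-1 - l) by rewrite (_ : (n.-1 - l = s)%N) ?fl1// /l; lia.
rewrite es -A_anti; last by rewrite /l; lia.
apply: (@ldet_eq0 _ _ _ x (x + l.+1)); first by rewrite /l; lia.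
rewrite !nth_cat !size_cat !size_mkseq.
have -> : (x - i + i = x)%N by lia.
rewrite ltnn subnn ltnNge leq_addr addKn /= nth_mkseq// /l; lia.
Qed.

(** The system for column i depends only on the earlier columns; its pivots are given by corners
    with i vectors of v and its right-hand side by zeros and corners with i+1. *)
Lemma columns_unique (v w : nat -> 'rV[F]_n) :
  (forall i (x : 'I_n), (x < i < n)%N -> v i 0 x = 0) ->
  (forall i (x : 'I_n), (x < i < n)%N -> w i 0 x = 0) ->
  (forall i j, (i + j <= n)%N -> corner v i j != 0) ->
  (forall i j, (i + j <= n)%N -> corner v i j = corner w i j) ->
  forall i, (i < n)%N -> v i = w i.
Proof.
move=> v0 w0 c0 vw i; have [k] := ubnP i; elim: k i => // k IH i ik i_n.
have e_pre : mkseq v i = mkseq w i.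
  apply: (@eq_from_nth _ 0); rewrite !size_mkseq// => m mi.
  by rewrite !nth_mkseq// IH//; lia.
have e_sys : column_system v i = column_system w i.
  by apply/matrixP => s x; rewrite !mxE e_pre.
have Tu : column_system v i \in unitmx.
  rewrite unitmxE unitfE det_column_system//; apply/prodf_neq0 => x _.
  case: ltnP => xi; first exact: oner_neq0.
  have xn := ltn_ord x; rewrite !mulf_neq0 ?signr_eq0 ?invr_eq0 ?a_neq0 ?c0//; lia.
apply: (can_inj (mulmxK Tu)); apply/rowP => x.
rewrite [in RHS]e_sys !column_systemE//; case: ltnP => xi.
  by rewrite v0 ?w0 ?xi.
have xn := ltn_ord x; have := @vw i.+1 (n.-1 - x)%N; rewrite /corner !mkseqS !cat_rcons.
by rewrite (_ : (n - i.+1 - (n.-1 - x) = x - i)%N); [apply; lia|lia].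
Qed.

End TriangularSystem.

Section ParametricColumns.
Variables (F : fieldType) (n : nat) (T : Type) (G : (T -> F) -> Prop).
Local Notation alg := (generated_algebra G).
Local Notation e := (fl (1%:M : 'M[F]_n)).
Variables (a : T -> nat -> F) (A : T -> nat -> 'rV[F]_n) (c : T -> nat -> nat -> F).
Hypothesis a_neq0 : forall t l, (l < n)%N -> a t l != 0.
Hypothesis a_alg : forall l, (l < n)%N -> alg (a ^~ l).
Hypothesis A_anti : forall t l, (l < n)%N -> A t l = a t l *: e (n.-1 - l).
Hypothesis c_neq0 : forall t i j, (i + j <= n)%N -> c t i j != 0.
Hypothesis c_alg : forall i j, (i + j <= n)%N -> alg (fun t => c t i j).
Hypothesis cV_alg : forall i j, (i + j <= n)%N -> alg (fun t => (c t i j)^-1).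
Hypothesis c0 : forall t j, (j <= n)%N -> corner (A t) (fun=> 0) 0 j = c t 0 j.

Let A_alg l x : (l < n)%N -> alg (fun t => A t l 0 x).
Proof.
move=> ln; apply: (gen_ext (f := fun t => a t l * e (n.-1 - l)%N 0 x)).
  by move=> t; rewrite A_anti// !mxE.
by apply: gen_mul; [exact: a_alg|exact: gen_cst].
Qed.

Let system_alg (v : T -> nat -> 'rV[F]_n) i : (i < n)%N ->
  (forall l x, alg (fun t => v t l 0 x)) ->
  forall s x, alg (fun t => column_system (A t) (v t) i s x).
Proof.
move=> i_n v_alg s x; have [xi|xi] := ltnP x i.
  by apply: (gen_ext _ (gen_cst _ (s == x)%:R)) => t; rewrite mxE xi.
apply: (gen_ext (f := fun t => ldet (mkseq e (x - i) ++ mkseq (v t) i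
    ++ delta_mx 0 s :: mkseq (A t) (n.-1 - x)))).
  by move=> t; rewrite mxE ltnNge xi.
apply: gen_ldet; apply: (gen_nth_cat (N := (x - i)%N)) => [t|k y|].
- by rewrite size_mkseq.
- exact: gen_cst.
apply: (gen_nth_cat (N := i)) => [t| |[|k] y].
- by rewrite size_mkseq.
- exact: gen_nth_mkseq.
- exact: gen_cst.
have [kn|kn] := ltnP k (n.-1 - x).
  apply: (gen_ext (f := fun t => A t k 0 y)); last by apply: A_alg; lia.
  by move=> t; rewrite /= nth_mkseq.
by apply: (gen_ext _ (gen_cst _ 0)) => t; rewrite /= nth_default ?size_mkseq// mxE.
Qed.

(** The same triangular systems solved for prescribed corners. By Cramer's rule the solution stays
    in the algebra once the inverses of the pivots do. *)
Lemma parametric_columns : exists v : T -> nat -> 'rV[F]_n, [/\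
  forall l x, alg (fun t => v t l 0 x),
  forall t i (x : 'I_n), (x < i < n)%N -> v t i 0 x = 0 &
  forall t i j, (i + j <= n)%N -> corner (A t) (v t) i j = c t i j].
Proof.
suff H k : (k <= n)%N -> exists v : T -> nat -> 'rV[F]_n, [/\
  forall l x, alg (fun t => v t l 0 x),
  forall t i (x : 'I_n), (x < i < k)%N -> v t i 0 x = 0 &
  forall t i j, (i <= k)%N -> (i + j <= n)%N -> corner (A t) (v t) i j = c t i j].
  have [v [v1 v2 v3]] := H n (leqnn n); exists v; split=> // t i j ij.
  by apply: v3 => //; lia.
elim: k => [_|k IH kn].
  exists (fun _ _ => 0); split=> [l x|t i x|t i j].
  - by apply: (gen_ext _ (gen_cst _ 0)) => t; rewrite mxE.
  - by rewrite ltn0 andbF.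
  - by rewrite leqn0 => /eqP -> jn; apply: c0.
have [v [v_alg v_low v_corner]] := IH (ltnW kn).
pose S t := column_system (A t) (v t) k.
have detS t : \det (S t) = \prod_(x < n) if (x < k)%N then 1
      else (-1) ^+ (n.-1 - x) / a t (n.-1 - x) * c t k (n - x).
  rewrite (det_column_system (a_neq0 t) (A_anti t))//; apply: eq_bigr => x _.
  by case: ltnP => // kx; rewrite v_corner//; move: (ltn_ord x); lia.
have detS_neq0 t : \det (S t) != 0.
  rewrite detS; apply/prodf_neq0 => x _; case: ltnP => kx; first exact: oner_neq0.
  have xn := ltn_ord x.
  by rewrite !mulf_neq0 ?signr_eq0 ?invr_eq0 ?a_neq0 ?c_neq0//; lia.
have detSV : alg (fun t => (\det (S t))^-1).
  (* A pivot is (-1)^l c / a, so its inverse calls for a and c^-1 but not for a^-1. *)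
  apply: (gen_ext (f := fun t => \prod_(x < n) (if (x < k)%N then 1
      else (-1) ^+ (n.-1 - x) / a t (n.-1 - x) * c t k (n - x))^-1)).
    by move=> t; rewrite detS prodfV.
  apply: gen_prod => x _; have xn := ltn_ord x; case: ltnP => kx; first exact: gen_cst.
  apply: (gen_ext (f := fun t => ((-1) ^+ (n.-1 - x) * a t (n.-1 - x)) * (c t k (n - x))^-1)).
    by move=> t; rewrite !invfM invrK -exprVn invrN1.
  apply: gen_mul; last by apply: cV_alg; lia.
  by apply: gen_mul; [exact: gen_cst|apply: a_alg; lia].
pose b t : 'rV[F]_n := \row_x if (x < k)%N then 0 else c t k.+1 (n.-1 - x).
pose w t := b t *m invmx (S t).
have wS t : w t *m S t = b t by rewrite mulmxKV// unitmxE unitfE.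
pose v' t m := if m == k then w t else v t m.
have pre t i : (i <= k)%N -> mkseq (v' t) i = mkseq (v t) i.
  move=> ik; apply: (@eq_from_nth _ 0); rewrite !size_mkseq// => m mi.
  by rewrite !nth_mkseq// /v' ltn_eqF//; lia.
exists v'; split=> [l x|t i x /andP[xi]|t i j].
- rewrite /v'; case: eqP => // _; apply: gen_mulmx => [u y|].
    have [yk|ky] := ltnP y k.
      by apply: (gen_ext _ (gen_cst _ 0)) => t; rewrite mxE yk.
    apply: (gen_ext (f := fun t => c t k.+1 (n.-1 - y))) => [t|].
      by rewrite mxE ltnNge ky.
    by apply: c_alg; move: (ltn_ord y); lia.
  by apply: gen_invmx => //; apply: system_alg.
- rewrite ltnS leq_eqVlt /v' => /orP[/eqP ik|ik]; last first.
    by rewrite ltn_eqF// v_low// xi.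
  have := column_systemE (A t) (v t) (w t) x kn.
  by rewrite ik eqxx -/(S t) wS mxE -ik xi.
rewrite leq_eqVlt => /orP[/eqP -> kj|ik ij]; last first.
  by rewrite /corner pre// -/(corner _ _ _ _) v_corner.
have jn : (n.-1 - j < n)%N by lia.
have := column_systemE (A t) (v t) (w t) (Ordinal jn) kn.
rewrite -/(S t) wS mxE /= ltnNge (_ : (k <= n.-1 - j)%N) /=; last by lia.
rewrite (_ : (n.-1 - (n.-1 - j) = j)%N) => [->|]; last by lia.
rewrite /corner mkseqS pre// /v' eqxx cat_rcons.
by have -> : (n - k.+1 - j = n.-1 - j - k)%N by lia.
Qed.

End ParametricColumns.

Lemma corner_ext (F : fieldType) n (A A' v v' : nat -> 'rV[F]_n) i j :
  (i + j <= n)%N -> (forall l, (l < n)%N -> A l = A' l) ->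
  (forall l, (l < n)%N -> v l = v' l) -> corner A v i j = corner A' v' i j.
Proof.
move=> ij AA' vv'; rewrite /corner; congr (ldet (_ ++ _ ++ _)).
  apply: (@eq_from_nth _ 0); rewrite !size_mkseq// => m mi.
  by rewrite !nth_mkseq// vv'//; lia.
apply: (@eq_from_nth _ 0); rewrite !size_mkseq// => m mi.
by rewrite !nth_mkseq// AA'//; lia.
Qed.

Lemma fl_inj (F : fieldType) n (h h' : 'M[F]_n) :
  (forall l, (l < n)%N -> fl h l = fl h' l) -> h = h'.
Proof.
move=> hh'; apply/matrixP => x c; have := hh' c (ltn_ord c).
by rewrite !flE => /rowP/(_ x); rewrite !mxE.
Qed.

Definition mx_of_columns (F : fieldType) n (v : nat -> 'rV[F]_n) : 'M[F]_n :=
  \matrix_(x, c) v c 0 x.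

Lemma fl_mx_of_columns (F : fieldType) n (v : nat -> 'rV[F]_n) l :
  (l < n)%N -> fl (mx_of_columns v) l = v l.
Proof.
move=> ln; rewrite -[l]/(val (Ordinal ln)) flE.
by apply/rowP => x; rewrite !mxE.
Qed.

(** * Triples through their partial products; uniqueness of normal forms *)

Section Configurations.
Variables (R : realType) (n : nat).
Local Notation C := R[i].
Local Notation GL := (GL R n).
Local Notation GL3 := (GL3 R n).
Local Notation e := (fl (1%:M : 'M[C]_n)).

(** In terms of the partial products h_i the action decouples on the right: h_i becomes w0 h_i
    w_i^-1. *)
Definition config (h1 h2 h3 : GL) : GL3 := (h1, (h1^-1 * h2)%g, (h2^-1 * h3)%g).

Lemma configE (g : GL3) : g = config g.1.1 (g.1.1 * g.1.2)%g (g.1.1 * g.1.2 * g.2)%g.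
Proof. by case: g => [[g1 g2] g3]; rewrite /config /= !mulKg. Qed.

Lemma act_config w0 w1 w2 w3 h1 h2 h3 :
  act w0 w1 w2 w3 (config h1 h2 h3)
  = config (w0 * h1 * w1^-1)%g (w0 * h2 * w2^-1)%g (w0 * h3 * w3^-1)%g.
Proof.
rewrite /act /config /=; congr (_, _, _).
  by rewrite !invgM invgK !mulgA mulgVK.
by rewrite !invgM invgK !mulgA mulgVK.
Qed.

Lemma flags1_config h1 h2 h3 : flags1 (config h1 h2 h3) = fl h1.
Proof. by []. Qed.

Lemma flags2_config h1 h2 h3 : flags2 (config h1 h2 h3) = fl h2.
Proof. by rewrite /flags2 -[_ *m _]/(glval (h1 * (h1^-1 * h2))%g) mulVKg. Qed.

Lemma flags3_config h1 h2 h3 : flags3 (config h1 h2 h3) = fl h3.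
Proof.
rewrite /flags3 -[_ *m _ *m _]/(glval (h1 * (h1^-1 * h2) * (h2^-1 * h3))%g).
by rewrite mulVKg mulVKg.
Qed.

Lemma multi_corner_face1 (g : GL3) i j : (i + j <= n)%N ->
  multi_corner i j 0 g = corner (flags2 g) (flags1 g) i j.
Proof.
move=> ij; rewrite multi_cornerE; last by lia.
by rewrite /bracket cats0 subn0.
Qed.

(** The sign comes from moving the flag of g1g2 behind that of g1g2g3, as [corner] demands. *)
Lemma multi_corner_face3 (g : GL3) j k : (j + k <= n)%N ->
  multi_corner 0 j k g = (-1) ^+ (j * k) * corner (flags2 g) (flags3 g) k j.
Proof.
move=> jk; rewrite multi_cornerE; last by lia.
have := @ldet_cat_swap _ n (mkseq e (n - j - k)) (mkseq (flags2 g) j) (mkseq (flags3 g) k) [::].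
rewrite !size_mkseq !cats0 /bracket subn0 /= => ->; last by lia.
by rewrite /corner subnAC.
Qed.

Definition normal_form (g : GL3) : Prop := [/\
  exists a : nat -> C, forall l, (l < n)%N -> a l != 0 /\ flags2 g l = a l *: e (n.-1 - l),
  forall i (x : 'I_n), (x < i < n)%N -> flags1 g i 0 x = 0 &
  forall i (x : 'I_n), (x < i < n)%N -> flags3 g i 0 x = 0].

Definition faces_neq0 (g : GL3) : Prop := forall i j k, (i + j + k <= n)%N ->
  on_k0_i0 i j k -> multi_corner i j k g != 0.

Lemma normal_form_unique (g g' : GL3) : normal_form g -> normal_form g' -> faces_neq0 g ->
  (forall i j k, (i + j + k <= n)%N -> on_k0_i0 i j k ->
     multi_corner i j k g = multi_corner i j k g') -> g = g'.
Proof.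
move=> [[a ga] g1 g3] [[a' ga'] g1' g3'] g0 gg'.
have e0 (g'' : GL3) j : (j <= n)%N -> corner (flags2 g'') (fun=> 0) 0 j = multi_corner 0 j 0 g''.
  by move=> jn; rewrite multi_corner_face1.
have a0 l ln := (ga l ln).1; have aE l ln := (ga l ln).2.
have a0' l ln := (ga' l ln).1; have aE' l ln := (ga' l ln).2.
have e2 l : (l < n)%N -> flags2 g l = flags2 g' l.
  move=> ln; rewrite aE// aE'//; congr (_ *: _).
  (* The minors (0, l, 0) and (0, l+1, 0) determine a_l. *)
  have := corner0S a0 aE ln; have := corner0S a0' aE' ln; rewrite !e0 ?(ltnW ln)//.
  rewrite -!gg' ?addn0 ?(ltnW ln)// => ->; rewrite -!mulrA => /(mulfI _).
  move=> /(_ ltac:(by rewrite signr_eq0)) /(mulIf _)-> //.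
  by rewrite g0 ?addn0 ?(ltnW ln).
have E2 : (g.1.1 * g.1.2)%g = (g'.1.1 * g'.1.2)%g.
  by apply: val_inj; apply: fl_inj => l ln; apply: e2.
have e_fl2 : flags2 g = flags2 g' by rewrite /flags2 -[LHS]/(fl (glval (g.1.1 * g.1.2)%g)) E2.
have c1 i j : (i + j <= n)%N -> corner (flags2 g) (flags1 g) i j = multi_corner i j 0 g.
  by move=> ij; rewrite (multi_corner_face1 g ij).
have c1' i j : (i + j <= n)%N -> corner (flags2 g) (flags1 g') i j = multi_corner i j 0 g'.
  by move=> ij; rewrite (multi_corner_face1 g' ij) e_fl2.
have swap i j : (i + j <= n)%N -> (j + i <= n)%N by rewrite addnC.
have c3 i j : (i + j <= n)%N ->
    corner (flags2 g) (flags3 g) i j = (-1) ^+ (j * i) * multi_corner 0 j i g.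
  move=> ij; rewrite (multi_corner_face3 g (swap _ _ ij)) mulrA -expr2 sqrr_sign.
  exact/esym/mul1r.
have c3' i j : (i + j <= n)%N ->
    corner (flags2 g) (flags3 g') i j = (-1) ^+ (j * i) * multi_corner 0 j i g'.
  move=> ij; rewrite (multi_corner_face3 g' (swap _ _ ij)) mulrA -expr2 sqrr_sign e_fl2.
  exact/esym/mul1r.
have E1 : g.1.1 = g'.1.1.
  have cols : forall l, (l < n)%N -> flags1 g l = flags1 g' l.
    apply: (columns_unique a0 aE g1 g1') => i j ij.
      by rewrite (c1 _ _ ij); apply: g0 => //; rewrite addn0.
    by rewrite (c1 _ _ ij) (c1' _ _ ij); apply: gg' => //; rewrite addn0.
  by apply: val_inj; apply: fl_inj => l ln; apply: cols.
have E3 : (g.1.1 * g.1.2 * g.2)%g = (g'.1.1 * g'.1.2 * g'.2)%g.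
  have cols : forall l, (l < n)%N -> flags3 g l = flags3 g' l.
    apply: (columns_unique a0 aE g3 g3') => i j ij.
      rewrite (c3 _ _ ij); apply: mulf_neq0; first by rewrite signr_eq0.
      by apply: g0; [exact: swap|rewrite /on_k0_i0 orbT].
    rewrite (c3 _ _ ij) (c3' _ _ ij); congr (_ * _).
    by apply: gg'; [exact: swap|rewrite /on_k0_i0 orbT].
  by apply: val_inj; apply: fl_inj => l ln; apply: cols.
by rewrite [g]configE [g']configE E3 E2 E1.
Qed.

End Configurations.

Section AntiTriangular.
Variables (F : fieldType) (n : nat) (X : 'M[F]_n).
Hypothesis X_unit : X \in unitmx.
Hypothesis X_anti : forall x c : 'I_n, (n <= x + c)%N -> X x c = 0.

Lemma anti_triangular_diag c : X (rev_ord c) c != 0.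
Proof.
(* Reversing the rows makes X lower triangular, with the antidiagonal entries on its diagonal. *)
pose s := perm (@rev_ord_inj n).
have : \det (row_perm s X) != 0.
  rewrite row_permE det_mulmx det_perm mulf_neq0 ?signr_eq0//.
  by rewrite -unitfE -unitmxE.
rewrite det_trig => [/prodf_neq0/(_ c isT)|]; first by rewrite mxE permE.
apply/is_trig_mxP => x y xy; rewrite mxE permE X_anti//=; lia.
Qed.

Lemma anti_triangular_factor : exists (w A : 'M[F]_n) (a : nat -> F),
  [/\ unitriangular w, X = w *m A &
      forall l, (l < n)%N -> a l != 0 /\ fl A l = a l *: fl 1%:M (n.-1 - l)].
Proof.
(* X with its columns reversed and divided by their antidiagonal entries. *)
pose w := \matrix_(x, y) (X x (rev_ord y) / X y (rev_ord y)).
pose A := \matrix_(x, c) (if x == rev_ord c then X x c else 0) : 'M[F]_n.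
exists w, A, (fun l => if insub l is Some c then X (rev_ord c) c else 0); split.
- move=> x y yx; rewrite mxE; have [<-|ne] := eqVneq x y.
    by rewrite divff// -{1}[x]rev_ordK anti_triangular_diag.
  rewrite X_anti ?mul0r//= ; have : x != y :> nat by []; have := ltn_ord y; lia.
- apply/matrixP => x c; rewrite mxE (bigD1 (rev_ord c))//= big1 ?addr0.
    by rewrite !mxE eqxx rev_ordK divfK// anti_triangular_diag.
  by move=> y yc; rewrite !mxE (negPf yc) mulr0.
- move=> l ln; rewrite -[l]/(val (Ordinal ln)) valK; split.
    exact: anti_triangular_diag.
  have -> : (n.-1 - val (Ordinal ln) = rev_ord (Ordinal ln))%N by rewrite /=; lia.
  rewrite fl1 (flE A); apply/rowP => x; rewrite !mxE eqxx /=.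
  by case: eqP => [->|_]; rewrite ?mulr1 ?mulr0.
Qed.

End AntiTriangular.

(** * Existence of normal forms *)

Section Orbits.
Variables (R : realType) (n : nat).
Local Notation C := R[i].
Local Notation GL := (GL R n).
Local Notation GL3 := (GL3 R n).
Local Notation e := (fl (1%:M : 'M[C]_n)).

Lemma unitriangular_unit (u : 'M[C]_n) : unitriangular u -> u \in unitmx.
Proof. by move=> /det_unitriangular u1; rewrite unitmxE u1 unitr1. Qed.

Lemma unipotent1 : unipotent (1%g : GL).
Proof. by move=> i j _; rewrite mxE. Qed.

Lemma to_normal_form (g : GL3) : faces_neq0 g ->
  exists2 g' : GL3, normal_form g' & forall f, U4_invariant f -> f g = f g'.
Proof.
move=> g0; set h1 := g.1.1; pose h2 := (g.1.1 * g.1.2)%g; pose h3 := (g.1.1 * g.1.2 * g.2)%g.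
(* Column c of h2 u2 lies in the span of e_0, ..., e_(n-1-c), so h2 u2 vanishes below the
   antidiagonal and factors as w0 A. *)
have [j jn|u2 U2 X_span] := @column_elimination _ n e h2.
  have := g0 0 j 0; rewrite addn0 => /(_ (ltnW jn) isT).
  by rewrite (multi_corner_face1 g (i := 0) (ltnW jn)) /corner subn0.
have X_unit : glval h2 *m u2 \in unitmx by rewrite unitmx_mul glvalP unitriangular_unit.
have [x c xc|w0 [A [a [W0 XA aA]]]] := anti_triangular_factor X_unit.
  have [b eb] := X_span c (ltn_ord c).
  have := congr1 (fun v : 'rV_n => v 0 x) eb; rewrite flE !mxE summxE => ->.
  rewrite big1// => m _; have mn : (m < n)%N by move: (ltn_ord m); lia.
  rewrite -[m : nat]/(val (Ordinal mn)) fl1 !mxE eqxx /= -val_eqE /=.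
  by rewrite gtn_eqF ?mulr0//; move: (ltn_ord m); lia.
have A_unit : A \in unitmx by move: X_unit; rewrite XA unitmx_mul => /andP[].
pose GA := MkGL A_unit.
pose W := MkGL (unitriangular_unit W0); pose V2 := MkGL (unitriangular_unit U2).
pose g1 := config (W^-1 * h1)%g GA (W^-1 * h3)%g.
have eg1 : g = act W 1%g V2 1%g g1.
  rewrite /g1 act_config [LHS]configE -/h1 -/h2 -/h3; congr config.
  - by rewrite invg1 mulg1 mulVKg.
  - have : (h2 * V2 = W * GA)%g by apply: val_inj; rewrite /= XA.
    by move=> <-; rewrite mulgK.
  - by rewrite invg1 mulg1 mulVKg.
have g1_inv f : U4_invariant f -> f g = f g1.
  by move=> If; rewrite eg1 If//; exact: unipotent1.
have g10 : faces_neq0 g1.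
  move=> i j k ijk face; rewrite -(g1_inv _ (multi_corner_invariant ijk)).
  exact: g0.
(* Elimination against A instead of the unit vectors: A_0, ..., A_(n-1-i) span e_i, ..., e_(n-1),
   which makes h lower triangular. *)
have elim_col (h : GL) : (forall j, (j <= n)%N -> ldet (mkseq (fl A) (n - j) ++ mkseq (fl h) j) != 0) ->
    exists2 u : GL, unipotent u & forall i (x : 'I_n), (x < i < n)%N -> fl (glval (h * u)%g) i 0 x = 0.
  move=> h0; have [j jn|u U h_span] := @column_elimination _ n (fl A) h; first by rewrite h0 ?(ltnW jn).
  exists (MkGL (unitriangular_unit U)) => // i x /andP[xi i_n].
  have [b /=] := h_span i i_n; rewrite -/(glval _) => ->.
  rewrite summxE big1// => m _; have mn : (m < n)%N by move: (ltn_ord m); lia.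
  rewrite !mxE (aA m mn).2 !mxE.
  have ln : (n.-1 - m < n)%N by lia.
  rewrite -[(n.-1 - m)%N]/(val (Ordinal ln)) fl1 !mxE eqxx /= -val_eqE /=.
  by rewrite ltn_eqF ?mulr0//; move: (ltn_ord m); lia.
(* The brackets required here are the minors with i + j = n and k = 0, in which no unit vector
   occurs. *)
have [j jn|w1 U1 L1] := elim_col (W^-1 * h1)%g.
  have := g10 j (n - j)%N 0; rewrite /on_k0_i0 eqxx => /(_ ltac:(lia) isT).
  rewrite multi_corner_face1; last by lia.
  rewrite flags2_config flags1_config /corner (_ : n - j - (n - j) = 0)%N; last by lia.
  apply: contra => /eqP h0; have := @ldet_cat_swap _ n [::] (mkseq (fl (glval (W^-1 * h1)%g)) j) (mkseq (fl A) (n - j)) [::].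
  by rewrite !cats0 !cat0s h0 mulr0 => ->//; rewrite !size_mkseq /=; lia.
have [k kn|w3 U3 L3] := elim_col (W^-1 * h3)%g.
  have := g10 0 (n - k)%N k; rewrite /on_k0_i0 eqxx orbT => /(_ ltac:(lia) isT).
  rewrite multi_cornerE; last by lia.
  rewrite /bracket flags2_config flags3_config (_ : n - 0 - (n - k) - k = 0)%N //; lia.
exists (config (W^-1 * h1 * w1)%g GA (W^-1 * h3 * w3)%g).
  split; last 2 first.
  - by rewrite flags1_config.
  - by rewrite flags3_config.
  by exists a => l ln; rewrite flags2_config; apply: aA.
move=> f If; rewrite (g1_inv _ If).
rewrite -[f (config _ _ (_ * w3)%g)](If 1%g w1 1%g w3)//; try exact: unipotent1.
by rewrite act_config !mul1g !mulgK invg1 mulg1.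
Qed.

End Orbits.

(** * The chart *)

Section DeltaPoints.
Variables (n : nat) (P : nat -> nat -> nat -> bool).

(** [inord] reads an index beyond n as 0, so the result is meaningful only for i + j + k <= n. *)
Definition delta_point (i j k : nat) : option (Delta3_sub n P) :=
  insub (inord i, inord j, inord k).

Lemma delta_point_val (s : Delta3_sub n P) :
  delta_point (val s).1.1 (val s).1.2 (val s).2 = Some s.
Proof. by rewrite /delta_point !inord_val -!surjective_pairing valK. Qed.

Lemma delta_point_Some i j k s :
  delta_point i j k = Some s -> val s = (inord i, inord j, inord k).
Proof. by rewrite /delta_point; case: insubP => // u _ eu [<-]. Qed.

Lemma delta_point_None i j k : (i + j + k <= n)%N -> delta_point i j k = None -> ~~ P i j k.
Proof.
by move=> ijk; rewrite /delta_point; case: insubP => //=; rewrite !inordK ?ijk //; lia.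
Qed.

End DeltaPoints.

Lemma chart_point_None n i j k : (i + j + k <= n)%N -> on_k0_i0 i j k ->
  delta_point n chart_index i j k = None -> (i, j, k) = (0, 0, 0)%N.
Proof.
by move=> ijk face /(delta_point_None ijk); rewrite /chart_index face andbT negbK => /eqP.
Qed.

Lemma chart_point000 n : delta_point n chart_index 0 0 0 = None.
Proof. by rewrite /delta_point insubF// /chart_index /= !inordK //= eqxx andbF. Qed.

Section NormalSection.
Variables (R : realType) (n : nat).
Local Notation C := R[i].
Local Notation torus := (torus R (Delta3_sub n chart_index)).
Local Notation alg := (generated_algebra (@laurent_generator R (Delta3_sub n chart_index))).

(** The default 1 is the value of the minor (0, 0, 0), the only face point that is not a
    coordinate. *)
Definition face_value (t : torus) (i j k : nat) : C :=
  if delta_point n chart_index i j k is Some s then t s else 1.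

Lemma face_value_neq0 t i j k : face_value t i j k != 0.
Proof. by rewrite /face_value; case: delta_point => [s|]; rewrite ?coord_neq0 ?oner_eq0. Qed.

Lemma face_value_laurent i j k : alg (fun t => face_value t i j k).
Proof.
rewrite /face_value; case: delta_point => [s|]; last exact: gen_cst.
by apply/gen_mem/laurent_var.
Qed.

Lemma face_valueV_laurent i j k : alg (fun t => (face_value t i j k)^-1).
Proof.
rewrite /face_value; case: delta_point => [s|]; last exact: gen_cst.
by apply/gen_mem/laurent_inv.
Qed.

Lemma face_value000 t : face_value t 0 0 0 = 1.
Proof. by rewrite /face_value chart_point000. Qed.

Lemma corner_full (h : 'M[C]_n) (A : nat -> 'rV[C]_n) :
  corner A (fl h) n 0 = \det h.
Proof. by rewrite /corner subnn subn0 /= cats0 ldet_fl. Qed.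

Lemma normal_section : exists sigma : torus -> GL3 R n, [/\
  forall f, regular_GL3 f -> laurent (fun t => f (sigma t)),
  forall t, normal_form (sigma t) &
  forall t i j k, (i + j + k <= n)%N -> on_k0_i0 i j k ->
    multi_corner i j k (sigma t) = face_value t i j k].
Proof.
(* The solution of the recursion in [corner0S] for the prescribed edge minors. *)
pose a (t : torus) l := (-1) ^+ l * face_value t 0 l.+1 0 / face_value t 0 l 0.
pose A t l : 'rV[C]_n := a t l *: fl 1%:M (n.-1 - l).
pose c1 t i j := face_value t i j 0.
pose c3 t k j := (-1) ^+ (j * k) * face_value t 0 j k.
have a0 t l : (l < n)%N -> a t l != 0.
  by move=> _; rewrite !mulf_neq0 ?signr_eq0 ?invr_eq0 ?face_value_neq0.
have a_alg l : (l < n)%N -> alg (a ^~ l).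
  move=> _; apply: gen_mul; last exact: face_valueV_laurent.
  by apply: gen_mul; [exact: gen_cst|exact: face_value_laurent].
have AE t l : (l < n)%N -> A t l = a t l *: fl 1%:M (n.-1 - l) by [].
have A0 t j : (j <= n)%N -> corner (A t) (fun=> 0) 0 j = face_value t 0 j 0.
  elim: j => [_|j IH jn].
    by rewrite /corner !subn0 !cats0 ldet_fl det1 face_value000.
  rewrite (corner0S (a0 t) (AE t))// IH ?(ltnW jn)// /a.
  by rewrite -mulrA divfK ?face_value_neq0// mulrA -expr2 sqrr_sign mul1r.
have [v1 [v1_alg v1_low v1_corner]] : exists v : torus -> nat -> 'rV[C]_n, [/\
    forall l x, alg (fun t => v t l 0 x),
    forall t i (x : 'I_n), (x < i < n)%N -> v t i 0 x = 0 &
    forall t i j, (i + j <= n)%N -> corner (A t) (v t) i j = c1 t i j].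
  apply: (parametric_columns a0 a_alg AE) => *.
  - exact: face_value_neq0.
  - exact: face_value_laurent.
  - exact: face_valueV_laurent.
  - exact: A0.
have [v3 [v3_alg v3_low v3_corner]] : exists v : torus -> nat -> 'rV[C]_n, [/\
    forall l x, alg (fun t => v t l 0 x),
    forall t i (x : 'I_n), (x < i < n)%N -> v t i 0 x = 0 &
    forall t i j, (i + j <= n)%N -> corner (A t) (v t) i j = c3 t i j].
  apply: (parametric_columns a0 a_alg AE) => [t i j _|i j _|i j _|t j jn].
  - by rewrite mulf_neq0 ?signr_eq0 ?face_value_neq0.
  - by apply: gen_mul; [exact: gen_cst|exact: face_value_laurent].
  - apply: (gen_ext (f := fun t => (-1) ^+ (j * i) * (face_value t 0 j i)^-1)).
      by move=> t; rewrite invfM -exprVn invrN1.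
    by apply: gen_mul; [exact: gen_cst|exact: face_valueV_laurent].
  - by rewrite A0// /c3 muln0 mul1r.
pose h1 t := mx_of_columns (v1 t); pose h2 t := mx_of_columns (A t).
pose h3 t := mx_of_columns (v3 t).
have flh1 t l : (l < n)%N -> v1 t l = fl (h1 t) l by move=> ln; rewrite fl_mx_of_columns.
have flh2 t l : (l < n)%N -> A t l = fl (h2 t) l by move=> ln; rewrite fl_mx_of_columns.
have flh3 t l : (l < n)%N -> v3 t l = fl (h3 t) l by move=> ln; rewrite fl_mx_of_columns.
have corner1 t i j : (i + j <= n)%N -> corner (fl (h2 t)) (fl (h1 t)) i j = c1 t i j.
  by move=> ij; rewrite -(v1_corner t _ _ ij); apply: esym (corner_ext ij (flh2 t) (flh1 t)).
have corner3 t i j : (i + j <= n)%N -> corner (fl (h2 t)) (fl (h3 t)) i j = c3 t i j.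
  by move=> ij; rewrite -(v3_corner t _ _ ij); apply: esym (corner_ext ij (flh2 t) (flh3 t)).
have n0 : (n + 0 <= n)%N by rewrite addn0.
have det1E t : \det (h1 t) = c1 t n 0%N.
  by rewrite -(corner1 t _ _ n0) corner_full.
have det2E t : \det (h2 t) = face_value t 0 n 0.
  have e : c1 t 0%N n = face_value t 0 n 0 by [].
  by rewrite -e -(corner1 t 0 n (leqnn n)) /corner subn0 subnn ldet_fl.
have det3E t : \det (h3 t) = c3 t n 0%N.
  by rewrite -(corner3 t _ _ n0) corner_full.
have c3_neq0 t k j : c3 t k j != 0 by rewrite mulf_neq0 ?signr_eq0 ?face_value_neq0.
have det1_neq0 t : \det (h1 t) != 0 by rewrite det1E face_value_neq0.
have det2_neq0 t : \det (h2 t) != 0 by rewrite det2E face_value_neq0.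
have det3_neq0 t : \det (h3 t) != 0 by rewrite det3E.
have unit1 t : h1 t \in unitmx by rewrite unitmxE unitfE.
have unit2 t : h2 t \in unitmx by rewrite unitmxE unitfE.
have unit3 t : h3 t \in unitmx by rewrite unitmxE unitfE.
pose sigma t := config (MkGL (unit1 t)) (MkGL (unit2 t)) (MkGL (unit3 t)).
have h1_alg x c : alg (fun t => h1 t x c).
  by apply: (gen_ext _ (v1_alg c x)) => t; rewrite mxE.
have h2_alg x c : alg (fun t => h2 t x c).
  apply: (gen_ext (f := fun t => a t c * fl (1%:M : 'M[C]_n) (n.-1 - c)%N 0 x)).
    by move=> t; rewrite !mxE.
  by apply: gen_mul; [exact: a_alg|exact: gen_cst].
have h3_alg x c : alg (fun t => h3 t x c).
  by apply: (gen_ext _ (v3_alg c x)) => t; rewrite mxE.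
(* The determinants are, up to sign, the minors at the vertices (n, 0, 0), (0, n, 0) and (0, 0, n),
   hence invertible Laurent monomials; thus inverse determinants also pull back to Laurent
   polynomials. *)
have det_alg1 : alg (fun t => (\det (h1 t))^-1).
  by apply: (gen_ext _ (face_valueV_laurent n 0 0)) => t; rewrite det1E.
have det_alg2 : alg (fun t => (\det (h2 t))^-1).
  by apply: (gen_ext _ (face_valueV_laurent 0 n 0)) => t; rewrite det2E.
have det_alg3 : alg (fun t => (\det (h3 t))^-1).
  apply: (gen_ext _ (face_valueV_laurent 0 0 n)) => t.
  by rewrite det3E /c3 mul0n mul1r.
exists sigma; split.
- move=> f; elim=> [{}f|c|f1 f2 _ IH1 _ IH2|f1 f2 _ IH1 _ IH2].
  + case=> [i j|i j|i j|||] /=.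
    * exact: h1_alg.
    * exact: gen_mulmx (gen_invmx det1_neq0 h1_alg det_alg1) h2_alg _ _.
    * exact: gen_mulmx (gen_invmx det2_neq0 h2_alg det_alg2) h3_alg _ _.
    * exact: det_alg1.
    * apply: (gen_ext (f := fun t => \det (h1 t) * (\det (h2 t))^-1)).
        by move=> t; rewrite det_mulmx det_inv invfM invrK.
      exact: gen_mul (gen_det h1_alg) det_alg2.
    * apply: (gen_ext (f := fun t => \det (h2 t) * (\det (h3 t))^-1)).
        by move=> t; rewrite det_mulmx det_inv invfM invrK.
      exact: gen_mul (gen_det h2_alg) det_alg3.
  + exact: gen_cst.
  + exact: gen_add.
  + exact: gen_mul.
- move=> t; split=> [|i x xi|i x xi].
  + by exists (a t) => l ln; split; [exact: a0|rewrite flags2_config -flh2].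
  + by rewrite flags1_config -flh1 ?v1_low//; case/andP: xi.
  + by rewrite flags3_config -flh3 ?v3_low//; case/andP: xi.
- move=> t i j k ijk /orP[/eqP k0|/eqP i0].
    rewrite k0 addn0 in ijk *.
    by rewrite multi_corner_face1// flags1_config flags2_config corner1.
  rewrite i0 in ijk *.
  rewrite multi_corner_face3// flags3_config flags2_config corner3 /c3 1?addnC//.
  by rewrite mulrA -expr2 sqrr_sign mul1r.
Qed.

End NormalSection.

Lemma spec_pt_ext (R : realType) (A : comAlgType R[i]) (p q : spec_pt A) :
  (forall f, p f = q f) -> p = q.
Proof.
case: p q => f [[f1] [f2] [f3]] [g [[g1] [g2] [g3]]] /= fg.
have e : f = g by apply: funext.
by subst g; congr GRing.LRMorphism.Pack; congr GRing.LRMorphism.Class;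
  congr (_ _); apply: Prop_irrelevance.
Qed.

(** * Points of the spectrum and the image of the chart *)

Section EvaluationPoints.
Variables (R : realType) (n : nat).
Local Notation C := R[i].
Local Notation A := (invariants R n).

Definition eval_at (g : GL3 R n) (f : A) : C^o := f g.

Lemma eval_at_nmod g : nmod_morphism (eval_at g).
Proof. by []. Qed.
HB.instance Definition _ g := GRing.isNmodMorphism.Build A C^o (eval_at g) (eval_at_nmod g).

Lemma eval_at_monoid g : GRing.monoid_morphism (eval_at g).
Proof. by []. Qed.
HB.instance Definition _ g := GRing.isMonoidMorphism.Build A C^o (eval_at g) (eval_at_monoid g).

Lemma eval_at_scalable g : GRing.scalable_for *:%R (eval_at g).
Proof. by []. Qed.
HB.instance Definition _ g :=
  GRing.isScalable.Build C A C^o *:%R (eval_at g) (eval_at_scalable g).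

Definition eval_pt (g : GL3 R n) : spec_pt A := eval_at g.

Lemma eval_ptE g f : eval_pt g f = f g.
Proof. by []. Qed.

Definition Mbar (i j k : nat) : A := insubd (0 : A) (@multi_corner R n i j k).

Lemma MbarE i j k g : (i + j + k <= n)%N -> Mbar i j k g = multi_corner i j k g.
Proof.
move=> ijk; congr (_ g); rewrite -[inv_fun _]/(val (Mbar i j k)) insubdK//.
apply/asboolP; split; [exact: multi_corner_regular|exact: multi_corner_invariant].
Qed.

Lemma Mbar000 : Mbar 0 0 0 = 1.
Proof. by apply: val_inj; apply: funext => g; rewrite [LHS]MbarE// multi_corner000. Qed.

Lemma Mbar_pluecker : pluecker n Mbar.
Proof.
move=> i j k ijk; apply: val_inj; apply: funext => g.
have := multi_corner_pluecker g ijk.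
by rewrite -!MbarE; try lia.
Qed.

End EvaluationPoints.

Section Chart.
Variables (R : realType) (n : nat).
Local Notation C := R[i].
Local Notation A := (invariants R n).
Local Notation idx := (Delta3_sub n chart_index).
Local Notation torus := (torus R idx).
Local Notation Mbar := (@Mbar R n).
Local Notation M s := (at_Delta3 Mbar s).

(** The image of the chart is the locus where this product does not vanish. *)
Definition chart_prod : A := \prod_(s : idx) M s.

Definition in_chart (p : spec_pt A) := forall s : idx, p (M s) != 0.

Lemma in_chartE (p : spec_pt A) : p chart_prod != 0 <-> in_chart p.
Proof.
rewrite rmorph_prod; split => [/prodf_neq0 h s|h]; first exact: h.
by apply/prodf_neq0 => s _; apply: h.
Qed.

Definition chart_coord (p : spec_pt A) (pM : in_chart p) : torus :=
  @Torus R idx [ffun s => p (M s)] (fun s => eq_ind_r (fun z => z != 0) (pM s) (ffunE _ s)).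

Lemma chart_coordE (p : spec_pt A) (pM : in_chart p) s : chart_coord pM s = p (M s).
Proof. by rewrite /= ffunE. Qed.

Lemma torus_ext (t t' : torus) : (forall s, t s = t' s) -> t = t'.
Proof.
case: t t' => [t t0] [t' t0'] /= tt'; have e : t = t' by apply/ffunP.
by subst t'; congr Torus; apply: Prop_irrelevance.
Qed.

Lemma face_value_chart (p : spec_pt A) (t : torus) i j k :
  (forall s, t s = p (M s)) -> (i + j + k <= n)%N -> on_k0_i0 i j k ->
  p (Mbar i j k) = face_value t i j k.
Proof.
move=> tp ijk face; rewrite /face_value; case e : (delta_point n chart_index i j k) => [s|].
  by rewrite tp /at_Delta3 (delta_point_Some e) /= !inordK//; lia.
by have [-> -> ->] := chart_point_None ijk face e; rewrite Mbar000 rmorph1.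
Qed.

Lemma in_chart_faces g : in_chart (eval_pt g) -> faces_neq0 g.
Proof.
move=> gM i j k ijk face; rewrite -MbarE// -[X in X != _]/(eval_pt g (Mbar i j k)).
by rewrite (face_value_chart (chart_coordE gM))// face_value_neq0.
Qed.

(** Clearing denominators: the inverse of one coordinate times [chart_prod] is the product of the
    others. The conclusion covers every morphism p with coordinates t, which is what [theta_coord]
    needs. *)
Lemma laurent_lift L : @laurent R idx L -> exists (q : A) (k : nat),
  forall (p : spec_pt A) (t : torus), (forall s, t s = p (M s)) ->
  p q = L t * p chart_prod ^+ k.
Proof.
elim=> [{}L [s|s]|c|L1 L2 _ [q1 [k1 h1]] _ [q2 [k2 h2]]|L1 L2 _ [q1 [k1 h1]] _ [q2 [k2 h2]]].
- by exists (M s), 0%N => p t tp; rewrite mulr1 tp.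
- exists (\prod_(s' | s' != s) M s'), 1%N => p t tp.
  rewrite expr1 (_ : chart_prod = M s * \prod_(s' | s' != s) M s'); last first.
    by rewrite /chart_prod (bigD1 s).
  rewrite rmorphM /= mulrA -tp mulVf ?mul1r//.
  exact: coord_neq0.
- by exists c%:A, 0%N => p t _; rewrite linearZ /= rmorph1 expr0.
- exists (q1 * chart_prod ^+ k2 + q2 * chart_prod ^+ k1), (k1 + k2)%N => p t tp.
  rewrite rmorphD !rmorphM !rmorphXn /= (h1 p t)// (h2 p t)// exprD.
  by rewrite mulrDl !mulrA [_ * _ ^+ k2 * _ ^+ k1]mulrAC.
- exists (q1 * q2), (k1 + k2)%N => p t tp.
  by rewrite rmorphM /= (h1 p t)// (h2 p t)// exprD mulrACA.
Qed.

Variable sigma : torus -> GL3 R n.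
Hypothesis sigma_laurent : forall f, regular_GL3 f -> laurent (fun t => f (sigma t)).
Hypothesis sigma_normal : forall t, normal_form (sigma t).
Hypothesis sigma_faces : forall t i j k, (i + j + k <= n)%N -> on_k0_i0 i j k ->
    multi_corner i j k (sigma t) = face_value t i j k.

Definition theta (t : torus) : spec_pt A := eval_pt (sigma t).

Lemma thetaM t s : theta t (M s) = t s.
Proof.
have [face ijk] : on_k0_i0 (val s).1.1 (val s).1.2 (val s).2 /\
    ((val s).1.1 + (val s).1.2 + (val s).2 <= n)%N.
  by have := valP s; rewrite /chart_index => /andP[? /andP[_ ?]].
rewrite /theta eval_ptE /at_Delta3 MbarE// sigma_faces// /face_value.
by rewrite delta_point_val.
Qed.

Lemma theta_in_chart t : in_chart (theta t).
Proof. by move=> s; rewrite thetaM coord_neq0. Qed.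

Lemma theta_chart_prod t : theta t chart_prod != 0.
Proof. exact/in_chartE/theta_in_chart. Qed.

(** Invariants do not distinguish g from its normal form, and the latter is determined by the face
    minors. *)
Lemma orbit_sigma g (t : torus) f : (forall s, t s = eval_pt g (M s)) ->
  U4_invariant f -> f g = f (sigma t).
Proof.
move=> tg If; have gM : in_chart (eval_pt g) by move=> s; rewrite -tg coord_neq0.
have [g' g'_nf g'_inv] := to_normal_form (in_chart_faces gM).
have g'_corner i j k : (i + j + k <= n)%N -> multi_corner i j k g' = multi_corner i j k g.
  by move=> ijk; rewrite (g'_inv _ (multi_corner_invariant ijk)).
rewrite (g'_inv f If) (_ : g' = sigma t) //.
apply: (normal_form_unique g'_nf (sigma_normal t)) => i j k ijk face.
  by rewrite (g'_corner _ _ _ ijk); apply: (in_chart_faces gM).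
rewrite (g'_corner _ _ _ ijk) (sigma_faces t ijk face) -(MbarE g ijk).
exact: (face_value_chart (p := eval_pt g)).
Qed.

(** Since p need not be an evaluation, f and its lift q are compared by an identity in the ring, to
    which p is then applied. *)
Lemma theta_coord (p : spec_pt A) (t : torus) :
  (forall s, t s = p (M s)) -> p = theta t.
Proof.
move=> tp; apply: spec_pt_ext => f.
have /asboolP[rf If] : inv_fun f \in @regular_invariant R n := valP f.
have [q [k hq]] := laurent_lift (sigma_laurent rf).
(* Off the chart both sides vanish because of the extra factor; on it [orbit_sigma] applies. *)
have e : chart_prod * q = chart_prod * (f * chart_prod ^+ k).
  apply: val_inj; apply: funext => g /=.
  rewrite -[LHS]/(eval_pt g (chart_prod * q)).
  rewrite -[RHS]/(eval_pt g (chart_prod * (f * chart_prod ^+ k))) !rmorphM rmorphXn /=.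
  have [->|/in_chartE gM] := eqVneq (eval_pt g chart_prod) 0; first by rewrite !mul0r.
  congr (_ * _); rewrite (hq _ (chart_coord gM)); last by move=> s; rewrite chart_coordE.
  congr (_ * _); rewrite eval_ptE; apply/esym/orbit_sigma => // s.
  by rewrite chart_coordE.
have P0 : p chart_prod != 0 by apply/in_chartE => s; rewrite -tp coord_neq0.
have := congr1 p e; rewrite !rmorphM rmorphXn /= => /(mulfI P0).
by rewrite (hq _ t)// => /(mulIf (expf_neq0 k P0)) <-.
Qed.

Lemma theta_embedding : open_embedding theta.
Proof.
split.
- move=> f; have /asboolP[rf _] : inv_fun f \in @regular_invariant R n := valP f.
  exact: sigma_laurent.
- by move=> t t' tt'; apply: torus_ext => s; rewrite -!thetaM tt'.
- exists [set chart_prod]%classic; apply/seteqP; split=> [p [t _ <-]|p [f -> p0]] /=.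
    by exists chart_prod => //; apply: theta_chart_prod.
  move/in_chartE: p0 => pM; exists (chart_coord pM) => //.
  by apply/esym/theta_coord => s; rewrite chart_coordE.
- move=> s t; exists (M s), 1; rewrite rmorph1 oner_eq0; split=> // t' _.
  by rewrite rmorph1 divr1 thetaM.
Qed.

End Chart.

(** * The potential on the chart *)

Section FacePotential.
Variables (F : fieldType) (n : nat).

Definition face_potential (m : nat -> nat -> nat -> F) : F :=
  \sum_(0 <= l < n.-1) \sum_(0 <= p < n.-1 - l)
    (rhombus_terms (fun _ y z => m y z 0%N) l p (n.-2 - l - p)
     + rhombus_terms (fun _ y z => m 0%N y z) l p (n.-2 - l - p)).

Lemma face_potential_ext m m' :
  (forall i j k, (i + j + k <= n)%N -> on_k0_i0 i j k -> m i j k = m' i j k) ->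
  face_potential m = face_potential m'.
Proof.
move=> mm'; rewrite /face_potential !big_nat; apply: eq_bigr => l ln.
rewrite !big_nat; apply: eq_bigr => p pn; have sz : (l + p + (n.-2 - l - p)).+2 = n by lia.
congr (_ + _); apply: (@rhombus_terms_ext _ _ _ n) => // x y z xyz; apply: mm' => //; try lia.
by rewrite /on_k0_i0 orbT.
Qed.

End FacePotential.

Section Potential.
Variables (R : realType) (n : nat).
Local Notation C := R[i].
Local Notation A := (invariants R n).
Local Notation idx := (Delta3_sub n chart_index).
Local Notation torus := (torus R idx).
Local Notation Mbar := (@Mbar R n).

Lemma face_potential_laurent :
  @laurent R idx (fun t => face_potential n (face_value t)).
Proof.
have ratio i1 j1 k1 i2 j2 k2 i3 j3 k3 i4 j4 k4 :
    @laurent R idx (fun t => face_value t i1 j1 k1 * face_value t i2 j2 k2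
      / (face_value t i3 j3 k3 * face_value t i4 j4 k4)).
  apply: gen_mul; first by apply: gen_mul; exact: face_value_laurent.
  apply: (gen_ext (f := fun t => (face_value t i3 j3 k3)^-1 * (face_value t i4 j4 k4)^-1)).
    by move=> t; rewrite invfM.
  by apply: gen_mul; exact: face_valueV_laurent.
apply: gen_sum => l _; apply: gen_sum => p _.
by apply: gen_add; (apply: gen_add; [apply: gen_add|]); apply: ratio.
Qed.

Lemma Phi3_face_potential (g : GL3 R n) (t : torus) :
  (forall s, t s = eval_pt g (at_Delta3 Mbar s)) ->
  Phi3 g = face_potential n (face_value t).
Proof.
move=> tg.
have e i j k : (i + j + k <= n)%N -> on_k0_i0 i j k -> multi_corner i j k g = face_value t i j k.
  by move=> ijk face; rewrite -MbarE//; apply: (face_value_chart (p := eval_pt g)).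
rewrite Phi3_multi_corner => [|i j ij|j k jk].
- exact: (face_potential_ext e).
- by rewrite e ?face_value_neq0// addn0.
- by rewrite e ?face_value_neq0// /on_k0_i0 orbT.
Qed.

Definition torus1 : torus :=
  @Torus R idx [ffun=> 1] (fun s => eq_ind_r (fun z => z != 0) (oner_neq0 _) (ffunE _ s)).

Variable sigma : torus -> GL3 R n.
Hypothesis sigma_laurent : forall f, regular_GL3 f -> laurent (fun t => f (sigma t)).
Hypothesis sigma_normal : forall t, normal_form (sigma t).
Hypothesis sigma_faces : forall t i j k, (i + j + k <= n)%N -> on_k0_i0 i j k ->
    multi_corner i j k (sigma t) = face_value t i j k.

Lemma induced_potential : exists Phibar : ratfun A,
  (forall g, rnum Phibar g = Phi3 g * rden Phibar g) /\
  forall t, theta sigma t (rden Phibar) != 0 /\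
    theta sigma t (rnum Phibar) / theta sigma t (rden Phibar)
    = face_potential n (face_value t).
Proof.
have [q [k hq]] := laurent_lift face_potential_laurent.
pose P := chart_prod R n.
have P0 t := @theta_chart_prod R n sigma sigma_faces t.
have den0 : P ^+ k.+1 != 0.
  apply: contraNneq (P0 torus1) => /(congr1 (theta sigma torus1)).
  by rewrite rmorphXn rmorph0 /= => /eqP; rewrite expf_eq0.
(* The extra factor P makes both members vanish off the chart. *)
exists (@RatFun _ _ (P * q) (P ^+ k.+1) den0); split=> [g|t]; cbn [rnum rden].
  rewrite -[LHS]/(eval_pt g (P * q)) -[RHS]/(Phi3 g * eval_pt g (P ^+ k.+1)) rmorphM rmorphXn /=.
  have [->|/in_chartE gM] := eqVneq (eval_pt g P) 0; first by rewrite mul0r expr0n mulr0.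
  rewrite (hq _ (chart_coord gM)); last by move=> s; rewrite chart_coordE.
  rewrite -(Phi3_face_potential (g := g)); last by move=> s; rewrite chart_coordE.
  by rewrite exprS mulrCA.
have eden : theta sigma t (P ^+ k.+1) = theta sigma t P ^+ k.+1 by rewrite rmorphXn.
have enum : theta sigma t (P * q) = theta sigma t P * theta sigma t q by rewrite rmorphM.
rewrite eden enum expf_neq0 ?P0//; split=> //.
rewrite (hq _ t); last by move=> s; rewrite thetaM.
by rewrite mulrCA -exprS mulfK// expf_neq0// P0.
Qed.

End Potential.

(** * Tropicalization *)

Section Tropicalization.
Variables (R : realType) (I : Type).
Local Notation C := R[i].
Local Notation expr := (expr C I).

(** Syntactic vanishing: by [trop_growth], a subtraction-free expression with [nonzero_dens] that
    fails this test takes positive values at all points [exp_point x s] with s >= 0. *)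
Fixpoint zero_expr (e : expr) : bool :=
  match e with
  | Const c => c == 0
  | Var _ => false
  | Add e1 e2 => zero_expr e1 && zero_expr e2
  | Mul e1 e2 => zero_expr e1 || zero_expr e2
  | Div e1 _ => zero_expr e1
  end.

Fixpoint nonzero_dens (e : expr) : bool :=
  match e with
  | Const _ | Var _ => true
  | Add e1 e2 | Mul e1 e2 => nonzero_dens e1 && nonzero_dens e2
  | Div e1 e2 => [&& nonzero_dens e1, nonzero_dens e2 & ~~ zero_expr e2]
  end.

Lemma zero_expr_eval t e : zero_expr e -> eval t e = 0.
Proof.
elim: e => //= [c /eqP //|e1 h1 e2 h2 /andP[/h1-> /h2->]|e1 h1 e2 h2|e1 h1 e2 h2 /h1->].
- by rewrite addr0.
- by case/orP => [/h1->|/h2->]; rewrite ?mul0r ?mulr0.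
- by rewrite mul0r.
Qed.

Lemma defined_nonzero_dens t e : defined_at t e -> nonzero_dens e.
Proof.
elim: e => //= [e1 h1 e2 h2 /andP[/h1-> /h2->//]|e1 h1 e2 h2 /andP[/h1-> /h2->//]|].
move=> e1 h1 e2 h2 /and3P[/h1-> /h2-> /=]; apply: contra => /zero_expr_eval->.
exact: eqxx.
Qed.

Definition exp_point (x : I -> R) (s : R) (i : I) : C := (expR (s * x i))%:C%C.

Definition exp_growth (x : I -> R) (e : expr) (r : R) := exists a b : R,
  [/\ 0 < a, 0 < b & forall s, 0 <= s -> exists v : R,
    [/\ eval (exp_point x s) e = v%:C%C, a * expR (s * r) <= v & v <= b * expR (s * r)]].

Lemma trop_growth x e : subtraction_free e -> nonzero_dens e ->
  if zero_expr e then trop x e = -oo%E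
  else exists2 r, trop x e = r%:E & exp_growth x e r.
Proof.
elim: e => /= [c c0 _|i _ _|e1 h1 e2 h2|e1 h1 e2 h2|e1 h1 e2 h2].
- case: eqP => [_ //|/eqP cn]; exists 0 => //.
  have : 0 < c by rewrite lt0r cn.
  case: c {c0 cn} => [u v]; rewrite ltcE /= => /andP[/eqP -> u0].
  by exists u, u; split => // s _; exists u; rewrite mulr0 expR0 !mulr1 !lexx.
- by exists (x i) => //; exists 1, 1; split => // s _; exists (expR (s * x i)); rewrite !mul1r !lexx.
- move=> /andP[/h1 {}h1 /h2 {}h2] /andP[/h1 {}h1 /h2 {}h2].
  case z1: (zero_expr e1) h1; case z2: (zero_expr e2) h2 => /=.
  + by move=> -> ->.
  + move=> [r -> [a [b [a0 b0 h]]]] ->; exists r; first by rewrite maxNye.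
    exists a, b; split=> // s s0; have [v [ev av vb]] := h s s0.
    by exists v; rewrite /= ev (zero_expr_eval _ z1) add0r.
  + move=> -> [r -> [a [b [a0 b0 h]]]]; exists r; first by rewrite maxeNy.
    exists a, b; split=> // s s0; have [v [ev av vb]] := h s s0.
    by exists v; rewrite /= ev (zero_expr_eval _ z2) addr0.
  move=> [r2 -> [a2 [b2 [a20 b20 g2]]]] [r1 -> [a1 [b1 [a10 b10 g1]]]].
  exists (Num.max r1 r2); first by rewrite EFin_max.
  (* From below the faster term alone suffices, whichever it is; from above both terms count. *)
  exists (Num.min a1 a2), (b1 + b2); split; [by rewrite lt_min a10|exact: addr_gt0|].
  move=> s s0; have [v1 [e1v l1 u1]] := g1 s s0; have [v2 [e2v l2 u2]] := g2 s s0.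
  exists (v1 + v2); split; first by rewrite /= e1v e2v rmorphD.
    have p1 : 0 <= v1 by apply: le_trans l1; rewrite mulr_ge0 ?expR_ge0// ltW.
    have p2 : 0 <= v2 by apply: le_trans l2; rewrite mulr_ge0 ?expR_ge0// ltW.
    case: (leP r1 r2) => r12.
      apply: le_trans (le_trans l2 _); last by rewrite lerDr.
      by rewrite ler_wpM2r ?expR_ge0// ge_min lexx orbT.
    apply: le_trans (le_trans l1 _); last by rewrite lerDl.
    by rewrite ler_wpM2r ?expR_ge0// ge_min lexx.
  have m1 : expR (s * r1) <= expR (s * Num.max r1 r2).
    by rewrite ler_expR ler_wpM2l// le_max lexx.
  have m2 : expR (s * r2) <= expR (s * Num.max r1 r2).
    by rewrite ler_expR ler_wpM2l// le_max lexx orbT.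
  rewrite mulrDl lerD//.
    by apply: (le_trans u1); rewrite ler_wpM2l// ltW.
  by apply: (le_trans u2); rewrite ler_wpM2l// ltW.
- move=> /andP[/h1 {}h1 /h2 {}h2] /andP[/h1 {}h1 /h2 {}h2].
  case z1: (zero_expr e1) h1; case z2: (zero_expr e2) h2 => /=.
  + by move=> -> ->.
  + by move=> [r -> _] ->.
  + by move=> -> [r -> _].
  move=> [r2 -> [a2 [b2 [a20 b20 g2]]]] [r1 -> [a1 [b1 [a10 b10 g1]]]].
  exists (r1 + r2) => //; exists (a1 * a2), (b1 * b2); split; [exact: mulr_gt0|exact: mulr_gt0|].
  move=> s s0; have [v1 [e1v l1 u1]] := g1 s s0; have [v2 [e2v l2 u2]] := g2 s s0.
  exists (v1 * v2); split; first by rewrite /= e1v e2v rmorphM.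
    rewrite mulrDr expRD mulrACA ler_pM// mulr_ge0 ?expR_ge0// ltW//.
  have p1 : 0 <= v1 by apply: le_trans l1; rewrite mulr_ge0 ?expR_ge0// ltW.
  have p2 : 0 <= v2 by apply: le_trans l2; rewrite mulr_ge0 ?expR_ge0// ltW.
  by rewrite mulrDr expRD mulrACA ler_pM.
- move=> /andP[/h1 {}h1 /h2 {}h2] /and3P[/h1 {}h1 /h2 {}h2 /negPf z2].
  rewrite z2 in h2; case z1: (zero_expr e1) h1 => /=.
    by move=> ->; move: h2 => [r -> _].
  move: h2 => [r2 -> [a2 [b2 [a20 b20 g2]]]] [r1 -> [a1 [b1 [a10 b10 g1]]]].
  exists (r1 - r2) => //; exists (a1 / b2), (b1 / a2); split; [exact: divr_gt0|exact: divr_gt0|].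
  move=> s s0; have [v1 [e1v l1 u1]] := g1 s s0; have [v2 [e2v l2 u2]] := g2 s s0.
  have q2 : 0 < v2 by apply: lt_le_trans l2; rewrite mulr_gt0 ?expR_gt0.
  have p1 : 0 <= v1 by apply: le_trans l1; rewrite mulr_ge0 ?expR_ge0// ltW.
  have eE c d : c / d * expR (s * (r1 - r2)) = (c * expR (s * r1)) / (d * expR (s * r2)).
    by rewrite mulrBr expRB invfM mulrACA.
  exists (v1 / v2); split; first by rewrite /= e1v e2v fmorph_div.
    rewrite eE; apply: ler_pM => //.
    - by rewrite mulr_ge0 ?expR_ge0// ltW.
    - by rewrite invr_ge0 mulr_ge0 ?expR_ge0// ltW.
    - by rewrite lef_pV2 ?posrE ?mulr_gt0 ?expR_gt0.
  rewrite eE; apply: ler_pM => //; first by rewrite invr_ge0 ltW.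
  by rewrite lef_pV2 ?posrE ?mulr_gt0 ?expR_gt0.
Qed.

Lemma exp_growth_le x e e' r r' :
  (forall s, 0 <= s -> eval (exp_point x s) e = eval (exp_point x s) e') ->
  exp_growth x e r -> exp_growth x e' r' -> r <= r'.
Proof.
move=> ee' [a [a' [a0 _ h]]] [b' [b [_ b0 h']]]; rewrite leNgt; apply/negP => r'r.
have d0 : 0 < r - r' by rewrite subr_gt0.
(* At this s, exp(s (r - r')) = exp(b/a) >= 1 + b/a > b/a, against the two growth bounds. *)
pose s := b / a / (r - r').
have s0 : 0 <= s by rewrite !divr_ge0 ?ltW.
have [v [ev av _]] := h s s0; have [w [ew _ wb]] := h' s s0.
have vw : v = w by have := ee' s s0; rewrite ev ew => /complexI.
have : a * expR (s * r) <= b * expR (s * r') by rewrite (le_trans av)// vw.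
rewrite -ler_pdivlMl// mulrA [a^-1 * b]mulrC -ler_pdivrMr ?expR_gt0// -expRB -mulrBr.
rewrite divfK ?gt_eqF// leNgt => /negP; apply.
by rewrite (lt_le_trans _ (expR_ge1Dx _))// ltrDr.
Qed.

Lemma trop_unique x e e' :
  subtraction_free e -> subtraction_free e' -> nonzero_dens e -> nonzero_dens e' ->
  (forall s, 0 <= s -> eval (exp_point x s) e = eval (exp_point x s) e') ->
  trop x e = trop x e'.
Proof.
move=> f f' d d' ee'; have := trop_growth x f d; have := trop_growth x f' d'.
have pos e1 e2 r : (forall s, 0 <= s -> eval (exp_point x s) e1 = eval (exp_point x s) e2) ->
    exp_growth x e1 r -> ~ zero_expr e2.
  move=> e12 [a [b [a0 _ h]]] /zero_expr_eval e0.
  have [v []] := h 0 (lexx _); rewrite e12// e0 => /(@complexI R 0) <- v0 _.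
  by move: v0; rewrite leNgt mulr_gt0 ?expR_gt0.
case z: (zero_expr e); case z': (zero_expr e').
- by move=> -> ->.
- by move=> [r _ /pos h]; exfalso; apply: (h e); [move=> s s0; rewrite ee'|rewrite z].
- by move=> _ [r _ /pos h]; exfalso; apply: (h e'); [|rewrite z'].
move=> [r' -> g'] [r -> g]; congr (_%:E); apply/eqP; rewrite eq_le.
rewrite (exp_growth_le ee' g g') (exp_growth_le _ g' g)// => s s0.
by rewrite ee'.
Qed.

End Tropicalization.

Section TropicalValues.
Variables (R : realType) (I : Type).

Lemma nonzero_dens_defined (x : I -> R) s e : 0 <= s ->
  subtraction_free e -> nonzero_dens e -> defined_at (exp_point x s) e.
Proof.
move=> s0; elim: e => //= [e1 h1 e2 h2|e1 h1 e2 h2|e1 h1 e2 h2].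
- by move=> /andP[/h1 {}h1 /h2 {}h2] /andP[/h1 -> /h2 ->].
- by move=> /andP[/h1 {}h1 /h2 {}h2] /andP[/h1 -> /h2 ->].
move=> /andP[/h1 {}h1 sf2] /and3P[/h1 -> nz2 z2]; rewrite (h2 sf2 nz2) /=.
have := trop_growth x sf2 nz2; rewrite (negPf z2) => -[r _ [a [b [a0 _ g]]]].
have [v [-> av _]] := g s s0; apply/eqP => /(@complexI R _ 0) v0.
by move: av; rewrite v0 leNgt mulr_gt0 ?expR_gt0.
Qed.

Lemma trop_real (x : I -> R) e t : subtraction_free e -> nonzero_dens e ->
  eval t e != 0 -> exists r, trop x e = r%:E.
Proof.
move=> sf nz e0; have := trop_growth x sf nz.
case: ifP => [/zero_expr_eval h|_ [r -> _]]; first by rewrite h eqxx in e0.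
by exists r.
Qed.

End TropicalValues.

(** * Solving the Plücker relations *)

(** Induction on i + k: in the relation, all entries other than m_(i+1, j, k+1) have a smaller sum
    of first and third index. *)
Lemma pluecker_face_gt0 (K : numFieldType) n (m : nat -> nat -> nat -> K) :
  pluecker n m ->
  (forall i j k, (i + j + k <= n)%N -> on_k0_i0 i j k -> 0 < m i j k) ->
  forall i j k, (i + j + k <= n)%N -> 0 < m i j k.
Proof.
move=> pl face i j k; have [N] := ubnP (i + k)%N.
elim: N i j k => // N IH [|i] j [|k] lt ijk; try by apply: face.
have m0 : 0 < m i j.+1 k by apply: IH; lia.
rewrite -(pmulr_lgt0 _ m0) pl; last by lia.
by rewrite addr_gt0// mulr_gt0// IH//; lia.
Qed.

Section Solving.
Variables (R : realType) (n : nat) (I : Type).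
Local Notation C := R[i].
Variables (P : nat -> nat -> nat -> bool) (E0 : nat -> nat -> nat -> expr C I).
Hypothesis E0_sf : forall i j k, subtraction_free (E0 i j k).

(** Correctness wherever e is defined, even if some entries vanish, is separate from definedness
    when no entry does: the former is used at every point of the spectrum, the latter to exhibit a
    point of definition. The base expressions [E0] are left free because the chart lacks the index
    (0, 0, 0). *)
Definition solves_at (i j k : nat) (e : expr C I) : Prop :=
  forall (t : I -> C) (m : nat -> nat -> nat -> C), pluecker n m ->
    (forall a b c, (a + b + c <= n)%N -> P a b c ->
       defined_at t (E0 a b c) /\ m a b c = eval t (E0 a b c)) ->
    (defined_at t e -> m i j k = eval t e) /\
    ((forall a b c, (a + b + c <= n)%N -> m a b c != 0) -> defined_at t e).

Lemma solves_base i j k : (i + j + k <= n)%N -> P i j k -> solves_at i j k (E0 i j k).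
Proof. by move=> ijk Pijk t m _ /(_ i j k ijk Pijk)[dE mE]. Qed.

Lemma solves_step i j k e1 e2 e3 e4 e5 i1 j1 k1 i2 j2 k2 i3 j3 k3 i4 j4 k4 i5 j5 k5 :
  (i5 + j5 + k5 <= n)%N ->
  (forall m : nat -> nat -> nat -> C, pluecker n m ->
     m i j k * m i5 j5 k5 = m i1 j1 k1 * m i2 j2 k2 + m i3 j3 k3 * m i4 j4 k4) ->
  solves_at i1 j1 k1 e1 -> solves_at i2 j2 k2 e2 -> solves_at i3 j3 k3 e3 ->
  solves_at i4 j4 k4 e4 -> solves_at i5 j5 k5 e5 ->
  solves_at i j k (Div (Add (Mul e1 e2) (Mul e3 e4)) e5).
Proof.
move=> n5 rel s1 s2 s3 s4 s5 t m pl mP.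
have [v1 d1] := s1 t m pl mP; have [v2 d2] := s2 t m pl mP.
have [v3 d3] := s3 t m pl mP; have [v4 d4] := s4 t m pl mP.
have [v5 d5] := s5 t m pl mP; split=> /=.
  move=> /and3P[/andP[/andP[/v1 <- /v2 <-] /andP[/v3 <- /v4 <-]] /v5 <- m5].
  by rewrite -rel// mulfK.
by move=> m0; rewrite d1// d2// d3// d4// d5//= -v5 ?d5// m0.
Qed.

End Solving.

Lemma solve_k0_i0 (R : realType) n I (E0 : nat -> nat -> nat -> expr R[i] I) :
  (forall i j k, subtraction_free (E0 i j k)) ->
  forall i j k, (i + j + k <= n)%N ->
  exists2 e, subtraction_free e & solves_at n on_k0_i0 E0 i j k e.
Proof.
move=> E0_sf i j k; have [N] := ubnP (i + k)%N.
elim: N i j k => // N IH i j k lt ijk.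
have [face|] := boolP (on_k0_i0 i j k); first by exists (E0 i j k) => //; apply: solves_base.
case: i k lt ijk => [|i] [|k] // lt ijk _.
have [e1 f1 s1] := IH i j.+1 k.+1 ltac:(lia) ltac:(lia).
have [e2 f2 s2] := IH i.+1 j k ltac:(lia) ltac:(lia).
have [e3 f3 s3] := IH i j k.+1 ltac:(lia) ltac:(lia).
have [e4 f4 s4] := IH i.+1 j.+1 k ltac:(lia) ltac:(lia).
have [e5 f5 s5] := IH i j.+1 k ltac:(lia) ltac:(lia).
exists (Div (Add (Mul e1 e2) (Mul e3 e4)) e5); first by rewrite /= f1 f2 f3 f4 f5.
apply: (solves_step _ _ s1 s2 s3 s4 s5); first by lia.
by move=> m pl; apply: pl; lia.
Qed.

(** Now the relation is solved for m_(i, j+1, k). The quantity (n - (i+j+k)) + j is smaller for the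
    other five entries. *)
Lemma solve_top_j0 (R : realType) n I (E0 : nat -> nat -> nat -> expr R[i] I) :
  (forall i j k, subtraction_free (E0 i j k)) ->
  forall i j k, (i + j + k <= n)%N ->
  exists2 e, subtraction_free e & solves_at n (on_top_j0 n) E0 i j k e.
Proof.
move=> E0_sf i j k; have [N] := ubnP (n - (i + j + k) + j)%N.
elim: N i j k => // N IH i [|j] k lt ijk.
  by exists (E0 i 0 k)%N => //; apply: solves_base; rewrite // /on_top_j0 eqxx orbT.
have [top|ntop] := eqVneq (i + j.+1 + k)%N n.
  by exists (E0 i j.+1 k)%N => //; apply: solves_base; rewrite // /on_top_j0 top eqxx.
have [e1 f1 s1] := IH i j.+1 k.+1 ltac:(lia) ltac:(lia).
have [e2 f2 s2] := IH i.+1 j k ltac:(lia) ltac:(lia).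
have [e3 f3 s3] := IH i j k.+1 ltac:(lia) ltac:(lia).
have [e4 f4 s4] := IH i.+1 j.+1 k ltac:(lia) ltac:(lia).
have [e5 f5 s5] := IH i.+1 j k.+1 ltac:(lia) ltac:(lia).
exists (Div (Add (Mul e1 e2) (Mul e3 e4)) e5); first by rewrite /= f1 f2 f3 f4 f5.
apply: (solves_step _ _ s1 s2 s3 s4 s5); first by lia.
by move=> m pl; rewrite mulrC; apply: pl; lia.
Qed.

(** * Octahedron recurrence and rhombi *)

Section Octahedron.
Variables (R : realDomainType) (n : nat).
Implicit Types m : nat -> nat -> nat -> nat -> R.

(** With the redundant coordinate x_0 as first argument, the symmetries between the four vertices
    become visible. *)
Definition octahedron4 m := forall a b c d, (a + b + c + d).+2 = n ->
  m a b.+1 c d.+1 + m a.+1 b c.+1 d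
  = Num.max (m a b c.+1 d.+1 + m a.+1 b.+1 c d) (m a.+1 b c d.+1 + m a b.+1 c.+1 d).

Lemma octahedron4_bounds m a b c d : octahedron4 m -> (a + b + c + d).+2 = n ->
  [/\ m a b c.+1 d.+1 + m a.+1 b.+1 c d <= m a b.+1 c d.+1 + m a.+1 b c.+1 d,
      m a.+1 b c d.+1 + m a b.+1 c.+1 d <= m a b.+1 c d.+1 + m a.+1 b c.+1 d &
      m a b.+1 c d.+1 + m a.+1 b c.+1 d <= m a b c.+1 d.+1 + m a.+1 b.+1 c d \/
      m a b.+1 c d.+1 + m a.+1 b c.+1 d <= m a.+1 b c d.+1 + m a b.+1 c.+1 d].
Proof.
move=> oct sz; rewrite oct//; split; rewrite ?le_max ?lexx ?orbT//.
by rewrite !ge_max !lexx !andbT /=; case: (leP (m a b c.+1 d.+1 + _)) => h; [right|left; rewrite ltW].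
Qed.

(* Propagation from the faces through the tropical relation r(13) = max(r(12), r(23))
   between the three rhombi of vertex 0 sharing a small triangle. *)
Lemma rhombi_at0 m : octahedron4 m ->
  (forall w x y, (w + x + y).+2 = n ->
     m w.+2 x y 0%N + m w x.+1 y.+1 0%N <= m w.+1 x.+1 y 0%N + m w.+1 x y.+1 0%N) ->
  (forall w y z, (w + y + z).+2 = n ->
     m w.+2 0%N y z + m w 0%N y.+1 z.+1 <= m w.+1 0%N y.+1 z + m w.+1 0%N y z.+1) ->
  forall w x y z, (w + x + y + z).+2 = n ->
  [/\ m w.+2 x y z + m w x.+1 y.+1 z <= m w.+1 x.+1 y z + m w.+1 x y.+1 z,
      m w.+2 x y z + m w x y.+1 z.+1 <= m w.+1 x y.+1 z + m w.+1 x y z.+1 &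
      m w.+2 x y z + m w x.+1 y z.+1 <= m w.+1 x.+1 y z + m w.+1 x y z.+1].
Proof.
move=> oct face12 face23.
have up w x y z : (w + x + y + z).+2 = n ->
    m w.+2 x y z + m w x.+1 y.+1 z <= m w.+1 x.+1 y z + m w.+1 x y.+1 z ->
    m w.+2 x y z + m w x y.+1 z.+1 <= m w.+1 x y.+1 z + m w.+1 x y z.+1 ->
    m w.+2 x y z + m w x.+1 y z.+1 <= m w.+1 x.+1 y z + m w.+1 x y z.+1.
  by move=> sz h1 h2; have [_ _] := octahedron4_bounds oct sz; case; lra.
move=> w x y z; have [N] := ubnP (x + z)%N.
elim: N w x y z => // N IH w x y z lt sz.
suff [h1 h2] : m w.+2 x y z + m w x.+1 y.+1 z <= m w.+1 x.+1 y z + m w.+1 x y.+1 z /\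
      m w.+2 x y z + m w x y.+1 z.+1 <= m w.+1 x y.+1 z + m w.+1 x y z.+1.
  by split=> //; apply: up.
split.
  case: z lt sz => [|z] lt sz; first by apply: face12; lia.
  (* The 12-rhombus at height z+1 follows from the 13-rhombus at (w, x, y+1, z) and one octahedron
     bound; below, the 23-rhombus is obtained in the same way by lowering x. *)
  have [_ _ h] := IH w x y.+1 z ltac:(lia) ltac:(lia).
  have sz' : (w.+1 + x + y + z).+2 = n by lia.
  by have [_] := octahedron4_bounds oct sz'; lra.
case: x lt sz => [|x] lt sz; first by apply: face23; lia.
have [_ _ h] := IH w x y.+1 z ltac:(lia) ltac:(lia).
have sz' : (w.+1 + x + y + z).+2 = n by lia.
by have [] := octahedron4_bounds oct sz'; lra.
Qed.

(** At vertex 1 the relation reads r(02) = max(r(03), r(23)), so r(02) controls the two others and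
    the induction starts from the face z = 0 alone. *)
Lemma rhombi_at1 m : octahedron4 m ->
  (forall w x y, (w + x + y).+2 = n ->
     m w x.+2 y 0%N + m w.+1 x y.+1 0%N <= m w.+1 x.+1 y 0%N + m w x.+1 y.+1 0%N) ->
  forall w x y z, (w + x + y + z).+2 = n ->
  [/\ m w x.+2 y z + m w.+1 x y.+1 z <= m w.+1 x.+1 y z + m w x.+1 y.+1 z,
      m w x.+2 y z + m w.+1 x y z.+1 <= m w.+1 x.+1 y z + m w x.+1 y z.+1 &
      m w x.+2 y z + m w x y.+1 z.+1 <= m w x.+1 y.+1 z + m w x.+1 y z.+1].
Proof.
move=> oct face.
have up w x y z : (w + x + y + z).+2 = n ->
    m w x.+2 y z + m w.+1 x y.+1 z <= m w.+1 x.+1 y z + m w x.+1 y.+1 z ->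
    m w x.+2 y z + m w.+1 x y z.+1 <= m w.+1 x.+1 y z + m w x.+1 y z.+1 /\
    m w x.+2 y z + m w x y.+1 z.+1 <= m w x.+1 y.+1 z + m w x.+1 y z.+1.
  by move=> sz h; have [h1 h2 _] := octahedron4_bounds oct sz; split; lra.
move=> w x y z sz.
suff h : m w x.+2 y z + m w.+1 x y.+1 z <= m w.+1 x.+1 y z + m w x.+1 y.+1 z.
  by have [] := up _ _ _ _ sz h.
elim: z w x y sz => [|z IH] w x y sz; first by apply: face; lia.
have sz1 : (w + x + y.+1 + z).+2 = n by lia.
have sz2 : (w.+1 + x + y + z).+2 = n by lia.
have sz' : (w + x.+1 + y + z).+2 = n by lia.
have [h1 _] := up _ _ _ _ sz1 (IH _ _ _ sz1).
have [_ h2] := up _ _ _ _ sz2 (IH _ _ _ sz2).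
(* Whichever term attains the maximum, it combines with one of the two inequalities above. *)
by have [_ _] := octahedron4_bounds oct sz'; case; lra.
Qed.

(** Exchanging 1 and 3, or 0 and 2, preserves the pairing 02 | 13 on the left and exchanges the two
    terms of the maximum. This reduces vertices 3 and 2 to vertices 1 and 0. *)
Lemma octahedron4_swap13 m : octahedron4 m -> octahedron4 (fun a b c d => m a d c b).
Proof.
move=> oct a b c d sz; rewrite (oct a d c b); last by lia.
by rewrite maxC; congr (Num.max _ _); rewrite addrC.
Qed.

Lemma octahedron4_swap02 m : octahedron4 m -> octahedron4 (fun a b c d => m c b a d).
Proof.
move=> oct a b c d sz; rewrite (oct c b a d); last by lia.
exact: maxC.
Qed.

End Octahedron.

Section RhombusInequalities.
Variables (R : realType) (n : nat) (r : nat -> nat -> nat -> R).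

Definition triangle_inequalities (B : nat -> nat -> nat -> R) : Prop :=
  forall l p q, (l + p + q).+2 = n ->
  [/\ B l.+2 p q + B l p.+1 q.+1 <= B l.+1 p.+1 q + B l.+1 p q.+1,
      B p l.+2 q + B p.+1 l q.+1 <= B p.+1 l.+1 q + B p l.+1 q.+1 &
      B p q l.+2 + B p.+1 q.+1 l <= B p.+1 q l.+1 + B p q.+1 l.+1].

Definition face_inequalities : Prop :=
  triangle_inequalities (fun _ y z => r y z 0%N) /\
  triangle_inequalities (fun _ y z => r 0%N y z).

Variable F : nat -> nat -> nat -> \bar R.
Hypothesis FE : forall i j k, (i + j + k <= n)%N -> F i j k = (r i j k)%:E.

Let shift (y : nat -> nat) (a b i : nat) : nat := (y i + (i == a) + (i == b))%N.

Lemma sum_ord4 (y : 'I_4 -> nat) :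
  (\sum_m y m = y (inord 0) + y (inord 1) + y (inord 2) + y (inord 3))%N.
Proof.
rewrite !big_ord_recr big_ord0 /= add0n.
by congr (_ + _ + _ + _)%N; congr (y _); apply: val_inj; rewrite /= inordK.
Qed.

Lemma at_simplex_shift2 (y : 'I_4 -> nat) (a b : 'I_4) : ((\sum_m y m) + 2 = n)%N ->
  let s := shift (fun i => y (inord i)) a b in
  at_simplex F (shift2 y a b) = (r (s 1%N) (s 2%N) (s 3%N))%:E.
Proof.
rewrite sum_ord4 => sz s.
have e i : (i < 4)%N -> shift2 y a b (inord i) = s i.
  by move=> i4; rewrite /shift2 /s /shift -!val_eqE /= inordK.
rewrite /at_simplex !e// FE// /s /shift.
have := ltn_ord a; have := ltn_ord b.
move: (nat_of_ord a) (nat_of_ord b) => {s e} u v.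
move: sz; move: (y _) (y _) (y _) (y _) => y0 y1 y2 y3 sz.
by move: u v => [|[|[|[|u]]]] [|[|[|[|v]]]] //=; lia.
Qed.

Lemma rhombus_inequalities_nat : rhombus_inequalities n F <->
  forall (y : nat -> nat) (a b c : nat), (a < 4)%N -> (b < 4)%N -> (c < 4)%N ->
  uniq [:: a; b; c] -> (y 0 + y 1 + y 2 + y 3).+2%N = n ->
  let m u v := r (shift y u v 1) (shift y u v 2) (shift y u v 3) in
  m a a + m b c <= m a b + m a c.
Proof.
split=> [H y a b c a4 b4 c4 abc sz|H y a b c sz abc].
  have sz' : ((\sum_(m < 4) y m) + 2 = n)%N by rewrite sum_ord4 !inordK//; lia.
  have := H (fun m => y m) (Ordinal a4) (Ordinal b4) (Ordinal c4) sz'.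
  rewrite !at_simplex_shift2// -!EFinD lee_fin /shift !inordK//=; apply.
  by move: abc; rewrite /= !inE -!val_eqE.
rewrite !at_simplex_shift2// -!EFinD lee_fin.
apply: (H (fun i => y (inord i))) => //; last by rewrite -sum_ord4; lia.
Qed.

Hypothesis oct : forall i j k, (i + j + k + 2 <= n)%N ->
  r i.+1 j k.+1 + r i j.+1 k
  = Num.max (r i j.+1 k.+1 + r i.+1 j k) (r i j k.+1 + r i.+1 j.+1 k).

(** From right to left, the rhombi at each of the four vertices are reached separately: vertices 0
    and 2 from both faces, vertex 1 from k = 0 and vertex 3 from i = 0. *)
Lemma rhombus_face_inequalities : rhombus_inequalities n F <-> face_inequalities.
Proof.
rewrite rhombus_inequalities_nat; split=> [H|[T3 T1]].
  have H' y0 y1 y2 y3 := H (nth 0%N [:: y0; y1; y2; y3]).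
  split=> l p q sz; split.
  - by have := H' l p q 0%N 0%N 1%N 2%N isT isT isT isT; rewrite /shift /= !(addn0, addn1); apply; lia.
  - by have := H' p l q 0%N 1%N 0%N 2%N isT isT isT isT; rewrite /shift /= !(addn0, addn1); apply; lia.
  - by have := H' p q l 0%N 2%N 0%N 1%N isT isT isT isT; rewrite /shift /= !(addn0, addn1); apply; lia.
  - by have := H' l 0%N p q 0%N 2%N 3%N isT isT isT isT; rewrite /shift /= !(addn0, addn1); apply; lia.
  - by have := H' p 0%N l q 2%N 0%N 3%N isT isT isT isT; rewrite /shift /= !(addn0, addn1); apply; lia.
  - by have := H' p 0%N q l 3%N 0%N 2%N isT isT isT isT; rewrite /shift /= !(addn0, addn1); apply; lia.
pose m (_ x y z : nat) := r x y z.
have om : octahedron4 n m by move=> w x y z sz; apply: oct; lia.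
have om13 := octahedron4_swap13 om; have om02 := octahedron4_swap02 om.
have at0 := rhombi_at0 om.
have {}at0 := at0 ltac:(by move=> w x y sz; have [] := T3 w x y ltac:(lia))
  ltac:(by move=> w x y sz; have [] := T1 w x y ltac:(lia)).
have at1 := rhombi_at1 om.
have {}at1 := at1 ltac:(by move=> w x y sz; have [] := T3 x w y ltac:(lia)).
have at2 := rhombi_at0 om02.
have {}at2 := at2 ltac:(by move=> w x y sz; rewrite /m [leRHS]addrC; have [] := T3 w y x ltac:(lia))
  ltac:(by move=> w y z sz; have [] := T1 w y z ltac:(lia)).
have at3 := rhombi_at1 om13.
have {}at3 := at3 ltac:(by move=> w x y sz; have [] := T1 x w y ltac:(lia)).
move=> y a b c a4 b4 c4 abc sz.
have [a1 a2 a3] := at0 (y 0) (y 1) (y 2) (y 3) sz.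
have [b1 b2 b3] := at1 (y 0) (y 1) (y 2) (y 3) sz.
have sz2 : (y 2 + y 1 + y 0 + y 3).+2%N = n.
  by move: sz; move: (y 0) (y 1) (y 2) (y 3) => *; lia.
have sz3 : (y 0 + y 3 + y 2 + y 1).+2%N = n.
  by move: sz; move: (y 0) (y 1) (y 2) (y 3) => *; lia.
have [c1 c2 c3] := at2 _ _ _ _ sz2; have [d1 d2 d3] := at3 _ _ _ _ sz3.
rewrite /m in a1 a2 a3 b1 b2 b3 c1 c2 c3 d1 d2 d3.
clear -a1 a2 a3 b1 b2 b3 c1 c2 c3 d1 d2 d3 a4 b4 c4 abc.
move: a b c a4 b4 c4 abc => [|[|[|[|a]]]] [|[|[|[|b]]]] [|[|[|[|c]]]] //= _ _ _ _;
  rewrite /shift /= !(addn0, addn1); lra.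
Qed.

End RhombusInequalities.

(** * The potential as an expression *)

Section PotentialExpression.
Variables (R : realType) (I : Type) (n : nat).
Local Notation C := R[i].
Local Notation expr := (expr C I).

Definition ratio_expr (a b c d : expr) : expr := Div (Mul a b) (Mul c d).

Definition rhombus_expr (B : nat -> nat -> nat -> expr) (l p q : nat) : expr :=
  Add (Add (ratio_expr (B l.+2 p q) (B l p.+1 q.+1) (B l.+1 p.+1 q) (B l.+1 p q.+1))
           (ratio_expr (B p l.+2 q) (B p.+1 l q.+1) (B p.+1 l.+1 q) (B p l.+1 q.+1)))
      (ratio_expr (B p q l.+2) (B p.+1 q.+1 l) (B p.+1 q l.+1) (B p q.+1 l.+1)).

(** The final constant 0 has tropical value -oo, neutral for the maximum. For n = 1 it is the whole
    potential. *)
Definition sum_expr (N : nat) (f : nat -> expr) : expr :=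
  \big[@Add C I / Const I 0]_(0 <= l < N) f l.

Definition potential_expr (E : nat -> nat -> nat -> expr) : expr :=
  sum_expr n.-1 (fun l => sum_expr (n.-1 - l) (fun p =>
    Add (rhombus_expr (fun _ y z => E y z 0%N) l p (n.-2 - l - p))
        (rhombus_expr (fun _ y z => E 0%N y z) l p (n.-2 - l - p)))).

Lemma eval_sum_expr t N f : eval t (sum_expr N f) = \sum_(0 <= l < N) eval t (f l).
Proof. by rewrite /sum_expr (big_morph (eval t) (id1 := 0) (op1 := +%R)). Qed.

Lemma eval_potential_expr t E :
  eval t (potential_expr E) = face_potential n (fun i j k => eval t (E i j k)).
Proof.
rewrite eval_sum_expr; apply: eq_bigr => l _.
by rewrite eval_sum_expr.
Qed.

Lemma subtraction_free_sum_expr N f :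
  (forall l, subtraction_free (f l)) -> subtraction_free (sum_expr N f).
Proof. by move=> h; elim/big_ind: (sum_expr N f) => //= a b -> ->. Qed.

Lemma nonzero_dens_sum_expr N f :
  (forall l, nonzero_dens (f l)) -> nonzero_dens (sum_expr N f).
Proof. by move=> h; elim/big_ind: (sum_expr N f) => //= a b -> ->. Qed.

Lemma subtraction_free_potential_expr E :
  (forall i j k, subtraction_free (E i j k)) -> subtraction_free (potential_expr E).
Proof.
move=> h; apply: subtraction_free_sum_expr => l; apply: subtraction_free_sum_expr => p.
by rewrite /= !h.
Qed.

Lemma nonzero_dens_potential_expr E :
  (forall i j k, nonzero_dens (E i j k)) -> (forall i j k, ~~ zero_expr (E i j k)) ->
  nonzero_dens (potential_expr E).
Proof.
move=> h h0; apply: nonzero_dens_sum_expr => l; apply: nonzero_dens_sum_expr => p.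
by rewrite /= !h !negb_or !h0.
Qed.

Lemma trop_sum_expr_le0 x N f :
  (trop x (sum_expr N f) <= 0)%E <-> forall l, (l < N)%N -> (trop x (f l) <= 0)%E.
Proof.
have -> : trop x (sum_expr N f) = \big[maxe/-oo%E]_(0 <= l < N) trop x (f l).
  by rewrite /sum_expr (big_morph (trop x) (id1 := -oo%E) (op1 := maxe))//= eqxx.
have bigmax_le0 (s : seq nat) (g : nat -> \bar R) :
    (\big[maxe/-oo%E]_(l <- s) g l <= 0)%E <-> forall l, l \in s -> (g l <= 0)%E.
  elim: s => [|k s IH]; first by rewrite big_nil leNye.
  rewrite big_cons ge_max; split=> [/andP[gk /IH gs] l|h].
    by rewrite inE => /orP[/eqP->|/gs].
  rewrite h ?mem_head//=; apply/IH => l ls; apply: h.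
  by rewrite inE ls orbT.
rewrite bigmax_le0; split=> h l; have := h l; rewrite mem_index_iota /=.
  by [].
by [].
Qed.

Variables (x : I -> R) (E : nat -> nat -> nat -> expr) (r : nat -> nat -> nat -> R).
Hypothesis trop_E : forall i j k, (i + j + k <= n)%N -> trop x (E i j k) = (r i j k)%:E.

Lemma trop_ratio_expr_le0 i1 j1 k1 i2 j2 k2 i3 j3 k3 i4 j4 k4 :
  (i1 + j1 + k1 <= n)%N -> (i2 + j2 + k2 <= n)%N ->
  (i3 + j3 + k3 <= n)%N -> (i4 + j4 + k4 <= n)%N ->
  (trop x (ratio_expr (E i1 j1 k1) (E i2 j2 k2) (E i3 j3 k3) (E i4 j4 k4)) <= 0)%E
  = (r i1 j1 k1 + r i2 j2 k2 <= r i3 j3 k3 + r i4 j4 k4).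
Proof. by move=> n1 n2 n3 n4; rewrite /= !trop_E// -!EFinD -?EFinB lee_fin subr_le0. Qed.

Lemma trop_potential_expr_le0 :
  (trop x (potential_expr E) <= 0)%E <-> face_inequalities n r.
Proof.
pose terms l p q := (trop x (rhombus_expr (fun _ y z => E y z 0%N) l p q) <= 0)%E /\
      (trop x (rhombus_expr (fun _ y z => E 0%N y z) l p q) <= 0)%E.
have termsE l p q : (l + p + q).+2 = n -> terms l p q <->
    ([/\ r p q 0%N + r p.+1 q.+1 0%N <= r p.+1 q 0%N + r p q.+1 0%N,
      r l.+2 q 0%N + r l q.+1 0%N <= r l.+1 q 0%N + r l.+1 q.+1 0%N &
      r q l.+2 0%N + r q.+1 l 0%N <= r q l.+1 0%N + r q.+1 l.+1 0%N] /\
     [/\ r 0%N p q + r 0%N p.+1 q.+1 <= r 0%N p.+1 q + r 0%N p q.+1,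
      r 0%N l.+2 q + r 0%N l q.+1 <= r 0%N l.+1 q + r 0%N l.+1 q.+1 &
      r 0%N q l.+2 + r 0%N q.+1 l <= r 0%N q l.+1 + r 0%N q.+1 l.+1]).
  move=> sz; rewrite /terms /rhombus_expr.
  have maxE (a b c : expr) : (trop x (Add (Add a b) c) <= 0)%E
      = [&& (trop x a <= 0)%E, (trop x b <= 0)%E & (trop x c <= 0)%E].
    by rewrite /= !ge_max andbA.
  rewrite !maxE !trop_ratio_expr_le0; try lia.
  by split=> [[/and3P ? /and3P ?]|[/and3P ? /and3P ?]].
have -> : (trop x (potential_expr E) <= 0)%E <->
    forall l p q, (l + p + q).+2 = n -> terms l p q.
  rewrite trop_sum_expr_le0; split=> [h l p q sz|h l ln].
    have := h l ltac:(lia); rewrite trop_sum_expr_le0 => /(_ p ltac:(lia)).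
    have -> : (n.-2 - l - p = q)%N by lia.
    by rewrite /= ge_max => /andP[].
  rewrite trop_sum_expr_le0 => p pn; rewrite [trop _ _]/= ge_max.
  by apply/andP; apply: h; lia.
split=> [h|[h3 h1] l p q sz].
  by split=> l p q sz; have [] := (termsE l p q sz).1 (h l p q sz).
by apply/(termsE l p q sz); split; [apply: h3|apply: h1].
Qed.

End PotentialExpression.

Section VariableExpressions.
Variables (R : realType) (n : nat) (P : nat -> nat -> nat -> bool).
Local Notation C := R[i].

Definition var_expr (i j k : nat) : expr C (Delta3_sub n P) :=
  if delta_point n P i j k is Some s then Var C s else Const _ 1.

Lemma var_expr_sf i j k : subtraction_free (var_expr i j k).
Proof. by rewrite /var_expr; case: delta_point => //=; rewrite ler01. Qed.

Lemma var_expr_defined t i j k : defined_at t (var_expr i j k).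
Proof. by rewrite /var_expr; case: delta_point. Qed.

Lemma eval_var_expr (m : nat -> nat -> nat -> C) i j k : (i + j + k <= n)%N -> P i j k ->
  eval (at_Delta3 m) (var_expr i j k) = m i j k.
Proof.
move=> ijk Pijk; rewrite /var_expr; case e: delta_point => [s|].
  by rewrite /at_Delta3 /= (delta_point_Some e) /= !inordK//; lia.
by have := delta_point_None ijk e; rewrite Pijk.
Qed.

End VariableExpressions.

(** * Pullbacks and tropical values on the chart *)

Section PositivePoints.
Variables (R : realType) (n : nat).
Local Notation C := R[i].
Local Notation A := (invariants R n).
Local Notation idx := (Delta3_sub n chart_index).
Local Notation torus := (torus R idx).

Lemma exp_point_gt0 (x : idx -> R) s i : 0 < exp_point x s i.
Proof. by rewrite /exp_point ltcR expR_gt0. Qed.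

Definition exp_torus (x : idx -> R) (s : R) : torus :=
  @Torus R idx [ffun i => exp_point x s i]
    (fun i => eq_ind_r (fun z => z != 0) (lt0r_neq0 (exp_point_gt0 x s i)) (ffunE _ i)).

Lemma exp_torusE x s : (exp_torus x s : idx -> C) = exp_point x s.
Proof. by apply: funext => i; rewrite /= ffunE. Qed.

Variable th : torus -> spec_pt A.

(** A pullback gives equality only where e is defined. One such point excludes vanishing
    denominators, and then e is defined on the whole ray. *)
Lemma pullback_exp_point (f : ratfun A) (e : expr C idx) : (forall t, th t (rden f) != 0) ->
  subtraction_free e -> pullback_is th f e ->
  nonzero_dens e /\ forall x s, 0 <= s ->
    eval (exp_point x s) e = th (exp_torus x s) (rnum f) / th (exp_torus x s) (rden f).
Proof.
move=> den0 sf [[t /andP[_ /defined_nonzero_dens nz]] h]; split=> // x s s0.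
by rewrite h// exp_torusE//; apply: nonzero_dens_defined.
Qed.

Lemma pullback_of_eval (f : ratfun A) (e : expr C idx) : (forall t, th t (rden f) != 0) ->
  subtraction_free e -> nonzero_dens e ->
  (forall t : torus, defined_at t e -> th t (rnum f) / th t (rden f) = eval t e) ->
  pullback_is th f e.
Proof.
move=> den0 sf nz h; split=> [|t _]; last exact: h.
exists (exp_torus (fun=> 0) 0); rewrite den0 /= exp_torusE.
exact: nonzero_dens_defined.
Qed.

End PositivePoints.

Section ThetaChart.
Variables (R : realType) (n : nat).
Local Notation C := R[i].
Local Notation A := (invariants R n).
Local Notation idx := (Delta3_sub n chart_index).
Local Notation torus := (torus R idx).
Local Notation Mbar := (@Mbar R n).

Lemma spec_pt_pluecker (p : spec_pt A) : pluecker n (fun i j k => p (Mbar i j k) : C).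
Proof. by move=> i j k ijk; rewrite -!rmorphM -rmorphD Mbar_pluecker. Qed.

Variable sigma : torus -> GL3 R n.
Hypothesis sigma_faces : forall t i j k, (i + j + k <= n)%N -> on_k0_i0 i j k ->
    multi_corner i j k (sigma t) = face_value t i j k.
Local Notation th := (theta sigma).

Lemma theta_face t i j k : (i + j + k <= n)%N -> on_k0_i0 i j k ->
  th t (Mbar i j k) = face_value t i j k.
Proof. by apply: face_value_chart => s; rewrite thetaM. Qed.

Lemma eval_var_expr_chart (t : torus) i j k :
  eval t (var_expr R n chart_index i j k) = face_value t i j k.
Proof. by rewrite /var_expr /face_value; case: delta_point. Qed.

Lemma theta_exp_torus_gt0 x s i j k : (i + j + k <= n)%N ->
  0 < (th (exp_torus x s) (Mbar i j k) : C).
Proof.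
apply: (pluecker_face_gt0 (spec_pt_pluecker _)) => a b c abc face.
rewrite theta_face// /face_value; case: delta_point => [u|]; last exact: ltr01.
by rewrite exp_torusE exp_point_gt0.
Qed.

Lemma theta_exp_torus_neq0 x s i j k : (i + j + k <= n)%N ->
  (th (exp_torus x s) (Mbar i j k) : C) != 0.
Proof. by move=> ijk; rewrite gt_eqF// theta_exp_torus_gt0. Qed.

Lemma rden_regfun_theta (t : torus) (f : A) : th t (rden (regfun f)) != 0.
Proof. by rewrite rmorph1 oner_eq0. Qed.

Lemma theta_regfun (t : torus) (f : A) :
  (th t (rnum (regfun f)) : C) / th t (rden (regfun f)) = th t f.
Proof. by rewrite [th t (rden _)]rmorph1 divr1. Qed.

Lemma Mbar_positive i j k : (i + j + k <= n)%N ->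
  positive_ratfun th (regfun (Mbar i j k)).
Proof.
move=> ijk; have [e sf sol] := solve_k0_i0 (@var_expr_sf R n chart_index) ijk.
have sol_at (t : torus) := sol t _ (spec_pt_pluecker (th t)).
have base (t : torus) a b c : (a + b + c <= n)%N -> on_k0_i0 a b c ->
    defined_at t (var_expr R n chart_index a b c) /\
    th t (Mbar a b c) = eval t (var_expr R n chart_index a b c).
  by move=> abc face; rewrite var_expr_defined eval_var_expr_chart theta_face.
exists e => //; apply: pullback_of_eval => // [t||t de].
- exact: rden_regfun_theta.
- have [_] := sol_at _ (base (exp_torus (fun=> 0) 0)).
  move=> /(_ (fun a b c abc => theta_exp_torus_neq0 _ _ abc)).
  exact: defined_nonzero_dens.
by rewrite theta_regfun; have [h _] := sol_at _ (base t); apply: h.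
Qed.

Lemma Mbar_rational P (solve : forall I (E0 : nat -> nat -> nat -> expr C I),
    (forall i j k, subtraction_free (E0 i j k)) ->
    forall i j k, (i + j + k <= n)%N ->
    exists2 e, subtraction_free e & solves_at n P E0 i j k e) i j k :
  (i + j + k <= n)%N ->
  exists e : expr C (Delta3_sub n P),
    pluecker_solves i j k e /\ rational_in (at_Delta3 Mbar) (Mbar i j k) e.
Proof.
move=> ijk; have [e _ sol] := solve _ _ (@var_expr_sf R n P) _ _ _ ijk.
have base (m : nat -> nat -> nat -> C) a b c : (a + b + c <= n)%N -> P a b c ->
    defined_at (at_Delta3 m) (var_expr R n P a b c) /\
    m a b c = eval (at_Delta3 m) (var_expr R n P a b c).
  by move=> abc Pabc; rewrite var_expr_defined eval_var_expr.
exists e; split; first by move=> m m0 pl; have [v d] := sol _ _ pl (base m); split; auto.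
pose mp (p : spec_pt A) i j k : C := p (Mbar i j k).
have sol_at p := sol _ (mp p) (spec_pt_pluecker p) (base (mp p)).
split.
  exists (th (exp_torus (fun=> 0) 0)).
  by have [_] := sol_at (th (exp_torus (fun=> 0) 0)); apply => a b c abc; apply: theta_exp_torus_neq0.
by move=> p; have [h _] := sol_at p; apply: h.
Qed.

Variable Phibar : ratfun A.
Hypothesis Phibar_den : forall t, th t (rden Phibar) != 0.
Hypothesis PhibarE : forall t, th t (rnum Phibar) / th t (rden Phibar)
  = face_potential n (face_value t).

Lemma Phibar_positive : positive_ratfun th Phibar.
Proof.
exists (potential_expr n (var_expr R n chart_index)).
  by apply: subtraction_free_potential_expr => *; apply: var_expr_sf.
apply: pullback_of_eval => // [||t _].
- by apply: subtraction_free_potential_expr => *; apply: var_expr_sf.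
- apply: nonzero_dens_potential_expr => i j k; rewrite /var_expr; case: delta_point => //=.
  by rewrite oner_eq0.
rewrite eval_potential_expr PhibarE; congr face_potential.
by apply: funext => i; apply: funext => j; apply: funext => k; rewrite eval_var_expr_chart.
Qed.

Section Tropical.
Variable Mt : nat -> nat -> nat -> (idx -> R) -> \bar R.
Hypothesis Mt_trop : forall i j k, (i + j + k <= n)%N ->
  tropicalization th (regfun (Mbar i j k)) (Mt i j k).
Variable x : idx -> R.

(** [Mt] comes from unspecified expressions. They are chosen here, with real tropical values because
    the minors are nonzero at positive points. *)
Lemma tropical_values : exists (E : nat -> nat -> nat -> expr C idx)
    (r : nat -> nat -> nat -> R), [/\
  forall i j k, subtraction_free (E i j k),
  forall i j k, nonzero_dens (E i j k),
  forall i j k, ~~ zero_expr (E i j k),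
  forall i j k, trop x (E i j k) = (r i j k)%:E &
  forall i j k, (i + j + k <= n)%N -> Mt i j k x = (r i j k)%:E /\
    forall s, 0 <= s ->
      eval (exp_point x s) (E i j k) = th (exp_torus x s) (Mbar i j k)].
Proof.
have H (u : nat * nat * nat) : exists er : expr C idx * R, [/\
    subtraction_free er.1, nonzero_dens er.1, ~~ zero_expr er.1, trop x er.1 = er.2%:E &
    (u.1.1 + u.1.2 + u.2 <= n)%N -> Mt u.1.1 u.1.2 u.2 x = er.2%:E /\
    forall s, 0 <= s ->
      eval (exp_point x s) er.1 = th (exp_torus x s) (Mbar u.1.1 u.1.2 u.2)].
  case: u => [[i j] k] /=; have [ijk|_] := leqP (i + j + k) n; last first.
    (* A harmless filler outside the simplex, so that the conditions hold for all indices. *)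
    exists (Const _ 1, 0); split=> //=; rewrite ?ler01 ?oner_eq0//.
  have [e [sf pb tE]] := Mt_trop ijk.
  have [nz ev] := pullback_exp_point (fun t => rden_regfun_theta t _) sf pb.
  have ev' s : 0 <= s -> eval (exp_point x s) e = th (exp_torus x s) (Mbar i j k).
    by move=> s0; rewrite ev// theta_regfun.
  have e0 : eval (exp_point x 0) e != 0 by rewrite ev'// theta_exp_torus_neq0.
  have [r tr] := trop_real x sf nz e0.
  exists (e, r); split=> //=; first by apply: contra e0 => /zero_expr_eval->.
  by rewrite tE.
have [f fP] := choice H.
exists (fun i j k => (f (i, j, k)).1), (fun i j k => (f (i, j, k)).2).
by split=> i j k; have [] := fP (i, j, k).
Qed.

(** Both sides of the Plücker relation are subtraction-free and agree along the ray, so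
    [trop_unique] applies. *)
Lemma tropical_octahedron (E : nat -> nat -> nat -> expr C idx) r :
  (forall i j k, subtraction_free (E i j k)) ->
  (forall i j k, nonzero_dens (E i j k)) ->
  (forall i j k, trop x (E i j k) = (r i j k)%:E) ->
  (forall i j k, (i + j + k <= n)%N -> forall s, 0 <= s ->
      eval (exp_point x s) (E i j k) = th (exp_torus x s) (Mbar i j k)) ->
  forall i j k, (i + j + k + 2 <= n)%N ->
    r i.+1 j k.+1 + r i j.+1 k
    = Num.max (r i j.+1 k.+1 + r i.+1 j k) (r i j k.+1 + r i.+1 j.+1 k).
Proof.
move=> sf nz tE ev i j k ijk.
have := @trop_unique R idx x (Mul (E i.+1 j k.+1) (E i j.+1 k))
  (Add (Mul (E i j.+1 k.+1) (E i.+1 j k)) (Mul (E i j k.+1) (E i.+1 j.+1 k))).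
rewrite /= !sf !nz !tE => /(_ isT isT isT isT).
rewrite -!EFinD -EFin_max => h; apply: EFin_inj; apply: h => s s0.
by rewrite !ev//; try lia; apply: spec_pt_pluecker.
Qed.

Lemma tropical_potential Phit : tropicalization th Phibar Phit ->
  (Phit x <= 0)%E <-> rhombus_inequalities n (fun i j k => Mt i j k x).
Proof.
move=> [e [sf pb ->]].
have [E [r [Esf Enz Ez tE MtE]]] := tropical_values.
have [nz ev] := pullback_exp_point Phibar_den sf pb.
have ex i j k ijk := (MtE i j k ijk).2.
(* The potential is rewritten in the expressions chosen for the minors, so that its tropical value
   involves the same numbers r as the rhombi. *)
have -> : trop x e = trop x (potential_expr n E).
  apply: trop_unique => //.
  - exact: subtraction_free_potential_expr.
  - exact: nonzero_dens_potential_expr.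
  move=> s s0; rewrite ev// PhibarE eval_potential_expr.
  by apply: face_potential_ext => i j k ijk face; rewrite ex// theta_face.
rewrite (trop_potential_expr_le0 (r := r)); last by move=> *; apply: tE.
rewrite (rhombus_face_inequalities (r := r))//.
  by move=> i j k ijk; have [] := MtE i j k ijk.
exact: (tropical_octahedron Esf Enz tE ex).
Qed.

Lemma tropical_recurrence : octahedron_recurrence n (fun i j k => Mt i j k x).
Proof.
have [E [r [Esf Enz _ tE MtE]]] := tropical_values.
have ex i j k ijk := (MtE i j k ijk).2.
have mt i j k ijk := (MtE i j k ijk).1.
move=> i j k ijk; rewrite !mt; try lia.
by rewrite -!EFinD -EFin_max; congr (_%:E); apply: (tropical_octahedron Esf Enz tE ex).
Qed.

End Tropical.

End ThetaChart.

Unset Implicit Arguments.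

Theorem theorem2p8 (R : realType) (n : nat) (n_gt0 : (0 < n)%N) :
  exists (Mbar : nat -> nat -> nat -> invariants R n)
         (Phibar : ratfun (invariants R n))
         (theta : torus R (Delta3_sub n chart_index) ->
                  spec_pt (invariants R n)),
    (* Mbar and Phibar are induced by the multi-corner minors and Phi_3 *)
    ((forall i j k, (i + j + k <= n)%N ->
        forall g : GL3 R n, Mbar i j k g = multi_corner i j k g) /\
     (forall g : GL3 R n, Phi3_defined g ->
        rnum Phibar g = Phi3 g * rden Phibar g)) /\
    [/\ (* (a) *)
        [/\ positive_structure Phibar [set theta]%classic,
            (forall s, coordinate_function theta s (regfun (at_Delta3 Mbar s)))
          & (forall i j k, (i + j + k <= n)%N ->
               positive_ratfun theta (regfun (Mbar i j k)))],
        (* (b) *)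
        [/\ pluecker n Mbar,
            (forall i j k, (i + j + k <= n)%N ->
               exists e : expr R[i] (Delta3_sub n on_k0_i0),
                 pluecker_solves i j k e /\
                 rational_in (at_Delta3 Mbar) (Mbar i j k) e)
          & (forall i j k, (i + j + k <= n)%N ->
               exists e : expr R[i] (Delta3_sub n (on_top_j0 n)),
                 pluecker_solves i j k e /\
                 rational_in (at_Delta3 Mbar) (Mbar i j k) e)],
        (* (c) *)
        (forall (Phit : (Delta3_sub n chart_index -> R) -> \bar R)
                (Mt : nat -> nat -> nat ->
                      (Delta3_sub n chart_index -> R) -> \bar R),
           tropicalization theta Phibar Phit ->
           (forall i j k, (i + j + k <= n)%N ->
              tropicalization theta (regfun (Mbar i j k)) (Mt i j k)) ->
           forall x, (Phit x <= 0)%E <->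
                     rhombus_inequalities n (fun i j k => Mt i j k x))
      & (* (d) *)
        (forall Mt : nat -> nat -> nat ->
                     (Delta3_sub n chart_index -> R) -> \bar R,
           (forall i j k, (i + j + k <= n)%N ->
              tropicalization theta (regfun (Mbar i j k)) (Mt i j k)) ->
           forall x, octahedron_recurrence n (fun i j k => Mt i j k x))].
Proof.
have [sigma [s_laurent s_normal s_faces]] := normal_section R n.
have [Phibar [Phi_ind Phi_val]] := induced_potential s_faces.
have Phi_den t := (Phi_val t).1; have PhiE t := (Phi_val t).2.
exists (Mbar R n), Phibar, (theta sigma); split.
  by split=> [i j k ijk g|g _]; [exact: MbarE|exact: Phi_ind].
split.
- split=> [|s|i j k ijk].
  (* With a single chart a coordinate function pulls back to a variable, which is
     subtraction-free. *)
  + split=> [_ ->|_ _ -> -> s r rP]; last by exists (Var _ s).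
    split; first exact: theta_embedding.
    exact: Phibar_positive.
  + split=> [|t _ _]; last by rewrite theta_regfun thetaM.
    by exists (torus1 R n); rewrite rden_regfun_theta.
  + exact: Mbar_positive.
- split; first exact: Mbar_pluecker.
  + by move=> i j k; apply: (Mbar_rational s_faces) => I; apply: solve_k0_i0.
  + by move=> i j k; apply: (Mbar_rational s_faces) => I; apply: solve_top_j0.
- move=> Phit Mt PhitP MtP x; exact: (tropical_potential s_faces Phi_den PhiE MtP x PhitP).
- move=> Mt MtP x; exact: (tropical_recurrence s_faces MtP x).
Qed.
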